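(* Let $s\in(1/2,1)$, let $K:\mathbb{R}^d\setminus\{0\}\to\mathbb{R}$ be measurable with $\lambda_K|y|^{-(d+2s)}\le K(y)\le\Lambda|y|^{-(d+2s)}$ for all $y\ne0$, for some constants $0<\lambda_K\le\Lambda<\infty$. Let $\alpha\ge0$, $f\in C(\mathbb{R}^d)$, and let $H\in C(\mathbb{R}^d\times\mathbb{R}^d)$ satisfy: there exists $m\ge1$ such that for each $R>0$ there is $C_{H,R}>0$ with $$|H(x,p+q)-H(y,p)|\le C_{H,R}\big[|x-y|(1+|p|^m)+|q|(|p|^{m-1}+|q|^{m-1})\big]$$ for all $x,y\in B_R$ and $p,q\in\mathbb{R}^d$ with $|q|\le R$. If $m\ge2s+1$, assume further that there is a constant $\kappa>0$ with $\frac1\kappa|p|^m-\kappa\le H(x,p)$ for all $x,p\in\mathbb{R}^d$. For $R>0$, let $u\in C(\mathbb{R}^d)\cap L^1(\omega_s)$ be a viscosity solution of $$\alpha u-Iu+H(x,\nabla u)-f(x)=0\quad\text{in }B_{R+2}.$$ Then there exists a constant $C_R>0$ such that $|u(x)-u(y)|\le C_R|x-y|$ for all $x,y\in B_R$. Moreover $C_R$ can be estimated as follows: for each $\theta_0\in(0,1)$ small enough there exists $C>0$, depending only on the data but not on $R$ nor $u$, such that $C_R$ has the form $$C_R=C\,C_{H,R+2}^{\frac1{1-\theta_0}}\max\{\mathfrak Z_1,\mathfrak Z_2\}^{\frac{m-\theta_0}{1-\theta_0}}\quad\text{when }m\ge2s+1,$$ $$C_R=C\,C_{H,R+2}^{\frac1{2s+1-m-\theta_0}}\,\mathfrak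 Z_2^{\frac{2s-\theta_0}{2s+1-m-\theta_0}}\quad\text{when }m<2s+1,$$ where, with $\gamma_0=\frac{m-2s}{m-1}$ and $A=1+\sup_{B_{R+2}}f^+-\alpha\inf_{B_{R+2}}u^-+\mathscr H(u,B_{R+2})$, $$\mathfrak Z_1=R^{1-\gamma_0}\big(A^{1/m}+\mathrm{osc}_{B_{R+2}}u\big),\qquad \mathfrak Z_2=1+\mathrm{osc}_{B_{R+2}}u+\mathrm{osc}_{B_{R+2}}f+\mathscr H(u,B_{R+2}).$$
   Context: $B_r$ is the ball of radius $r$ centered at $0$, $B=B_1$, $\chi_E$ the indicator function of $E$, $a^+=\max\{a,0\}$, $a^-=\min\{a,0\}$, $\mathrm{osc}_Eu=\sup_Eu-\inf_Eu$. $L^1(\omega_s)=\{u\in L^1_{loc}(\mathbb{R}^d):\int|u(y)|(1+|y|^{d+2s})^{-1}dy<\infty\}$. No symmetry of $K$ is assumed. $$Iu(x)=\int_{\mathbb{R}^d}\big(u(x+y)-u(x)-\chi_B(y)\,y\cdot\nabla u(x)\big)K(y)\,dy,\qquad \mathscr H(u,E)=\sup_{x\in E}\int_{\mathbb{R}^d}\frac{|u(x+y)-u(x)|}{1+|y|^{d+2s}}\,dy .$$ Put $I[E](u,p,x)=\int_E(u(x+y)-u(x)-\chi_B(y)y\cdot p)K(y)dy$. Viscosity subsolution (inequality $\le0$) in an open set $D$: whenever $x_0\in D$, $\delta>0$, $\varphi$ is $C^2$ near $\overline{B_\delta(x_0)}$ and $u-\varphi$ has a maximum over $B_\delta(x_0)$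 at $x_0$, then $\alpha u(x_0)-I[B_\delta](\varphi,\nabla\varphi(x_0),x_0)-I[B_\delta^c](u,\nabla\varphi(x_0),x_0)+H(x_0,\nabla\varphi(x_0))-f(x_0)\le0$. Supersolutions are defined analogously with minima and $\ge0$; a solution is both. ''The data'' means $d,s,m,\lambda_K,\Lambda,\kappa,\alpha$ and $\theta_0$ (the dependence on the local constant of $H$ being displayed through $C_{H,R+2}$).
   Formalization: When m≥2s+1, C may also depend on a positive lower bound for R; when m<2s+1, on a positive lower bound for C_{H,R+2}. With C uniform as R→0, resp. as C_{H,R+2}→0 (e.g. H=0, α=0, f=−Iu, u nonconstant), the stated estimate is false. *)

(* Defs.v *)
From HB Require Import structures.
From mathcomp Require Import all_boot all_order all_algebra.
From mathcomp Require Import all_classical all_reals all_analysis.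

Set Implicit Arguments.
Unset Strict Implicit.
Unset Printing Implicit Defensive.

Import Order.TTheory GRing.Theory Num.Theory.
Import numFieldNormedType.Exports.

Local Open Scope classical_set_scope.
Local Open Scope ring_scope.

(* The space R^d, d >= 1, is 'rV[R]_n.+1 with d = n.+1.  The norm that the
   library puts on row vectors is the sup norm: it yields the right topology,
   but balls and lengths below are the Euclidean ones. *)

Section euclidean.
Context {R : realType} {n : nat}.
Implicit Types x y p : 'rV[R]_n.+1.

Definition dotp x y : R := \sum_i x 0 i * y 0 i.

Definition enorm x : R := Num.sqrt (dotp x x).

Definition eball x (r : R) : set 'rV[R]_n.+1 := [set y | enorm (y - x) < r].

Definition eclosed_ball x (r : R) : set 'rV[R]_n.+1 :=
  [set y | enorm (y - x) <= r].

End euclidean.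

(* Lebesgue measure on R^d: infimum of the total volume of countable covers by
   half-open boxes, restricted to the Caratheodory (i.e. Lebesgue) measurable
   sets. *)

Section lebesgue_outer.
Local Open Scope ereal_scope.
Context (R : realType) (n : nat).
Implicit Types A : set 'rV[R]_n.+1.

Definition box (c : 'rV[R]_n.+1 * 'rV[R]_n.+1) : set 'rV[R]_n.+1 :=
  [set x | forall i, (c.1 0%R i < x 0%R i <= c.2 0%R i)%R].

Definition box_volume (c : 'rV[R]_n.+1 * 'rV[R]_n.+1) : \bar R :=
  (\prod_i Num.max 0 (c.2 0 i - c.1 0 i))%R%:E.

Definition box_cover A : set (nat -> 'rV[R]_n.+1 * 'rV[R]_n.+1) :=
  [set c | A `<=` \bigcup_k box (c k)].

Definition lebesgue_outer A : \bar R :=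
  ereal_inf [set \sum_(k <oo) box_volume (c k) | c in box_cover A].

Lemma box_volume_ge0 c : 0 <= box_volume c.
Proof.
by rewrite lee_fin; apply: prodr_ge0 => i _; rewrite le_max lexx.
Qed.

Lemma lebesgue_outer_ge0 A : 0 <= lebesgue_outer A.
Proof.
apply: le_ereal_inf_tmp => _ [c _ <-].
by apply: nneseries_ge0 => k _ _; exact: box_volume_ge0.
Qed.

Lemma lebesgue_outer0 : lebesgue_outer set0 = 0.
Proof.
apply/eqP; rewrite eq_le lebesgue_outer_ge0 andbT.
apply: ereal_inf_lbound; exists (fun=> (0%R, 0%R)) => //=.
apply: eseries0 => k _ _.
by rewrite /box_volume (bigD1 ord0)//= subrr maxxx mul0r.
Qed.

Lemma le_lebesgue_outer : {homo lebesgue_outer : A B / A `<=` B >-> A <= B}.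
Proof.
move=> A B AB; apply/ereal_inf_le_tmp => _ [c cB <-].
by exists c => //; exact: subset_trans AB cB.
Qed.

Lemma lebesgue_outer_sigma_subadditive : sigma_subadditive lebesgue_outer.
Proof.
move=> A; have [[i ioo]|] := pselect (exists i, lebesgue_outer (A i) = +oo).
  rewrite (eseries_pinfty _ _ ioo) ?leey// => k _.
  by rewrite -ltNye (lt_le_trans _ (lebesgue_outer_ge0 _)).
rewrite -forallNE => Aoo.
suff add2e (e : {posnum R}) : lebesgue_outer (\bigcup_k A k) <=
    \sum_(i <oo) lebesgue_outer (A i) + e%:num%:E.
  by apply/lee_addgt0Pr => _/posnumP[].
rewrite (le_trans _ (epsilon_trick _ _ _))//; last first.
  by move=> k; exact: lebesgue_outer_ge0.
pose P k c := box_cover (A k) c /\ \sum_(j <oo) box_volume (c j) <=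
  lebesgue_outer (A k) + (e%:num / (2 ^ k.+1)%:R)%:E.
have [G PG] : {G : nat -> nat -> 'rV[R]_n.+1 * 'rV[R]_n.+1 &
    forall k, P k (G k)}.
  apply: (@choice _ _ P) => k; rewrite /P /lebesgue_outer.
  set S := (X in ereal_inf X); move infS : (ereal_inf S) => iS.
  case: iS infS => [r Sr|Soo|Soo].
  - have en1 : (0 < e%:num / (2 ^ k.+1)%:R)%R by [].
    have /(lb_ereal_inf_adherent en1) : ereal_inf S \is a fin_num by rewrite Sr.
    move=> [_ [c cA <-] xS].
    by exists c; split => //; rewrite -Sr; exact/ltW.
  - by have := Aoo k; rewrite /lebesgue_outer Soo.
  - by have := lebesgue_outer_ge0 (A k); rewrite /lebesgue_outer Soo.
pose vG (z : nat * nat) := box_volume (G z.1 z.2).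
have vG_ge0 z : 0 <= vG z by exact: box_volume_ge0.
apply: (@le_trans _ _ (\esum_(i in setT) vG i)).
  apply: ereal_inf_lbound => /=.
  have /card_esym/ppcard_eqP[f] := card_nat2.
  exists (fun k => G (f k).1 (f k).2).
    move=> t [i _ Ait]; have [j _ Gijt] := (PG i).1 t Ait.
    by exists (f^-1%FUN (i, j)) => //=; rewrite invK ?inE.
  rewrite -(esum_pred_image vG _ xpredT) ?[fun=> _]set_true//.
  by rewrite image_eq.
rewrite (_ : esum _ _ = \sum_(i <oo) \sum_(j <oo) box_volume (G i j)).
  apply: lee_lim.
  - apply: is_cvg_nneseries => k *.
    by apply: nneseries_ge0 => m *; exact: box_volume_ge0.
  - apply: is_cvg_nneseries => k *; apply: adde_ge0 => //.
    exact: lebesgue_outer_ge0.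
  - by near=> k; apply: lee_sum => i _; exact: (PG i).2.
pose J : nat -> set (nat * nat) := fun i => [set (i, j) | j in setT].
rewrite (_ : setT = \bigcup_k J k); last first.
  by rewrite predeqE => -[a b]; split => // _; exists a => //; exists b.
rewrite esum_bigcupT /=; last 2 first.
  - apply/trivIsetP => i j _ _ ij.
    rewrite predeqE => -[k m] /=; split => //= -[] [_] _ [<-{k} _].
    by move=> [m' _] [] /esym/eqP; rewrite (negbTE ij).
  - by move=> z; exact: vG_ge0.
rewrite -(image_id [set: nat]) -fun_true esum_pred_image//; last first.
  by move=> k _; exact: esum_ge0.
apply: eq_eseriesr => /= j _.
rewrite -(esum_pred_image vG (pair j) predT)//=; last first.
  by move=> ? ? _ _; exact: (@can_inj _ _ _ snd).
by congr esum; rewrite predeqE => -[a b]; split; move=> [i _ <-]; exists i.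
Unshelve. all: by end_near. Qed.

HB.instance Definition _ := isOuterMeasure.Build R 'rV[R]_n.+1 lebesgue_outer
  lebesgue_outer0 lebesgue_outer_ge0 le_lebesgue_outer
  lebesgue_outer_sigma_subadditive.

Definition leb_rV : Type := caratheodory_type lebesgue_outer.

HB.instance Definition _ := Measurable.on leb_rV.

Definition leb : set leb_rV -> \bar R := lebesgue_outer.

HB.instance Definition _ := isMeasure.Build _ leb_rV R leb
  (@caratheodory_measure0 _ _ lebesgue_outer)
  (@caratheodory_measure_ge0 _ _ lebesgue_outer)
  (@caratheodory_measure_sigma_additive _ _ lebesgue_outer).

End lebesgue_outer.

Arguments leb_rV : clear implicits.
Arguments leb : clear implicits.

Section smooth_functions.
Context {R : realType} {n : nat}.
Implicit Types (phi : 'rV[R]_n.+1 -> R) (x : 'rV[R]_n.+1).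

Definition pderive (i : 'I_n.+1) phi : 'rV[R]_n.+1 -> R :=
  fun x => 'D_(delta_mx 0 i) phi x.

Definition gradient phi x : 'rV[R]_n.+1 := \row_i pderive i phi x.

Definition C0_on (U : set 'rV[R]_n.+1) phi :=
  forall x, U x -> {for x, continuous phi}.

Definition C1_on (U : set 'rV[R]_n.+1) phi :=
  C0_on U phi /\
  forall i, (forall x, U x -> derivable phi x (delta_mx 0 i)) /\
            C0_on U (pderive i phi).

Definition C2_on (U : set 'rV[R]_n.+1) phi :=
  C1_on U phi /\ forall i, C1_on U (pderive i phi).

Definition C2_near (E : set 'rV[R]_n.+1) phi :=
  exists U, [/\ open U, E `<=` U & C2_on U phi].

Definition osc (E : set 'rV[R]_n.+1) phi : R := sup (phi @` E) - inf (phi @` E).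

End smooth_functions.

Section nonlocal.
Context {R : realType} {n : nat}.
Local Notation V := 'rV[R]_n.+1.
Local Notation mu := (leb R n).
Implicit Types (K : V -> R) (u phi f : V -> R) (H : V -> V -> R) (x p : V).

(* 1 + |y|^(d + 2s) *)
Definition weight (s : R) (y : V) : R := 1 + enorm y `^ (n.+1%:R + 2 * s).

Definition L1_loc u :=
  forall E : set V, compact E -> mu.-integrable E (fun y : leb_rV R n => (u y)%:E).

Definition L1_weighted (s : R) u :=
  L1_loc u /\
  (\int[mu]_(y in [set: leb_rV R n]) (`|u y| / weight s y)%:E < +oo)%E.

(* the tail quantity; it is finite when [E] is bounded and [u] is continuous
   and in [L1_weighted s] *)
Definition tail (s : R) u (E : set V) : R :=
  fine (ereal_sup
    [set (\int[mu]_(y in [set: leb_rV R n]) (`|u (x + y) - u x| / weight s y)%:E)%E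
    | x in E]).

(* [K] lives on R^d \ {0}: its value at the origin is irrelevant. *)
Definition kernel_bounds (s lambda Lambda : R) K :=
  measurable_fun (~` [set (0 : V)] : set (leb_rV R n)) (K : leb_rV R n -> R) /\
  forall y, y != 0 ->
    lambda * enorm y `^ (- (n.+1%:R + 2 * s)) <= K y
      <= Lambda * enorm y `^ (- (n.+1%:R + 2 * s)).

Definition nonlocal K (E : set V) u p x : R :=
  \int[mu]_(y in (E : set (leb_rV R n)))
     ((u (x + y) - u x - \1_(eball 0 1) y * dotp y p) * K y).

Definition growth (m : R) H (CH : R -> R) :=
  forall r, 0 < r -> 0 < CH r /\
    forall x y p q, eball 0 r x -> eball 0 r y -> enorm q <= r ->
      `|H x (p + q) - H y p| <=
        CH r * (enorm (x - y) * (1 + enorm p `^ m) +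
                enorm q * (enorm p `^ (m - 1) + enorm q `^ (m - 1))).

Definition coercive (m kappa : R) H :=
  forall x p, kappa^-1 * enorm p `^ m - kappa <= H x p.

(* The operator of the equation alpha u - I u + H(x, grad u) - f = 0 evaluated
   at [x] on the test function [phi] inside the ball of radius [delta] and on
   [u] outside.  Both integrals converge for the functions it is used with. *)
Definition test_operator (alpha : R) K H f u phi (delta : R) x : R :=
  alpha * u x
  - nonlocal K (eball 0 delta) phi (gradient phi x) x
  - nonlocal K (~` eball 0 delta) u (gradient phi x) x
  + H x (gradient phi x) - f x.

Definition viscosity_subsolution (alpha : R) K H f (D : set V) u :=
  forall x0 delta phi, D x0 -> 0 < delta ->
    C2_near (eclosed_ball x0 delta) phi ->
    (forall y, eball x0 delta y -> u y - phi y <= u x0 - phi x0) ->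
    test_operator alpha K H f u phi delta x0 <= 0.

Definition viscosity_supersolution (alpha : R) K H f (D : set V) u :=
  forall x0 delta phi, D x0 -> 0 < delta ->
    C2_near (eclosed_ball x0 delta) phi ->
    (forall y, eball x0 delta y -> u x0 - phi x0 <= u y - phi y) ->
    0 <= test_operator alpha K H f u phi delta x0.

Definition viscosity_solution (alpha : R) K H f (D : set V) u :=
  viscosity_subsolution alpha K H f D u /\
  viscosity_supersolution alpha K H f D u.

Definition lipschitz_on_ball (r L : R) u :=
  forall x y, eball 0 r x -> eball 0 r y -> `|u x - u y| <= L * enorm (x - y).

Definition Aconst (s alpha r : R) f u : R :=
  1 + sup [set Num.max (f x) 0 | x in eball 0 (r + 2)]
  - alpha * inf [set Num.min (u x) 0 | x in eball 0 (r + 2)]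
  + tail s u (eball 0 (r + 2)).

Definition gamma0 (s m : R) : R := (m - 2 * s) / (m - 1).

Definition Z1 (s m alpha r : R) f u : R :=
  r `^ (1 - gamma0 s m) *
  (Aconst s alpha r f u `^ m^-1 + osc (eball 0 (r + 2)) u).

Definition Z2 (s r : R) f u : R :=
  1 + osc (eball 0 (r + 2)) u + osc (eball 0 (r + 2)) f
  + tail s u (eball 0 (r + 2)).

End nonlocal.

(* Main.v *)
Require Import Defs.
From HB Require Import structures.
From mathcomp Require Import all_boot all_order all_algebra.
From mathcomp Require Import all_classical all_reals all_analysis.
From mathcomp Require Import measurable_realfun.
From mathcomp Require Import ring lra.

(* Ishii-Lions doubling.  For x0 in B_r, maximize
     u(x) - u(y) - L phi(|x - y|) - M |x - x0|^2,  phi(t) = t - t^(1 + th) / 4,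
   near the diagonal, with M = 16 Z2.  If the maximum is positive, it is attained
   at some x <> y, and subtracting the two viscosity inequalities cancels the
   large slope p.  With a = x - y, the strict concavity of phi on a small cube
   around (3 / 16) a produces the gain c L |a|^(1 - 2 s + th (1 + d / 2)), while
   all the other terms are bounded by C (Z2 + CH Z2 L^(m - 1)).  This is a
   contradiction for large L as soon as |a| is small in terms of L: |a| <= C Z2 / L
   always, and, when m >= 2 s + 1, |a|^(1 - gamma0) <= C Z / L by a gamma0-Hoelder
   estimate, for which the term |p|^m of the coercive Hamiltonian balances the
   nonlocal operator on the barrier L |x - c|^gamma0.  The barriers are concave
   functions of the distance, hence lie below paraboloids touching them at the
   maximum point, so quadratic test functions suffice. *)

Set Implicit Arguments.
Unset Strict Implicit.
Unset Printing Implicit Defensive.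

Import Order.TTheory GRing.Theory Num.Theory.
Import numFieldNormedType.Exports.

Local Open Scope classical_set_scope.
Local Open Scope ring_scope.

(** Since [K] need not be symmetric, the drift does not cancel inside one nonlocal term. It is
    affordable because 2 s > 1: the integral of |z| K(z) outside B_rho is of order rho^(1 - 2 s),
    which is the scaling of the second order part inside B_rho. [riesz] measures both at once. In
    the doubling step only the slope [q] of the penalization, of size Z2, is left of the drift.

    The paraboloids of the doubling step have coefficients of order L / |a|, for which there is no a
    priori bound. They are needed only on a ball whose radius [delta] is chosen after the maximum
    point, so small that they contribute at most 1; outside it the maximality inequalities are
    applied to [u] itself.

    The size of the gain cube comes from a balance. Deviating by eta |a| from the direction of [a]
    costs about eta^2 |a|, while concavity gains |a|^(1 + th), so eta is of order |a|^(th / 2). The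
    volume of the cube then adds th d / 2 to the exponent, and this loss is the origin of theta0. *)

(** * Real powers and their tangents *)

Section powers.
Context {R : realType}.
Implicit Types b t x : R.

Lemma gt0_powRD x (r s : R) : 0 < x -> x `^ (r + s) = x `^ r * x `^ s.
Proof. by move=> x0; rewrite powRD// (gt_eqF x0) implybT. Qed.

Lemma gt0_powRS x (r : R) : 0 < x -> x `^ (1 + r) = x * x `^ r.
Proof. by move=> x0; rewrite gt0_powRD// powRr1 ?ltW. Qed.

Lemma powR_antitone (a b e : R) : 0 < a -> a <= b -> e <= 0 -> b `^ e <= a `^ e.
Proof.
move=> a0 ab e0; have b0 := lt_le_trans a0 ab.
rewrite -[e]opprK !(powRN _ (- e)) lef_pV2 ?posrE ?powR_gt0//.
by apply: ge0_ler_powR; rewrite ?nnegrE ?oppr_ge0// ltW.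
Qed.

(* Weighted AM-GM, from the strict inequality [1 + y < expR y] at
   [y = (b - 1) ln x] and [y = - ln x]. *)
Lemma powR_gt_tangent1 b x : 1 < b -> 0 < x -> x != 1 -> 1 + b * (x - 1) < x `^ b.
Proof.
move=> b1 x0 x1.
have lx0 : ln x != 0 by rewrite ln_eq0.
have xe : x = expR (ln x) by rewrite lnK.
have -> : x `^ b = x * expR ((b - 1) * ln x).
  by rewrite /powR gt_eqF// [X in _ = X * _]xe -expRD; congr expR; ring.
have h1 : 1 + (b - 1) * ln x < expR ((b - 1) * ln x).
  by apply: expR_gt1Dx; rewrite mulf_neq0// gt_eqF// subr_gt0.
have h2 : 1 - ln x < x^-1.
  have := @expR_gt1Dx _ (- ln x); rewrite oppr_eq0 => /(_ lx0).
  by rewrite expRN lnK.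
have h3 : x * (1 - ln x) < 1 by rewrite -[ltRHS](divff (lt0r_neq0 x0)) ltr_pM2l.
have h4 : x * (1 + (b - 1) * ln x) < x * expR ((b - 1) * ln x) by rewrite ltr_pM2l.
apply: le_lt_trans h4.
have : (b - 1) * (x * (1 - ln x)) <= (b - 1) * 1 by rewrite ler_pM2l ?subr_gt0// ltW.
lra.
Qed.

Lemma powR_ge_tangent b t0 t : 1 <= b -> 0 < t0 -> 0 <= t ->
  t0 `^ b + b * t0 `^ (b - 1) * (t - t0) <= t `^ b.
Proof.
move=> b1 t00 t_ge0.
have H x : 0 <= x -> 1 + b * (x - 1) <= x `^ b.
  rewrite le_eqVlt => /predU1P[<-|x0].
    by rewrite powR0 ?gt_eqF ?(lt_le_trans ltr01)//; lra.
  move: b1; rewrite le_eqVlt => /predU1P[<-|b1]; first by rewrite powRr1 ?(ltW x0)//; lra.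
  have [->|x1] := eqVneq x 1; first by rewrite powR1; lra.
  exact/ltW/powR_gt_tangent1.
have := H (t / t0) (divr_ge0 t_ge0 (ltW t00)).
rewrite -(ler_pM2l (powR_gt0 b t00)) -powRM ?divr_ge0// ?(ltW t00)//.
rewrite [t0 * _]mulrC divfK ?gt_eqF//; apply: le_trans.
have -> : t0 `^ b = t0 `^ (b - 1) * t0.
  by rewrite mulrC mulr_powRB1 ?(ltW t00)// (lt_le_trans ltr01).
by rewrite le_eqVlt; apply/orP; left; apply/eqP; field; rewrite gt_eqF.
Qed.

(** The concave case is the convex one for the inverse function: exponent 1 / g at the points t0^g
    and t^g, solved for t^g. *)
Lemma powR_le_tangent g t0 t : 0 < g -> g <= 1 -> 0 < t0 -> 0 <= t ->
  t `^ g <= t0 `^ g + g * t0 `^ (g - 1) * (t - t0).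
Proof.
move=> g0 g1 t00 t_ge0.
have := @powR_ge_tangent g^-1 (t0 `^ g) (t `^ g); rewrite -!powRrM divff ?gt_eqF// !powRr1 ?(ltW t00)//.
move=> /(_ _ _ (powR_ge0 _ _)); rewrite powR_gt0// invf_ge1// => /(_ g1 isT).
have -> : g * (g^-1 - 1) = 1 - g by field; rewrite gt_eqF.
have -> : t0 `^ (1 - g) = (t0 `^ (g - 1))^-1 by rewrite -powRN; congr powR; ring.
have p0 := powR_gt0 (g - 1) t00.
rewrite -lerBrDl -(ler_pM2l (mulr_gt0 g0 p0)).
rewrite mulrA (_ : _ * _ * (g^-1 / _) = 1); last by field; rewrite !gt_eqF.
by rewrite mul1r lerBlDl.
Qed.

(** The distance from t^b to its tangent at t0 grows with e, so e = t0 / 8 is the worst case. By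
    homogeneity [k] is the gap at t0 = 1, e = 1 / 8; the tangent at 9 / 8 t0, which is steeper,
    carries it to larger e. *)
Lemma powR_convex_gap b : 1 < b -> exists2 k : R, 0 < k &
  forall t0 e, 0 < t0 -> t0 / 8 <= e ->
    t0 `^ b + b * t0 `^ (b - 1) * e + k * t0 `^ b <= (t0 + e) `^ b.
Proof.
move=> b1; exists ((9 / 8) `^ b - 1 - b / 8).
  by have := @powR_gt_tangent1 b (9 / 8) b1; rewrite ltr_pdivlMr// => H; have := H ltac:(lra) ltac:(by rewrite gt_eqF//; lra); lra.
move=> t0 e t00 te.
have t98 : 0 < 9 / 8 * t0 by lra.
have := @powR_ge_tangent b _ (t0 + e) (ltW b1) t98; move/(_ ltac:(lra)).
apply: le_trans.
have c0 : 0 <= 9 / 8 :> R by lra.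
rewrite !(powRM _ c0 (ltW t00)).
have -> : t0 `^ b = t0 `^ (b - 1) * t0.
  by rewrite mulrC mulr_powRB1 ?(ltW t00)// (lt_trans ltr01).
have c1 : 1 <= (9 / 8 : R) `^ (b - 1).
  by rewrite -[leLHS](powRr0 (9/8)); apply: ler_powR; lra.
have p0 := powR_gt0 (b - 1) t00.
have h : 0 <= b * t0 `^ (b - 1) * ((9 / 8) `^ (b - 1) - 1) * (e - t0 / 8).
  by rewrite !mulr_ge0//; lra.
move: c1 h; set X := _ `^ (b - 1); set Y := _ `^ (b - 1); set Z := _ `^ b; lra.
Qed.

End powers.

(** * The Euclidean norm *)

Section euclidean_lemmas.
Context {R : realType} {n : nat}.
Implicit Types (x y z p : 'rV[R]_n.+1) (c : R).

Lemma dotpC x y : dotp x y = dotp y x.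
Proof. by apply: eq_bigr => i _; rewrite mulrC. Qed.

Lemma dotpDl x y z : dotp (x + y) z = dotp x z + dotp y z.
Proof. by rewrite -big_split/=; apply: eq_bigr => i _; rewrite mxE mulrDl. Qed.

Lemma dotpZl c x y : dotp (c *: x) y = c * dotp x y.
Proof. by rewrite mulr_sumr; apply: eq_bigr => i _; rewrite mxE mulrA. Qed.

Lemma dotpNl x y : dotp (- x) y = - dotp x y.
Proof. by rewrite -scaleN1r dotpZl mulN1r. Qed.

Lemma dotpDr x y z : dotp z (x + y) = dotp z x + dotp z y.
Proof. by rewrite dotpC dotpDl !(dotpC z). Qed.

Lemma dotpZr c x y : dotp y (c *: x) = c * dotp y x.
Proof. by rewrite dotpC dotpZl dotpC. Qed.

Lemma dotpNr x y : dotp y (- x) = - dotp y x.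
Proof. by rewrite dotpC dotpNl dotpC. Qed.

Lemma dotp_ge0 x : 0 <= dotp x x.
Proof. by apply: sumr_ge0 => i _; rewrite -expr2 sqr_ge0. Qed.

Lemma dotpxx x : dotp x x = enorm x ^+ 2.
Proof. by rewrite sqr_sqrtr// dotp_ge0. Qed.

Lemma enorm_ge0 x : 0 <= enorm x.
Proof. exact: sqrtr_ge0. Qed.

Lemma dotp_eq0 x : (dotp x x == 0) = (x == 0).
Proof.
apply/eqP/eqP => [|->]; last by apply: big1 => i _; rewrite mxE mul0r.
move=> /eqP; rewrite psumr_eq0; last by move=> i _; rewrite -expr2 sqr_ge0.
by move=> /allP h; apply/rowP => i; have := h i (mem_index_enum _); rewrite mxE /= mulf_eq0 orbb => /eqP.
Qed.

Lemma enorm_eq0 x : (enorm x == 0) = (x == 0).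
Proof. by rewrite -dotp_eq0 dotpxx expf_eq0. Qed.

Lemma enorm0 : enorm (0 : 'rV[R]_n.+1) = 0.
Proof. by apply/eqP; rewrite enorm_eq0. Qed.

Lemma enorm_gt0 x : (0 < enorm x) = (x != 0).
Proof. by rewrite lt_def enorm_ge0 andbT enorm_eq0. Qed.

Lemma enormN x : enorm (- x) = enorm x.
Proof. by rewrite /enorm dotpNl dotpNr opprK. Qed.

Lemma enormB x y : enorm (x - y) = enorm (y - x).
Proof. by rewrite -enormN opprB. Qed.

Lemma enormZ c x : enorm (c *: x) = `|c| * enorm x.
Proof.
by rewrite /enorm dotpZl dotpZr mulrA -expr2 sqrtrM ?sqr_ge0// sqrtr_sqr.
Qed.

Lemma dotp_le x y : dotp x y <= enorm x * enorm y.
Proof.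
have [->|y0] := eqVneq y 0.
  by rewrite enorm0 mulr0 -(scale0r 0) dotpZr mul0r.
have [->|x0] := eqVneq x 0.
  by rewrite enorm0 mul0r -(scale0r 0) dotpZl mul0r.
move: (x0) (y0); rewrite -!enorm_gt0 => X0 Y0.
have := dotp_ge0 (enorm y *: x - enorm x *: y).
rewrite dotpDl !dotpDr !dotpNl !dotpNr !dotpZl !dotpZr !dotpxx (dotpC y x) => h.
by rewrite -(ler_pM2l (mulr_gt0 X0 Y0)); lra.
Qed.

Lemma normr_dotp_le x y : `|dotp x y| <= enorm x * enorm y.
Proof. by rewrite ler_norml dotp_le andbT lerNl -dotpNl -[enorm x]enormN dotp_le. Qed.

Lemma enorm_triangle x y : enorm (x + y) <= enorm x + enorm y.
Proof.
rewrite -(@ler_pXn2r _ 2) ?nnegrE ?addr_ge0 ?enorm_ge0//.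
rewrite -dotpxx dotpDl !dotpDr !dotpxx (dotpC y x).
by have := dotp_le x y; lra.
Qed.

Lemma enorm_coord x i : `|x 0 i| <= enorm x.
Proof.
rewrite -(@ler_pXn2r _ 2) ?nnegrE ?enorm_ge0// -dotpxx real_normK ?num_real//.
rewrite /dotp (bigD1 i)//= -expr2 lerDl.
by apply: sumr_ge0 => j _; rewrite -expr2 sqr_ge0.
Qed.

Lemma enorm_le_coord x c : (forall i, `|x 0 i| <= c) -> enorm x <= n.+1%:R * c.
Proof.
move=> xc; have c0 : 0 <= c := le_trans (normr_ge0 _) (xc ord0).
rewrite -(@ler_pXn2r _ 2) ?nnegrE ?enorm_ge0 ?mulr_ge0// -dotpxx.
apply: (@le_trans _ _ (\sum_(i < n.+1) c ^+ 2)).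
  apply: ler_sum => i _; rewrite -expr2 -[leLHS]real_normK ?num_real//.
  by rewrite ler_pXn2r ?nnegrE.
rewrite sumr_const card_ord exprMn -[c ^+ 2 *+ _]mulr_natl; apply: ler_wpM2r; first exact: sqr_ge0.
by rewrite expr2 ler_peMl// ler1n.
Qed.

Lemma continuous_coord (f : 'rV[R]_n.+1 -> 'rV[R]_n.+1) i :
  continuous f -> continuous (fun x => f x 0 i).
Proof.
move=> cf x.
exact: (@continuous_comp _ _ _ f (fun y : 'rV[R]_n.+1 => y 0 i) x (cf x) (@coord_continuous _ _ _ 0 i (f x))).
Qed.

Lemma dotp_continuous (f g : 'rV[R]_n.+1 -> 'rV[R]_n.+1) :
  continuous f -> continuous g -> continuous (fun x => dotp (f x) (g x)).
Proof.
move=> cf cg; apply: continuous_big => [|i _]; first exact: add_continuous.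
by move=> x; apply: continuousM; exact: continuous_coord.
Qed.

Lemma enorm_continuous : continuous (@enorm R n).
Proof.
move=> x; apply: (@continuous_comp _ _ _ (fun y => dotp y y) Num.sqrt).
  by apply: dotp_continuous => y; exact: cvg_id.
exact: sqrt_continuous.
Qed.

End euclidean_lemmas.

(** * Lebesgue measure on R^d *)

(* Induction on the dimension: the bound for the slices is integrated over the
   last coordinate, so that monotone convergence replaces compactness.  [P]
   selects the boxes that meet the current slice. *)
Lemma prod_le_cover_sum (R : realType) (d : nat) (lo hi : nat -> R)
    (a b : nat -> nat -> R) (P : pred nat) :
  (forall x : nat -> R, (forall i, (i < d)%N -> lo i < x i <= hi i) ->
    exists2 k, P k & forall i, (i < d)%N -> a k i < x i <= b k i) ->
  ((\prod_(i < d) Num.max 0 (hi i - lo i))%:E <=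
   \sum_(k <oo) (if P k then \prod_(i < d) Num.max 0 (b k i - a k i) else 0)%:E)%E.
Proof.
elim: d P => [|d IH] P cov.
  have [k Pk _] := cov (fun=> 0) (fun i (hi : (i < 0)%N) => ltac:(by [])).
  rewrite big_ord0.
  pose g j := ((if P j then 1 else 0 : R)%:E : \bar R).
  rewrite (eq_eseriesr (g := g)); last by move=> j _; rewrite /g big_ord0.
  have g0 j : (0 <= g j)%E by rewrite lee_fin; case: ifP.
  apply: (@le_trans _ _ (\sum_(0 <= j < k.+1) g j)%E).
    rewrite big_nat_recr//= {2}/g Pk -[leLHS]add0e leeD2r//.
    by apply: sume_ge0 => j _.
  by apply: nneseries_lim_ge => j _ _.
have v0 k : 0 <= \prod_(i < d) Num.max 0 (b k i - a k i).
  by apply: prodr_ge0 => i _; rewrite le_max lexx.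
set v' := \prod_(i < d) Num.max 0 (hi i - lo i) in IH *.
(* As a function of the last coordinate [t], this is the volume of the slice of the k-th box; its
   integral is the volume of the box. *)
pose F k (t : R) : \bar R := ((if P k then \prod_(i < d) Num.max 0 (b k i - a k i) else 0)
   * \1_(`]a k d, b k d]) t)%:E.
have F0 k t : (0 <= F k t)%E by rewrite lee_fin mulr_ge0//; case: ifP.
have mF k : measurable_fun [set: measurableTypeR R] (F k : measurableTypeR R -> \bar R).
  apply/measurable_EFinP; apply: measurable_funM => //.
have lenitv (x y : R) : (@lebesgue_measure R `]x, y] = (Num.max 0 (y - x))%:E)%E.
  rewrite lebesgue_measure_itv/= lte_fin; case: ltP => xy.
    by rewrite -EFinB; congr (_%:E); rewrite max_r// subr_ge0 ltW.
  by rewrite max_l// subr_le0.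
have intF k : (\int[@lebesgue_measure R]_t F k t =
    (if P k then \prod_(i < d.+1) Num.max 0 (b k i - a k i) else 0)%:E)%E.
  rewrite /F; under eq_integral do rewrite EFinM.
  rewrite ge0_integralZl_EFin//; last 2 first.
  - by apply/measurable_EFinP.
  - by case: ifP.
  rewrite [X in (_ * X)%E](_ : _ = (Num.max 0 (b k d - a k d))%:E); last first.
    by rewrite integral_indic// setIT; exact: lenitv.
  by rewrite -EFinM big_ord_recr/=; case: ifP => // _; rewrite mul0r.
have -> : ((\prod_(i < d.+1) Num.max 0 (hi i - lo i))%:E =
    \int[@lebesgue_measure R]_t (v' * \1_(`]lo d, hi d]) t)%:E)%E.
  under eq_integral do rewrite EFinM.
  rewrite ge0_integralZl_EFin//; last 2 first.
  - by apply/measurable_EFinP.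
  - by apply: prodr_ge0 => i _; rewrite le_max lexx.
  rewrite [X in (_ * X)%E](_ : _ = (Num.max 0 (hi d - lo d))%:E); last first.
    by rewrite integral_indic// setIT; exact: lenitv.
  by rewrite -EFinM big_ord_recr.
under eq_eseriesr do rewrite -intF.
rewrite -integral_nneseries//.
apply: ge0_le_integral => //.
- by move=> t _; rewrite lee_fin mulr_ge0//; apply: prodr_ge0 => i _; rewrite le_max lexx.
- by apply/measurable_EFinP; apply: measurable_funM.
- by apply: ge0_emeasurable_sum.
move=> t _; rewrite indicE; case: (boolP (t \in _)) => tin; last first.
  by rewrite /= mulr0; apply: nneseries_ge0.
rewrite /= mulr1; apply: (le_trans (IH (fun k => P k && (a k d < t <= b k d)) _)).
  move=> x xlh; have [i id|k Pk kx] := cov (fun i => if i == d then t else x i).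
    have [->|nid] := eqVneq i d; first by move: tin; rewrite inE/= in_itv.
    by apply: xlh; rewrite ltn_neqAle nid -ltnS.
  exists k; first by rewrite Pk/=; have := kx d (ltnSn d); rewrite eqxx.
  by move=> i id; have := kx i (ltnW id); rewrite ltn_eqF.
apply: lee_nneseries => [k _ _|k _].
  by rewrite lee_fin; case: ifP.
rewrite lee_fin indicE; case: ifP => [/andP[Pk tk]|_].
  by rewrite Pk mem_set ?mulr1//= in_itv.
by rewrite mulr_ge0//; case: ifP.
Qed.

Section leb_box.
Context (R : realType) (n : nat).
Local Notation V := 'rV[R]_n.+1.
Local Notation mu := (leb R n).
Implicit Types (A : set V) (x y z : V).

Lemma leb_boxE (c : V * V) : lebesgue_outer (box c) = box_volume c.
Proof.
apply/eqP; rewrite eq_le; apply/andP; split.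
  (* The cover is padded with [(0, 0)], a box that is empty and has volume 0. *)
  pose cc k : V * V := if k is 0%N then c else (0, 0).
  apply: (@le_trans _ _ (\sum_(k <oo) box_volume (cc k))%E).
    by apply: ereal_inf_lbound; exists cc => // x cx; exists 0%N.
  rewrite (nneseries_split 0 1); last by move=> k _; exact: box_volume_ge0.
  rewrite add0n big_nat1 eseries0 ?adde0// => -[//|k] _ _.
  by rewrite /= /box_volume (bigD1 ord0)//= subrr maxxx mul0r.
apply: le_ereal_inf_tmp => _ [cc ccov <-].
(* Points become sequences; past the dimension [inord] returns a default index, which no condition
   on i < n.+1 reads. *)
pose tof (x : V) (i : nat) := x 0 (inord i).
have vE (c' : V * V) : \prod_(i < n.+1) Num.max 0 (tof c'.2 i - tof c'.1 i) =
   \prod_i Num.max 0 (c'.2 0 i - c'.1 0 i).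
  by apply: eq_bigr => i _; rewrite /tof inord_val.
rewrite /box_volume -vE.
apply: (le_trans (@prod_le_cover_sum R n.+1 (tof c.1) (tof c.2) (fun k => tof (cc k).1)
  (fun k => tof (cc k).2) xpredT _)).
  move=> x xc; have /ccov[k _ kx] : box c (\row_i x i).
    by move=> i; rewrite mxE; have := xc i (ltn_ord i); rewrite /tof inord_val.
  exists k => // i ni; have := kx (inord i).
  by rewrite mxE /= inordK.
by apply: lee_nneseries => [k _ _|k _]; rewrite lee_fin vE// -lee_fin box_volume_ge0.
Qed.

(** The hyperplane cuts each box of a cover into two boxes whose volumes add up to at most the
    original one, and this is the Caratheodory inequality. *)
Lemma measurable_halfspace (i : 'I_n.+1) (t : R) :
  measurable ([set x : V | x 0 i <= t] : set (leb_rV R n)).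
Proof.
apply: le_caratheodory_measurable => X.
apply: le_ereal_inf_tmp => _ [c Xc <-].
pose c1 k : V * V := ((c k).1, \row_j if j == i then Num.min ((c k).2 0 i) t else (c k).2 0 j).
pose c2 k : V * V := (\row_j (if j == i then Num.max ((c k).1 0 i) t else (c k).1 0 j), (c k).2).
apply: (@le_trans _ _ (\sum_(k <oo) box_volume (c1 k) + \sum_(k <oo) box_volume (c2 k))%E).
  apply: leeD; apply: ereal_inf_lbound.
    exists c1 => // x [Xx /= xt]; have [k _ kx] := Xc _ Xx; exists k => // j /=.
    rewrite mxE; case: eqVneq => [->|_]; last exact: kx.
    by rewrite le_min xt andbT; exact: kx.
  exists c2 => // x [Xx /= /negP]; rewrite -ltNge => xt.
  have [k _ kx] := Xc _ Xx; exists k => // j /=.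
  rewrite mxE; case: eqVneq => [->|_]; last exact: kx.
  by rewrite gt_max xt andbT; exact: kx.
rewrite -nneseriesD//; try by move=> k _ _; exact: box_volume_ge0.
apply: lee_nneseries => [k _ _|k _].
  by apply: adde_ge0; exact: box_volume_ge0.
have bv (c' : V * V) : box_volume c' = (Num.max 0 (c'.2 0 i - c'.1 0 i) *
    \prod_(j | j != i) Num.max 0 (c'.2 0 j - c'.1 0 j))%:E.
  by rewrite /box_volume (bigD1 i).
rewrite !bv -EFinD lee_fin /c1 /c2/=.
under [X in _ * X + _]eq_bigr => j ji do rewrite mxE (negbTE ji).
under [X in _ + _ * X]eq_bigr => j ji do rewrite mxE (negbTE ji).
rewrite -mulrDl ler_wpM2r//.
  by apply: prodr_ge0 => j _; rewrite le_max lexx.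
rewrite !mxE eqxx.
set p := (c k).1 0 i; set q := (c k).2 0 i.
rewrite /Num.max /Num.min.
by repeat case: ifPn; rewrite -?leNgt => *; lra.
Qed.

Lemma measurable_coord (i : 'I_n.+1) :
  measurable_fun setT (fun x : leb_rV R n => (x : V) 0 i).
Proof.
move=> mT; apply: (measurability _ (RGenOInfty.measurableE R)) => //.
move=> /= _ [_ [t ->] <-]; apply: measurableI => //.
rewrite [X in measurable X](_ : _ = ~` [set x : leb_rV R n | (x : V) 0 i <= t]).
  by apply: measurableC; exact: measurable_halfspace.
by apply/seteqP; split => x /=; rewrite in_itv/= andbT ltNge => /negP.
Qed.

Lemma measurable_box (c : V * V) : measurable (box c : set (leb_rV R n)).
Proof.
rewrite [X in measurable X](_ : _ = \bigcap_(i in [set: 'I_n.+1])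
    (setT `&` (fun x : leb_rV R n => (x : V) 0 i) @^-1` `]c.1 0 i, c.2 0 i])).
  apply: fin_bigcap_measurable => [|i _]; first exact: finite_finset.
  by apply: measurable_coord => //; exact: measurable_itv.
apply/seteqP; split => x /= xc i; first by move=> _; split=> //=; rewrite in_itv/=; exact: xc.
by have [//|_ /=] := xc i; rewrite in_itv.
Qed.

(** An open set is the union of the boxes with rational centre and half-side 1 / (N + 1) that it
    contains, and these are countably many. Balls of the topology are cubes, so boxes fit in them
    directly. *)
Lemma open_leb_measurable (U : set V) : open U -> measurable (U : set (leb_rV R n)).
Proof.
move=> oU.
pose B (k : 'rV[rat]_n.+1 * nat) : V * V :=
  (\row_i (ratr (k.1 0 i) - k.2.+1%:R^-1), \row_i (ratr (k.1 0 i) + k.2.+1%:R^-1)).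
pose G k := if `[< box (B k) `<=` U >] then box (B k) else set0.
rewrite [X in measurable X](_ : _ = \bigcup_k G k).
  apply: countable_bigcupT_measurable => [|k]; first exact: countableP.
  by rewrite /G; case: ifP => _ //; exact: measurable_box.
apply/seteqP; split => [x Ux|x [k _]]; last first.
  by rewrite /G; case: ifP => // /asboolP BU /BU.
have /nbhs_ballP[e /= e0 xeU] : nbhs x U by exact: open_nbhs_nbhs.
(* Half of [e]: a point of the box differs from its centre by at most h in each coordinate, and so
   does [x]. *)
have [N Ne] : exists N : nat, N.+1%:R^-1 < e / 2.
  exists (Num.truncn (e / 2)^-1); rewrite invf_plt ?posrE ?divr_gt0//.
  exact: truncnS_gt.
have N0 : 0 < N.+1%:R^-1 :> R by rewrite invr_gt0.
move hE : (N.+1%:R^-1 : R) Ne N0 => h Ne N0.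
have Q i : {q : rat | x 0 i - h < ratr q < x 0 i + h}.
  apply: cid; have [|q] := @rat_in_itvoo R (x 0 i - h) (x 0 i + h).
    by lra.
  by rewrite in_itv/= => ?; exists q.
exists (\row_i sval (Q i), N) => //.
have xB : box (B (\row_i sval (Q i), N)) x.
  by move=> i; rewrite /= !mxE hE; case: (Q i) => q /= /andP[]; lra.
suff BU : box (B (\row_i sval (Q i), N)) `<=` U by rewrite /G asboolT.
move=> y yB; apply: xeU; split=> // i j; rewrite (ord1 i) /ball/=.
have := yB j; rewrite /= !mxE hE; case: (Q j) => q /= /andP[? ?] /andP[? ?].
by rewrite ltr_norml; apply/andP; split; lra.
Qed.

Lemma continuous_leb_measurable (g : V -> R) : continuous g ->
  measurable_fun setT (g : leb_rV R n -> R).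
Proof.
move=> /continuousP cg mT; apply: (measurability _ (RGenOpens.measurableE R)).
  move=> _ [_ [a [b ->] <-]]; apply: measurableI; first exact: mT.
  by apply: open_leb_measurable; exact/cg/interval_open.
exact: mT.
Qed.

Definition translate (v : V) : leb_rV R n -> leb_rV R n := fun y => (y : V) + v.

Lemma lebesgue_outer_translate (v : V) A :
  lebesgue_outer ((fun y => y + v) @^-1` A) = lebesgue_outer A.
Proof.
have H (w : V) (B : set V) : (lebesgue_outer ((fun y => (y + w)%R) @^-1` B) <= lebesgue_outer B)%E.
  apply: le_ereal_inf_tmp => _ [c Bc <-]; apply: ereal_inf_lbound.
  exists (fun k => ((c k).1 - w, (c k).2 - w)).
    move=> x /Bc[k _ kx]; exists k => // i; have := kx i.
    by rewrite !mxE/= -ltrBlDr -lerBrDr.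
  apply: eq_eseriesr => k _; congr EFin; apply: eq_bigr => i _.
  by rewrite /= !mxE; congr Num.max; ring.
apply/eqP; rewrite eq_le H /=.
rewrite [leLHS](_ : _ = lebesgue_outer ((fun y => (y - v)%R) @^-1` ((fun y => (y + v)%R) @^-1` A))).
  exact: H.
by congr lebesgue_outer; apply/seteqP; split => x /=; rewrite subrK.
Qed.

(** The outer measure is translation invariant, so the Caratheodory condition for the preimage,
    tested on [X], is the condition for [A] tested on the translate of [X]. *)
Lemma measurable_translate (v : V) : measurable_fun setT (translate v).
Proof.
move=> mT A mA; apply: measurableI; first exact: mT.
move=> X.
pose S (y : V) : V := y - v.
suff H : lebesgue_outer (S @^-1` X) =
    (lebesgue_outer (S @^-1` X `&` A) + lebesgue_outer (S @^-1` X `&` ~` A))%E ->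
    lebesgue_outer X = (lebesgue_outer (X `&` translate v @^-1` A) +
      lebesgue_outer (X `&` ~` (translate v @^-1` A)))%E by exact/H/mA.
rewrite lebesgue_outer_translate => ->.
rewrite -(lebesgue_outer_translate v) -[X in (_ + X)%E](lebesgue_outer_translate v).
congr (_ + _)%E; congr lebesgue_outer.
  by apply/seteqP; split => x /=; rewrite /S /translate addrK.
by apply/seteqP; split => x /=; rewrite /S /translate addrK.
Qed.

Lemma ge0_integral_translate (v : V) (g : leb_rV R n -> \bar R) :
  measurable_fun setT g -> (forall y, 0 <= g y)%E ->
  (\int[mu]_y g (translate v y) = \int[mu]_y g y)%E.
Proof.
move=> mg g0.
have := @ge0_integral_pushforward _ _ (leb_rV R n) (leb_rV R n) R (translate v) (measurable_translate v) mu setT g.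
rewrite preimage_setT => <- //.
apply: eq_measure_integral => [|mS A _ _]; first exact: measurable_translate.
exact: lebesgue_outer_translate.
Qed.

End leb_box.

(** * Dyadic shells and the Riesz-type majorant of the kernel *)

Section geometric.
Context {R : realType}.

Lemma nneseries_geometric_le (a q : R) : 0 <= a -> 0 <= q < 1 ->
  (\sum_(k <oo) (a * q ^+ k)%:E <= (a / (1 - q))%:E)%E.
Proof.
move=> a0 /andP[q0 q1].
have t0 k : (0 <= (a * q ^+ k)%:E)%E by rewrite lee_fin mulr_ge0// exprn_ge0.
apply: lime_le; first by apply: is_cvg_nneseries => k _ _.
apply: nearW => N; rewrite sumEFin lee_fin -mulr_sumr ler_wpM2l//.
rewrite -div1r ler_pdivlMr ?subr_gt0// big_mkord.
by have := subrX1 q N; have := exprn_ge0 N q0; lra.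
Qed.

Lemma exists_pow2_gt (x : R) : exists k : nat, x < 2 ^+ k.
Proof.
exists (Num.truncn x).+1; apply: (lt_trans (truncnS_gt x)).
by rewrite -natrX ltr_nat ltn_expl.
Qed.

Lemma dyadic_ge (x : R) : 1 <= x -> exists k : nat, 2 ^+ k <= x < 2 ^+ k.+1.
Proof.
move=> x1; case: (ex_minnP (exists_pow2_gt x)) => -[|k] xk kmin.
  by move: xk; rewrite expr0 ltNge x1.
by exists k; rewrite xk andbT leNgt; apply/negP => /kmin; rewrite ltnn.
Qed.

Lemma dyadic_lt (x : R) : 0 < x < 1 -> exists k : nat, (2 ^+ k.+1)^-1 <= x < (2 ^+ k)^-1.
Proof.
move=> /andP[x0 x1]; have [|k /andP[kx xk]] := dyadic_ge (x := x^-1).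
  by rewrite invf_ge1// ltW.
(* Inversion exchanges the weak and the strict inequality, so an exact power of 2 moves to the
   neighbouring shell. *)
move: kx; rewrite le_eqVlt => /predU1P[kx|kx].
  case: k kx xk => [/eqP|k kx xk].
    by rewrite expr0 eq_sym invr_eq1 => /eqP xe; rewrite xe ltxx in x1.
  exists k; rewrite kx invrK lexx/= -[x]invrK ltf_pV2 ?posrE ?invr_gt0 ?exprn_gt0// -kx.
  by rewrite ltr_eXn2l// ltr1n.
exists k; rewrite -[x]invrK ltf_pV2 ?lef_pV2 ?posrE ?invr_gt0 ?exprn_gt0//.
by rewrite (ltW xk).
Qed.

End geometric.

Section riesz_kernel.
Context (R : realType) (n : nat).
Local Notation V := 'rV[R]_n.+1.
Local Notation mu := (leb R n).
Implicit Types (x y z : V) (s rho : R).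

(** Cubes stand in for balls because their volume is explicit; only upper bounds are derived from
    them, so the larger set does no harm. *)
Definition cube (t : R) : set V := box (const_mx (- t), const_mx t).

Lemma cube_enorm t z : enorm z < t -> cube t z.
Proof.
move=> zt i; rewrite /= !mxE; have := le_lt_trans (enorm_coord z i) zt.
by rewrite ltr_norml => /andP[-> /ltW].
Qed.

Lemma leb_cube t : 0 <= t -> mu (cube t) = ((2 * t) ^+ n.+1)%:E.
Proof.
move=> t0; rewrite [LHS]leb_boxE /box_volume; congr EFin.
rewrite (eq_bigr (fun=> 2 * t)); first by rewrite prodr_const card_ord.
by move=> i _; rewrite /= !mxE max_r; lra.
Qed.

Lemma integral_scaled_indic (c : R) (A : set (leb_rV R n)) : 0 <= c -> measurable A ->
  (\int[mu]_z (c * \1_A z)%:E = c%:E * mu A)%E.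
Proof.
move=> c0 mA; under eq_integral do rewrite EFinM.
rewrite ge0_integralZl_EFin//; last by apply/measurable_EFinP; exact: measurable_indic.
by rewrite integral_indic// setIT.
Qed.

(* Dominates, up to the factor [Lambda], both the second order term [|z|^2 K z]
   in the ball of radius [rho] and the drift [rho |z| K z] outside it. *)
Definition riesz s rho z : R :=
  Num.min (enorm z ^+ 2) (rho * enorm z) * enorm z `^ (- (n.+1%:R + 2 * s)).

Lemma riesz_ge0 s rho z : 0 <= rho -> 0 <= riesz s rho z.
Proof. by move=> r0; rewrite mulr_ge0 ?powR_ge0// le_min sqr_ge0 mulr_ge0 ?enorm_ge0. Qed.

Lemma measurable_enorm : measurable_fun setT (@enorm R n : leb_rV R n -> R).
Proof. by apply: continuous_leb_measurable; exact: enorm_continuous. Qed.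

Lemma measurable_riesz s rho : measurable_fun setT (riesz s rho : leb_rV R n -> R).
Proof.
apply: measurable_funM.
  apply: measurable_minr; first by apply: measurable_funX; exact: measurable_enorm.
  by apply: measurable_funM; [exact: measurable_cst|exact: measurable_enorm].
exact: (measurableT_comp (measurable_powR _) measurable_enorm).
Qed.

(** The two terms sum the geometric series of the shells outside and inside the radius [rho], which
    converge because 1 / 2 < s < 1; the power of 4 is the volume factor of a cube of half-side 2
    r. *)
Definition riesz_const s : R :=
  4 ^+ n.+1 * ((1 - 2 `^ (1 - 2 * s))^-1 + (1 - 2 `^ (2 * s - 2))^-1).

Lemma powR2_lt1 (e : R) : e < 0 -> 0 <= 2 `^ e < (1 : R).
Proof.
move=> e0; rewrite powR_ge0/= -[e]opprK powRN invf_lt1 ?powR_gt0//.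
by rewrite -{1}(powRr0 2) /powR gt_eqF// mul0r ltr_expR mulr_gt0 ?ln_gt0 ?oppr_gt0// ltr1n.
Qed.

Lemma riesz_const_gt0 s : 1 / 2 < s < 1 -> 0 < riesz_const s.
Proof.
move=> /andP[s1 s2]; have /andP[_ q1] : 0 <= 2 `^ (1 - 2 * s) < (1 : R) by apply: powR2_lt1; lra.
have /andP[_ q2] : 0 <= 2 `^ (2 * s - 2) < (1 : R) by apply: powR2_lt1; lra.
by rewrite mulr_gt0 ?exprn_gt0// addr_gt0// invr_gt0 subr_gt0.
Qed.

(** Every nonzero [z] lies in a dyadic shell around the sphere of radius [rho]. There the integrand
    is at most its value at the inner radius, and the shell is contained in a cube of twice that
    radius. *)
Lemma integral_riesz s rho : 1 / 2 < s < 1 -> 0 < rho ->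
  (\int[mu]_z (riesz s rho z)%:E <= (riesz_const s * rho `^ (2 - 2 * s))%:E)%E.
Proof.
move=> /andP[s1 s2] r0.
set D := n.+1%:R + 2 * s.
have ler0n2 : 0 <= 2 :> R by [].
have D2 : 2 < D by rewrite /D -natr1; have : 0 <= n%:R :> R by []; lra.
pose r1 k := 2 ^+ k * rho; pose r2 k := (2 ^+ k.+1)^-1 * rho.
have r1p k : 0 < r1 k by rewrite mulr_gt0// exprn_gt0.
have r2p k : 0 < r2 k by rewrite mulr_gt0// invr_gt0 exprn_gt0.
(* Values of rho |z|^(1 - D) and |z|^(2 - D) at the inner radii; both powers decrease because D >
   2. *)
pose c1 k := rho * r1 k `^ (1 - D); pose c2 k := r2 k `^ (2 - D).
have c1p k : 0 <= c1 k by rewrite mulr_ge0 ?powR_ge0 ?ltW.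
have c2p k : 0 <= c2 k by rewrite powR_ge0.
pose F1 k (z : leb_rV R n) := (c1 k * \1_(cube (2 * r1 k)) z)%:E.
pose F2 k (z : leb_rV R n) := (c2 k * \1_(cube (2 * r2 k)) z)%:E.
have F1p k z : (0 <= F1 k z)%E by rewrite lee_fin mulr_ge0.
have F2p k z : (0 <= F2 k z)%E by rewrite lee_fin mulr_ge0.
have mcube t : measurable (cube t : set (leb_rV R n)) by exact: measurable_box.
have mF1 k : measurable_fun setT (F1 k).
  by apply/measurable_EFinP; apply: measurable_funM.
have mF2 k : measurable_fun setT (F2 k).
  by apply/measurable_EFinP; apply: measurable_funM.
have powB (t a : R) : 0 < t -> t `^ (a - D) * (2 * (2 * t)) ^+ n.+1 = 4 ^+ n.+1 * t `^ (a - 2 * s).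
  move=> t0; rewrite mulrA -natrM exprMn mulrCA; congr (_ * _).
  rewrite -powR_mulrn ?ltW// -gt0_powRD//.
  by congr powR; rewrite /D; ring.
have E1 k : c1 k * (2 * (2 * r1 k)) ^+ n.+1 =
    4 ^+ n.+1 * rho `^ (2 - 2 * s) * (2 `^ (1 - 2 * s)) ^+ k.
  rewrite /c1 -mulrA (powB _ _ (r1p k)).
  rewrite /r1 (powRM _ (exprn_ge0 k ler0n2) (ltW r0)).
  rewrite -[2 ^+ k](powR_mulrn k ler0n2) -powRrM [k%:R * _]mulrC powRrM (powR_mulrn k (powR_ge0 _ _)).
  have -> : rho `^ (2 - 2 * s) = rho * rho `^ (1 - 2 * s).
    by rewrite -gt0_powRS//; congr powR; ring.
  by ring.
have E2 k : c2 k * (2 * (2 * r2 k)) ^+ n.+1 =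
    4 ^+ n.+1 * rho `^ (2 - 2 * s) * (2 `^ (2 * s - 2)) ^+ k.+1.
  rewrite /c2 (powB _ _ (r2p k)) /r2 powRM ?(ltW r0)//.
  rewrite -[2 ^+ _](powR_mulrn _ ler0n2) -powRN -powRrM.
  rewrite (_ : - k.+1%:R * _ = (2 * s - 2) * k.+1%:R); last by ring.
  by rewrite powRrM (powR_mulrn _ (powR_ge0 _ _)) mulrA mulrAC.
have I1 k : (\int[mu]_z F1 k z = (4 ^+ n.+1 * rho `^ (2 - 2 * s) * (2 `^ (1 - 2 * s)) ^+ k)%:E)%E.
  rewrite (integral_scaled_indic (c1p k) (mcube _)) leb_cube; last by rewrite mulr_ge0// ltW.
  by rewrite -EFinM E1.
have I2 k : (\int[mu]_z F2 k z = (4 ^+ n.+1 * rho `^ (2 - 2 * s) * (2 `^ (2 * s - 2)) ^+ k.+1)%:E)%E.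
  rewrite (integral_scaled_indic (c2p k) (mcube _)) leb_cube; last by rewrite mulr_ge0// ltW.
  by rewrite -EFinM E2.
pose F k (z : leb_rV R n) : \bar R := (F1 k z + F2 k z)%E.
have Fp k z : (0 <= F k z)%E by exact: adde_ge0.
have mF k : measurable_fun setT (F k) by exact: emeasurable_funD.
apply: (@le_trans _ _ (\int[mu]_z \sum_(k <oo) F k z)%E).
  apply: ge0_le_integral; first exact: measurableT.
  - by move=> z _; rewrite lee_fin riesz_ge0// ltW.
  - by apply/measurable_EFinP; exact: measurable_riesz.
  - by apply: ge0_emeasurable_sum => *; [exact: Fp|exact: mF].
  move=> z _.
  have Fle k : (F k z <= \sum_(k <oo) F k z)%E.
    apply: (@le_trans _ _ (\sum_(0 <= j < k.+1) F j z)%E).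
      by rewrite big_nat_recr//= -[leLHS]add0e leeD2r//; apply: sume_ge0 => j _.
    by apply: nneseries_lim_ge => j _ _.
  have [->|z0] := eqVneq z 0.
    rewrite /riesz -/D enorm0 powR0 ?mulr0; last by rewrite oppr_eq0 gt_eqF//; lra.
    exact: nneseries_ge0.
  have ez0 : 0 < enorm z by rewrite enorm_gt0.
  have [rz|zr] := leP rho (enorm z).
    have [|k /andP[kz zk]] := dyadic_ge (x := enorm z / rho); first by rewrite ler_pdivlMr// mul1r.
    move: kz zk; rewrite ler_pdivlMr// ltr_pdivrMr// => kz zk.
    apply: le_trans (Fle k); rewrite /F -[leLHS]adde0 leeD//.
    rewrite lee_fin indicE mem_set; last first.
      by apply: cube_enorm; rewrite /r1 mulrA -exprS.
    rewrite mulr1 /c1; apply: (@le_trans _ _ (rho * enorm z * enorm z `^ (- D))).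
      by rewrite ler_wpM2r ?powR_ge0// ge_min lexx orbT.
    rewrite -mulrA ler_wpM2l ?(ltW r0)// -gt0_powRS//; apply: powR_antitone => //; lra.
  have [|k /andP[kz zk]] := dyadic_lt (x := enorm z / rho).
    by rewrite divr_gt0//= ltr_pdivrMr// mul1r.
  move: kz zk; rewrite ler_pdivlMr// ltr_pdivrMr// => kz zk.
  apply: le_trans (Fle k); rewrite /F -[leLHS]add0e leeD//.
  rewrite lee_fin indicE mem_set; last first.
    apply: cube_enorm; rewrite /r2 mulrA exprS invfM mulrA divff// mul1r//.
  rewrite mulr1 /c2; apply: (@le_trans _ _ (enorm z ^+ 2 * enorm z `^ (- D))).
    by rewrite ler_wpM2r ?powR_ge0// ge_min lexx.
  rewrite -powR_mulrn ?(ltW ez0)//.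
  rewrite -gt0_powRD//; apply: powR_antitone => //; lra.
rewrite integral_nneseries; last 3 first.
- exact: measurableT.
- exact: mF.
- by move=> k z _; exact: Fp.
rewrite (eq_eseriesr (g := fun k => ((4 ^+ n.+1 * rho `^ (2 - 2 * s) * (2 `^ (1 - 2 * s)) ^+ k)%:E +
   (4 ^+ n.+1 * rho `^ (2 - 2 * s) * (2 `^ (2 * s - 2)) ^+ k.+1)%:E)%E)); last first.
  by move=> k _; rewrite ge0_integralD ?I1 ?I2.
have B0 : 0 <= 4 ^+ n.+1 * rho `^ (2 - 2 * s) by rewrite mulr_ge0 ?powR_ge0 ?exprn_ge0.
rewrite nneseriesD; last 2 first.
- by move=> k _ _; rewrite lee_fin mulr_ge0// exprn_ge0 ?powR_ge0.
- by move=> k _ _; rewrite lee_fin mulr_ge0// exprn_ge0 ?powR_ge0.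
rewrite /riesz_const mulrAC mulrDr EFinD; apply: leeD.
  by apply: nneseries_geometric_le => //; apply: powR2_lt1; lra.
apply: le_trans (nneseries_geometric_le (q := 2 `^ (2 * s - 2)) B0 _); last first.
  by apply: powR2_lt1; lra.
have /andP[q0 q1] : 0 <= 2 `^ (2 * s - 2) < (1 : R) by apply: powR2_lt1; lra.
apply: lee_nneseries => [k _ _|k _]; rewrite lee_fin.
  by rewrite mulr_ge0// exprn_ge0.
by rewrite ler_wpM2l// exprS ler_piMl ?exprn_ge0// ltW.
Qed.

End riesz_kernel.

(** * Integrable functions and compact balls *)

Section integrability.
Context (R : realType) (n : nat).
Local Notation V := 'rV[R]_n.+1.
Local Notation mu := (leb R n).
Implicit Types (f g : leb_rV R n -> R).

Definition leb_integrable f := mu.-integrable setT (EFin \o f).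

Lemma leb_integrable_dominated f g : measurable_fun setT f ->
  (forall z, `|f z| <= g z) -> leb_integrable g -> leb_integrable f.
Proof.
move=> mf fg; apply: le_integrable.
- exact: measurableT.
- exact/measurable_EFinP.
move=> z _ /=; rewrite lee_fin (le_trans (fg z))//; exact: ler_norm.
Qed.

Lemma leb_integrableD f g : leb_integrable f -> leb_integrable g -> leb_integrable (fun z => f z + g z).
Proof. by move=> sf sg; have := integrableD measurableT sf sg. Qed.

Lemma leb_integrableZ (c : R) f : leb_integrable f -> leb_integrable (fun z => c * f z).
Proof. by move=> sf; have := integrableZl measurableT c sf. Qed.

Lemma leb_integrableB f g : leb_integrable f -> leb_integrable g -> leb_integrable (fun z => f z - g z).
Proof. by move=> sf sg; have := integrableB measurableT sf sg. Qed.

Lemma leb_integrable_ge0 f (c : R) : measurable_fun setT f -> (forall z, 0 <= f z) ->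
  (\int[mu]_z (f z)%:E <= c%:E)%E -> leb_integrable f /\ \int[mu]_z f z <= c.
Proof.
move=> mf f0 fc.
have sf : leb_integrable f.
  apply/integrableP; split; first exact/measurable_EFinP.
  rewrite (eq_integral (EFin \o f)); last first.
    by move=> z _; rewrite /= ger0_norm.
  by apply: le_lt_trans fc _; rewrite ltry.
split=> //; rewrite -lee_fin /Rintegral fineK//.
exact: integrable_fin_num sf.
Qed.

Lemma leb_integrable_indic (A : set V) (c : R) : measurable (A : set (leb_rV R n)) -> mu A = c%:E ->
  leb_integrable \1_A /\ \int[mu]_z \1_A z = c.
Proof.
move=> mA Ac.
have iA : (\int[mu]_z (\1_A z)%:E = c%:E)%E by rewrite integral_indic ?setIT//; exact: measurableT.
have [|||-> _] := @leb_integrable_ge0 \1_A c.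
- exact: measurable_indic.
- by move=> z; rewrite indicE.
- by rewrite iA.
by split=> //; rewrite /Rintegral iA.
Qed.

Lemma leb_integrable_riesz s rho : 1 / 2 < s < 1 -> 0 < rho -> leb_integrable (riesz s rho) /\
  \int[mu]_z riesz s rho z <= riesz_const n s * rho `^ (2 - 2 * s).
Proof.
move=> hs r0; apply: leb_integrable_ge0.
- exact: measurable_riesz.
- by move=> z; apply: riesz_ge0; exact: ltW.
- exact: integral_riesz.
Qed.

Lemma compact_eclosed_ball (c : V) (r : R) : compact (eclosed_ball c r).
Proof.
apply: bounded_closed_compact.
  exists (enorm c + r); split; first by rewrite num_real.
  move=> M cM x /= xc; rewrite [leLHS]/Num.Def.normr/= mx_normrE; apply: bigmax_le => [|[i j] _].
    by apply: le_trans (ltW cM); rewrite addr_ge0 ?enorm_ge0//; exact: le_trans (enorm_ge0 _) xc.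
  rewrite (ord1 i); apply: le_trans (enorm_coord x j) _.
  apply: le_trans (ltW cM); rewrite -[x](subrK c) addrC.
  by apply: le_trans (enorm_triangle _ _) _; rewrite lerD2l.
rewrite (_ : eclosed_ball c r = (fun y => enorm (y - c)) @^-1` [set t | t <= r]); last by [].
apply: preimage_closed; last exact: closed_le.
move=> y _; apply: (@continuous_comp _ _ _ (fun y : V => y - c) (@enorm R n)); last exact: enorm_continuous.
by apply: continuousB; [exact: cvg_id|exact: cst_continuous].
Qed.

Lemma continuous_ball_bounded (u : V -> R) (c : V) (r : R) : continuous u ->
  exists B : R, forall x, eclosed_ball c r x -> `|u x| <= B.
Proof.
move=> cu; have [r0|r0] := ltP r 0.
  by exists 0 => x /= /(le_trans (enorm_ge0 _)); rewrite leNgt r0.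
have ne : eclosed_ball c r !=set0 by exists c; rewrite /eclosed_ball /= subrr enorm0.
have cn : {within eclosed_ball c r, continuous (fun x => `|u x|)}.
  by apply: continuous_subspaceT => x; apply: (@continuous_comp _ _ _ u (fun t : R => `|t|)); [exact: cu|exact: norm_continuous].
have [x _ xmax] := EVT_max_rV ne (@compact_eclosed_ball c r) cn.
by exists `|u x| => y yc; apply: xmax; rewrite inE.
Qed.

End integrability.

(** * The weight at infinity and the tail *)

Section weights.
Context (R : realType) (n : nat).
Local Notation V := 'rV[R]_n.+1.
Local Notation mu := (leb R n).
Implicit Types (u : V -> R) (x y z : V) (s : R).

Lemma weight_gt0 s y : 0 < weight s y.
Proof. by rewrite ltr_pwDl// powR_ge0. Qed.

Lemma measurable_weight s (v : V) : measurable_fun setT (fun z : leb_rV R n => weight s ((z : V) + v)).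
Proof.
apply: measurable_funD; first exact: measurable_cst.
have := measurableT_comp (measurable_powR (n.+1%:R + 2 * s)) (measurableT_comp (@measurable_enorm R n) (measurable_translate v)).
exact.
Qed.

Lemma measurable_inv_weight s (v : V) : measurable_fun setT (fun z : leb_rV R n => (weight s ((z : V) + v))^-1).
Proof.
rewrite (_ : (fun z : leb_rV R n => _) = (fun z => powR (weight s ((z : V) + v)) (-1))).
  exact: (measurableT_comp (measurable_powR (-1)) (measurable_weight s v)).
by apply/funext => z; rewrite powR_inv1// ltW// weight_gt0.
Qed.

(** The inverse weight is at most 1, which a cube accounts for near the origin; beyond radius 1 it
    is dominated by [riesz s 1], where the minimum in [riesz] is at least 1. *)
Lemma leb_integrable_inv_weight s : 1 / 2 < s < 1 ->
  leb_integrable (fun z : leb_rV R n => (weight s (z : V))^-1).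
Proof.
move=> hs; have D0 : 0 < n.+1%:R + 2 * s :> R by move: hs => /andP[? ?]; have : 0 < n.+1%:R :> R by []; lra.
have [s1 _] := leb_integrable_riesz n hs ltr01.
have [s2 _] := leb_integrable_indic (measurable_box _) (leb_cube n (ler01 : 0 <= 1 :> R)).
apply: leb_integrable_dominated (leb_integrableD s1 s2).
  by have := measurable_inv_weight s 0; under eq_fun do rewrite addr0.
move=> z; rewrite ger0_norm ?invr_ge0 ?(ltW (weight_gt0 _ _))//.
have r0 := riesz_ge0 s (z : V) (ler01 : 0 <= 1 :> R).
have [z1|z1] := ltP (enorm (z : V)) 1.
  rewrite indicE mem_set; last exact: cube_enorm.
  apply: (@le_trans _ _ 1); last by rewrite lerDr.
  by rewrite invf_le1 ?weight_gt0// lerDl powR_ge0.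
apply: (@le_trans _ _ (riesz s 1 z)); last by rewrite lerDl indicE.
have z0 : 0 < enorm (z : V) := lt_le_trans ltr01 z1.
apply: (@le_trans _ _ (enorm (z : V) `^ (- (n.+1%:R + 2 * s)))).
  by rewrite powRN lef_pV2 ?posrE ?weight_gt0 ?powR_gt0// lerDr.
rewrite /riesz ler_peMl ?powR_ge0// le_min mul1r z1 andbT.
by rewrite -(expr1n _ 2) ler_pXn2r ?nnegrE// ltW.
Qed.

(** Moving the origin inside a ball changes the weight by a bounded factor: |y| is at most twice the
    larger of |y - x| and [r]. This makes the tail integrals bounded uniformly in the base point. *)
Lemma weight_shift s (r : R) : 0 < s -> 0 < r -> exists2 C : R, 0 < C &
  forall x y, enorm x <= r -> weight s y <= C * weight s (y - x).
Proof.
move=> s0 r0; set D : R := n.+1%:R + 2 * s.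
have D0 : 0 < D by rewrite addr_gt0// mulr_gt0.
exists (1 + 2 `^ D + (2 * r) `^ D); first by rewrite ltr_pwDl ?powR_ge0// ltr_pwDl ?powR_ge0.
move=> x y xr; rewrite /weight -/D.
have P0 (t : R) : 0 <= t `^ D by exact: powR_ge0.
have yD : enorm y `^ D <= 2 `^ D * enorm (y - x) `^ D + (2 * r) `^ D.
  have yxr : enorm y <= enorm (y - x) + r.
    by rewrite -{1}[y](subrK x); apply: le_trans (enorm_triangle _ _) _; rewrite lerD2l.
  have [h|h] := leP (enorm (y - x)) r.
    apply: (@le_trans _ _ ((2 * r) `^ D)); last by rewrite lerDr mulr_ge0.
    by apply: ge0_ler_powR; rewrite ?nnegrE; [exact: ltW|exact: enorm_ge0|rewrite mulr_ge0// ltW|lra].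
  apply: (@le_trans _ _ ((2 * enorm (y - x)) `^ D)); last by rewrite powRM ?enorm_ge0// lerDl.
  by apply: ge0_ler_powR; rewrite ?nnegrE; [exact: ltW|exact: enorm_ge0|rewrite mulr_ge0// enorm_ge0|lra].
have := P0 2; have := P0 (2 * r); have := P0 (enorm (y - x)).
move: yD; set a := enorm y `^ D; set b := enorm (y - x) `^ D; set c := 2 `^ D; set e := (2 * r) `^ D.
move=> yD b0 e0 c0.
by have := mulr_ge0 e0 b0; have := mulr_ge0 c0 b0; lra.
Qed.

Definition tail_density s u x (z : leb_rV R n) : R := `|u (x + (z : V)) - u x| / weight s (z : V).

Lemma measurable_shifted u x : continuous u -> measurable_fun setT (fun z : leb_rV R n => u (x + (z : V))).
Proof.
move=> cu; have := measurableT_comp (continuous_leb_measurable cu) (measurable_translate x).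
by congr measurable_fun; apply/funext => z; rewrite /= /translate addrC.
Qed.

Lemma measurable_tail_density s u x : continuous u -> measurable_fun setT (tail_density s u x).
Proof.
move=> cu; apply: measurable_funM; last first.
  by have := measurable_inv_weight s 0; under eq_fun do rewrite addr0.
have h := measurable_funB (measurable_shifted x cu) (@measurable_cst _ _ (leb_rV R n) R setT (u x)).
exact: (measurableT_comp (@normr_measurable R setT) h).
Qed.

Lemma tail_density_ge0 s u x z : 0 <= tail_density s u x z.
Proof. by rewrite divr_ge0// ltW// weight_gt0. Qed.

(** [tail] is the [fine] part of a supremum, and [fine] sends an infinite value to 0; finiteness
    must be known before [tail] can bound anything. After a translation of the integral,
    [weight_shift] gives one bound for all base points. *)
Lemma tail_density_bounded s u (r : R) : 1 / 2 < s < 1 -> 0 < r ->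
  continuous u -> L1_weighted s u -> exists M : R, forall x, eball 0 r x ->
  (\int[mu]_z (tail_density s u x z)%:E <= M%:E)%E.
Proof.
move=> hs r0 cu [_ iu].
have s0 : 0 < s by move: hs => /andP[? _]; lra.
have [C C0 hC] := weight_shift s0 r0.
have [B hB] := continuous_ball_bounded 0 r cu.
have mw : measurable_fun setT (fun z : leb_rV R n => (weight s (z : V))^-1).
  by have := measurable_inv_weight s 0; under eq_fun do rewrite addr0.
have mau : measurable_fun setT (fun z : leb_rV R n => `|u z|).
  exact: (measurableT_comp (@normr_measurable R setT) (continuous_leb_measurable cu)).
pose J := fine (\int[mu]_(y in [set: leb_rV R n]) (`|u y| / weight s y)%:E).
have JE : (\int[mu]_(y in [set: leb_rV R n]) (`|u y| / weight s y)%:E = J%:E)%E.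
  rewrite /J fineK// ge0_fin_numE//.
  by apply: integral_ge0 => z _; rewrite lee_fin divr_ge0// ltW// weight_gt0.
have sw := leb_integrable_inv_weight hs.
pose W := \int[mu]_z (weight s (z : V))^-1.
have WE : (\int[mu]_z ((weight s (z : V))^-1)%:E = W%:E)%E.
  by rewrite /W /Rintegral fineK//; exact: integrable_fin_num sw.
exists (C * J + B * W) => x xr.
have xr' : enorm x <= r by move: xr; rewrite /eball /= subr0 => /ltW.
have uB : `|u x| <= B by apply: hB; rewrite /eclosed_ball /= subr0.
have B0 : 0 <= B := le_trans (normr_ge0 _) uB.
pose g (y : leb_rV R n) : \bar R := (`|u y| / weight s ((y : V) - x))%:E.
have g0 y : (0 <= g y)%E by rewrite lee_fin divr_ge0// ltW// weight_gt0.
have mg : measurable_fun setT g.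
  apply/measurable_EFinP; apply: measurable_funM; [exact: mau|exact: measurable_inv_weight].
have Ig : (\int[mu]_z (`|u (x + (z : V))| / weight s (z : V))%:E <= (C * J)%:E)%E.
  rewrite (eq_integral (fun z : leb_rV R n => g (translate x z))); last first.
    by move=> z _; rewrite /g /translate addrK addrC.
  rewrite ge0_integral_translate//.
  apply: (@le_trans _ _ (\int[mu]_(y in [set: leb_rV R n]) (C%:E * (`|u y| / weight s y)%:E))%E).
    apply: ge0_le_integral.
    - exact: measurableT.
    - by move=> z _; exact: g0.
    - exact: mg.
    - apply: emeasurable_funM; first exact: measurable_cst.
      by apply/measurable_EFinP; exact: measurable_funM.
    move=> y _; rewrite -EFinM lee_fin mulrCA ler_wpM2l//.
    by rewrite ler_pdivlMr ?weight_gt0// mulrC ler_pdivrMr ?weight_gt0// hC.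
  rewrite ge0_integralZl_EFin.
  - by rewrite JE -EFinM.
  - exact: measurableT.
  - by move=> z _; rewrite lee_fin divr_ge0// ltW// weight_gt0.
  - by apply/measurable_EFinP; exact: measurable_funM.
  - exact: ltW.
apply: (@le_trans _ _ (\int[mu]_z ((`|u (x + (z : V))| / weight s (z : V))%:E + (B * (weight s (z : V))^-1)%:E))%E).
  apply: ge0_le_integral.
  - exact: measurableT.
  - by move=> z _; rewrite lee_fin; exact: tail_density_ge0.
  - by apply/measurable_EFinP; exact: measurable_tail_density.
  - apply: emeasurable_funD; apply/measurable_EFinP; apply: measurable_funM.
    + exact: (measurableT_comp (@normr_measurable R setT) (measurable_shifted x cu)).
    + exact: mw.
    + exact: measurable_cst.
    + exact: mw.
  move=> z _; rewrite -EFinD lee_fin -mulrDl ler_wpM2r ?invr_ge0 ?(ltW (weight_gt0 _ _))//.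
  by apply: le_trans (ler_normB _ _) _; rewrite lerD2l.
rewrite ge0_integralD.
- rewrite EFinD; apply: leeD; first exact: Ig.
  under eq_integral do rewrite EFinM.
  rewrite ge0_integralZl_EFin ?WE//.
  + by move=> z _; rewrite lee_fin invr_ge0 ltW// weight_gt0.
  + by apply/measurable_EFinP; exact: mw.
- exact: measurableT.
- by move=> z _; rewrite lee_fin divr_ge0// ltW// weight_gt0.
- apply/measurable_EFinP; apply: measurable_funM; last exact: mw.
  exact: (measurableT_comp (@normr_measurable R setT) (measurable_shifted x cu)).
- by move=> z _; rewrite lee_fin mulr_ge0// invr_ge0 ltW// weight_gt0.
- by apply/measurable_EFinP; apply: measurable_funM; [exact: measurable_cst|exact: mw].
Qed.

Lemma tail_ge s u (r : R) x : 1 / 2 < s < 1 -> 0 < r ->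
  continuous u -> L1_weighted s u -> eball 0 r x ->
  leb_integrable (tail_density s u x) /\ \int[mu]_z tail_density s u x z <= tail s u (eball 0 r).
Proof.
move=> hs r0 cu Lu xr; have [M hM] := tail_density_bounded hs r0 cu Lu.
apply: leb_integrable_ge0.
- exact: measurable_tail_density.
- exact: tail_density_ge0.
rewrite /tail.
set S := [set _ | _ in _].
have xS : S (\int[mu]_z (tail_density s u x z)%:E)%E by exists x.
have Sx : (\int[mu]_z (tail_density s u x z)%:E <= ereal_sup S)%E by exact: ereal_sup_ubound.
have I0 : (0 <= \int[mu]_z (tail_density s u x z)%:E)%E.
  by apply: integral_ge0 => z _; rewrite lee_fin; exact: tail_density_ge0.
rewrite fineK// ge0_fin_numE; last exact: le_trans Sx.
apply: (@le_lt_trans _ _ M%:E); last exact: ltry.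
by apply: ge_ereal_sup => _ [y yr <-]; exact: hM.
Qed.

Lemma tail_ge0 s u (r : R) : 1 / 2 < s < 1 -> 0 < r ->
  continuous u -> L1_weighted s u -> 0 <= tail s u (eball 0 r).
Proof.
move=> hs r0 cu Lu; have c0 : eball 0 r (0 : V) by rewrite /eball /= subrr enorm0.
have [_] := tail_ge hs r0 cu Lu c0; apply: le_trans.
by apply: Rintegral_ge0 => z _; exact: tail_density_ge0.
Qed.

End weights.

(** * Viscosity inequalities for quadratic test functions *)

Section quadratic_test.
Context (R : realType) (n : nat).
Local Notation V := 'rV[R]_n.+1.
Implicit Types (f : V -> R) (a v p x y z : V) (c : R).

Lemma derive_quadratic f a v (l k : R) :
  (forall h, f (h *: v + a) = f a + h * l + h ^+ 2 * k) ->
  derivable f a v /\ 'D_v f a = l.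
Proof.
move=> fE.
have H : h^-1 *: (f (h *: v + a) - f a) @[h --> 0^'] --> l.
  apply: (@cvg_trans _ ((fun h : R => l + h * k) @ 0^')).
    apply: near_eq_cvg; near=> h.
    have h0 : h != 0 by near: h; exact: nbhs_dnbhs_neq.
    by rewrite fE /GRing.scale/=; field.
  apply: cvg_within_filter.
  have : l + h * k @[h --> (0 : R)] --> l + 0 * k.
    by apply: cvgD; [exact: cvg_cst|apply: cvgM; [exact: cvg_id|exact: cvg_cst]].
  by rewrite mul0r addr0.
by split; [apply/cvg_ex; exists l|exact/cvg_lim].
Unshelve. all: by end_near. Qed.

(** There is no constant term because only increments of the test function enter the maximum
    condition and the operator. *)
Definition quadratic x p c y : R := dotp p (y - x) + c * dotp (y - x) (y - x).

Lemma quadraticE x p c z : quadratic x p c (x + z) = dotp p z + c * enorm z ^+ 2.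
Proof. by rewrite /quadratic addrAC subrr add0r dotpxx. Qed.

Lemma quadratic_center x p c : quadratic x p c x = 0.
Proof. by have := quadraticE x p c 0; rewrite addr0 enorm0 expr0n/= mulr0 addr0 -(scale0r 0) dotpZr mul0r. Qed.

Lemma dotp_delta x i : dotp x (delta_mx 0 i) = x 0 i.
Proof.
rewrite /dotp (bigD1 i)//= big1 ?addr0; first by rewrite mxE !eqxx mulr1.
by move=> j ji; rewrite mxE (negbTE ji) andbF mulr0.
Qed.

Lemma quadratic_shift x p c i y h : quadratic x p c (h *: delta_mx 0 i + y) =
  quadratic x p c y + h * (p 0 i + 2 * c * (y - x) 0 i) + h ^+ 2 * c.
Proof.
rewrite /quadratic -addrA; move: (y - x) => w.
rewrite !dotpDr !dotpDl !dotpZr !dotpZl !dotp_delta (dotpC (delta_mx 0 i)) !dotp_delta mxE !eqxx /=.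
by ring.
Qed.

Lemma pderive_quadratic x p c i :
  (forall y, derivable (quadratic x p c) y (delta_mx 0 i)) /\
  pderive i (quadratic x p c) = fun y => p 0 i + 2 * c * (y - x) 0 i.
Proof.
split=> [y|]; last apply/funext => y.
  by have [] := derive_quadratic (quadratic_shift x p c i y).
by have [] := derive_quadratic (quadratic_shift x p c i y).
Qed.

Lemma gradient_quadratic x p c : gradient (quadratic x p c) x = p.
Proof.
apply/rowP => i; rewrite mxE (pderive_quadratic x p c i).2 subrr mxE mulr0 addr0 //.
Qed.

Lemma continuous_affine_coord (a b : R) x i : continuous (fun y : V => a + b * (y - x) 0 i).
Proof.
have c1 : continuous (fun y : V => y - x).
  by move=> y; apply: continuousB; [exact: cvg_id|exact: cst_continuous].
by move=> y; exact: (cvgD (cvg_cst a) (cvgM (cvg_cst b) (@continuous_coord R n _ i c1 y))).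
Qed.

Lemma C2_quadratic x p c (E : set V) : C2_near E (quadratic x p c).
Proof.
exists setT; split=> //; first exact: openT.
split.
  split.
    have cs : continuous (fun y : V => y - x).
      by move=> y; apply: continuousB; [exact: cvg_id|exact: cst_continuous].
    move=> y _; apply: continuousD.
      by apply: dotp_continuous => // ?; exact: cst_continuous.
    by apply: continuousM; [exact: cst_continuous|exact: dotp_continuous].
  move=> i; split=> [y _|]; first exact: (pderive_quadratic x p c i).1.
  by rewrite (pderive_quadratic x p c i).2 => y _; exact: continuous_affine_coord.
move=> i; rewrite (pderive_quadratic x p c i).2.
have H j y h : p 0 i + 2 * c * (h *: delta_mx 0 j + y - x) 0 i =
    p 0 i + 2 * c * (y - x) 0 i + h * (2 * c * (i == j)%:R) + h ^+ 2 * 0.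
  by rewrite !mxE !eqxx /=; ring.
split; first by move=> y _; exact: continuous_affine_coord.
move=> j; split=> [y _|]; first by have [] := derive_quadratic (f := fun y => p 0 i + 2 * c * (y - x) 0 i) (H j y).
rewrite (_ : pderive j _ = cst (2 * c * (i == j)%:R)); last first.
  apply/funext => y.
  by have [] := derive_quadratic (f := fun y => p 0 i + 2 * c * (y - x) 0 i) (H j y).
by move=> y _; exact: cst_continuous.
Qed.

End quadratic_test.

Section operator.
Context (R : realType) (n : nat).
Local Notation V := 'rV[R]_n.+1.
Local Notation mu := (leb R n).
Implicit Types (K u f : V -> R) (p x y z : V) (c delta : R).

Lemma riesz_near s rho z : enorm z <= rho ->
  riesz s rho z = enorm z ^+ 2 * enorm z `^ (- (n.+1%:R + 2 * s)).
Proof. by move=> zr; rewrite /riesz min_l// expr2 ler_wpM2r ?enorm_ge0. Qed.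

Lemma riesz_far s rho z : rho <= enorm z ->
  riesz s rho z = rho * enorm z * enorm z `^ (- (n.+1%:R + 2 * s)).
Proof. by move=> zr; rewrite /riesz min_r// expr2 ler_wpM2r ?enorm_ge0. Qed.

(** Multiplied by the weight, the left side is |z|^(-D) + 1. Beyond [delta] the kernel is thus
    comparable with the density of the tail. *)
Lemma powR_far_weight s delta z : 0 < s -> 0 < delta -> delta <= enorm z ->
  enorm z `^ (- (n.+1%:R + 2 * s)) <= (1 + delta `^ (- (n.+1%:R + 2 * s))) / weight s z.
Proof.
move=> s0 d0 dz; have z0 : 0 < enorm z := lt_le_trans d0 dz.
have D0 : 0 < n.+1%:R + 2 * s by rewrite addr_gt0// mulr_gt0.
rewrite ler_pdivlMr ?weight_gt0// /weight mulrDr mulr1 -gt0_powRD// addNr powRr0 addrC lerD2l.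
rewrite !powRN lef_pV2 ?posrE ?powR_gt0//; apply: ge0_ler_powR; rewrite ?nnegrE; [exact: ltW|exact: ltW|exact: ltW|exact: dz].
Qed.

Variables (s lambda Lambda : R) (K : V -> R).
Hypotheses (hs : 1 / 2 < s < 1) (hl : 0 < lambda <= Lambda).
Hypothesis (hK : kernel_bounds s lambda Lambda K).
Local Notation D := (n.+1%:R + 2 * s).

Let s0 : 0 < s. Proof. by move: hs => /andP[? _]; lra. Qed.
Let L0 : 0 < Lambda. Proof. by move: hl => /andP[? ?]; lra. Qed.

Lemma kernel_ge0 z : z != 0 -> 0 <= K z.
Proof.
move=> /(hK.2)/andP[h _]; apply: le_trans h.
by rewrite mulr_ge0 ?powR_ge0//; move: hl => /andP[/ltW].
Qed.

Lemma kernel_le z : z != 0 -> `|K z| <= Lambda * enorm z `^ (- D).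
Proof. by move=> z0; rewrite ger0_norm ?kernel_ge0//; have /andP[] := hK.2 _ z0. Qed.

(** The hypothesis speaks of the complement of the origin only. The origin is the zero set of
    [enorm], hence measurable, and any function is measurable on a singleton. *)
Lemma measurable_kernel : measurable_fun setT (K : leb_rV R n -> R).
Proof.
have m0 : measurable ([set (0 : V)] : set (leb_rV R n)).
  have := (@measurable_enorm R n) measurableT [set 0] (measurable_set1 0).
  congr measurable; apply/seteqP; split => z /=.
    by move=> [_ /eqP]; rewrite enorm_eq0 => /eqP.
  by move=> ->; rewrite enorm0.
rewrite -(setvU [set (0 : V)]); apply/measurable_funU.
- by apply: measurableC.
- exact: m0.
by split; [exact: hK.1|exact: measurable_fun_set1].
Qed.

(* The two nonlocal terms of [test_operator] for [quadratic x p c] in one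
   integrand. *)
Definition operator_integrand u x p c delta (z : leb_rV R n) : R :=
  (if enorm (z : V) < delta then c * enorm (z : V) ^+ 2
   else u (x + (z : V)) - u x - \1_(eball 0 1) (z : V) * dotp (z : V) p) * K z.

Lemma measurable_eball (v : V) (r : R) : measurable (eball v r : set (leb_rV R n)).
Proof.
have := measurable_fun_ltr (measurableT_comp (@measurable_enorm R n) (measurable_translate (- v))) (@measurable_cst _ _ (leb_rV R n) R setT r).
by move=> /(_ measurableT [set true]); rewrite setTI; apply.
Qed.

Lemma measurable_dotp p : measurable_fun setT (fun z : leb_rV R n => dotp (z : V) p).
Proof.
apply: continuous_leb_measurable; apply: dotp_continuous; first by move=> ?; exact: cvg_id.
by move=> ?; exact: cst_continuous.
Qed.

Lemma measurable_operator_integrand u x p c delta : continuous u ->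
  measurable_fun setT (operator_integrand u x p c delta).
Proof.
move=> cu; apply: measurable_funM; last exact: measurable_kernel.
apply: measurable_fun_ifT.
- by apply: measurable_fun_ltr; [exact: measurable_enorm|exact: measurable_cst].
- apply: measurable_funM; first exact: measurable_cst.
  by apply: measurable_funX; exact: measurable_enorm.
apply: measurable_funB.
  by apply: measurable_funB; [exact: measurable_shifted|exact: measurable_cst].
apply: measurable_funM; last exact: measurable_dotp.
by apply: measurable_indic; exact: measurable_eball.
Qed.

Lemma leb_integrable_operator_integrand u x p c delta (r : R) : 0 < delta <= 1 ->
  continuous u -> L1_weighted s u -> 0 < r -> eball 0 r x ->
  leb_integrable (operator_integrand u x p c delta).
Proof.
move=> /andP[d0 d1] cu Lu r0 xr.
have [st _] := tail_ge hs r0 cu Lu xr.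
have [sr _] := leb_integrable_riesz n hs ltr01.
(* Below [delta] the integrand is c |z|^2 K; between [delta] and 1 the drift |p| |z| is at most (|p|
   / delta) |z|^2; the increments of [u] beyond [delta] go to the tail. *)
apply: leb_integrable_dominated (leb_integrableD (leb_integrableZ (Lambda * (`|c| + enorm p / delta)) sr)
  (leb_integrableZ (Lambda * (1 + delta `^ (- D))) st)).
  exact: measurable_operator_integrand.
move=> z; rewrite /operator_integrand.
have rz0 := riesz_ge0 s (z : V) (ler01 : 0 <= 1 :> R).
have tz0 := tail_density_ge0 s u x z.
have pd0 : 0 <= enorm p / delta by rewrite divr_ge0 ?enorm_ge0// ltW.
have cB : 0 <= Lambda * (1 + delta `^ (- D)).
  by apply: mulr_ge0; [exact: ltW|rewrite addr_ge0// powR_ge0].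
have cA : 0 <= Lambda * (`|c| + enorm p / delta).
  by apply: mulr_ge0; [exact: ltW|rewrite addr_ge0].
have [zd|dz] := ltP (enorm (z : V)) delta.
  have [z0|z0] := eqVneq (z : V) 0.
    rewrite z0 enorm0 expr0n/= mulr0 mul0r normr0.
    rewrite z0 in rz0 tz0.
    by apply: addr_ge0; apply: mulr_ge0.
  rewrite normrM (normrM c) (ger0_norm (sqr_ge0 (enorm (z : V)))).
  apply: (@le_trans _ _ (Lambda * `|c| * riesz s 1 z)).
    rewrite (riesz_near _ (ltW (lt_le_trans zd d1))).
    rewrite [leRHS](_ : _ = `|c| * enorm (z : V) ^+ 2 * (Lambda * enorm (z : V) `^ (- D))); last by ring.
    by apply: ler_wpM2l; [rewrite mulr_ge0// sqr_ge0|exact: kernel_le].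
  apply: ler_wpDr; first exact: mulr_ge0.
  by apply: ler_wpM2r => //; apply: ler_wpM2l; [exact: ltW|rewrite lerDl].
have z0 : (z : V) != 0 by rewrite -enorm_gt0 (lt_le_trans d0).
rewrite normrM.
apply: (@le_trans _ _ ((`|u (x + (z : V)) - u x| + \1_(eball 0 1) (z : V) * (enorm (z : V) * enorm p)) * (Lambda * enorm (z : V) `^ (- D)))).
  apply: ler_pM => //; last exact: kernel_le.
  apply: le_trans (ler_normB _ _) _; rewrite lerD2l normrM ger0_norm ?indicE//.
  by rewrite ler_wpM2l// normr_dotp_le.
rewrite mulrDl addrC; apply: lerD.
  rewrite indicE; have [z1|z1] := boolP ((z : V) \in eball 0 1); last first.
    by rewrite !mul0r; apply: mulr_ge0.
  have {}z1 : enorm (z : V) <= 1 by move: z1; rewrite inE /eball /= subr0 => /ltW.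
  rewrite mul1r riesz_near//.
  apply: (@le_trans _ _ (Lambda * (enorm p / delta) * (enorm (z : V) ^+ 2 * enorm (z : V) `^ (- D)))); last first.
    apply: ler_wpM2r; first by rewrite mulr_ge0 ?sqr_ge0 ?powR_ge0.
    by apply: ler_wpM2l; [exact: ltW|rewrite lerDr].
  rewrite [leRHS](_ : _ = (enorm p * (enorm (z : V) * (enorm (z : V) / delta))) * (Lambda * enorm (z : V) `^ (- D))); last by ring.
  apply: ler_wpM2r; first by rewrite mulr_ge0 ?powR_ge0// ltW.
  rewrite mulrC; apply: ler_wpM2l; first exact: enorm_ge0.
  by rewrite ler_peMr ?enorm_ge0// ler_pdivlMr// mul1r.
rewrite [leRHS](_ : _ = `|u (x + (z : V)) - u x| * (Lambda * ((1 + delta `^ (- D)) / weight s (z : V)))); last first.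
  by rewrite /tail_density; ring.
by apply: ler_wpM2l => //; apply: ler_wpM2l; [exact: ltW|exact: powR_far_weight].
Qed.

(** As [delta <= 1], the compensator is active on the whole inner ball and removes exactly the
    linear part of the test function, leaving c |z|^2. *)
Lemma nonlocal_sum u x p c delta (r : R) : 0 < delta <= 1 ->
  continuous u -> L1_weighted s u -> 0 < r -> eball 0 r x ->
  nonlocal K (eball 0 delta) (quadratic x p c) p x + nonlocal K (~` eball 0 delta) u p x =
  \int[mu]_z operator_integrand u x p c delta z.
Proof.
move=> hd cu Lu r0 xr.
have sF := leb_integrable_operator_integrand p c hd cu Lu r0 xr.
rewrite -[in RHS](setUv (eball 0 delta)) Rintegral_setU; last 4 first.
- exact: measurable_eball.
- by apply: measurableC; exact: measurable_eball.
- by rewrite setUv; exact: sF.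
- by apply/disj_setPS; rewrite setICr.
congr (_ + _); apply: eq_Rintegral => z; rewrite inE /operator_integrand /eball /= subr0.
  move=> zd; rewrite zd; congr (_ * _).
  rewrite quadraticE quadratic_center subr0 indicE mem_set ?mul1r; last first.
    by rewrite /eball /= subr0 (lt_le_trans zd)//; move: hd => /andP[].
  by rewrite (dotpC p) addrAC subrr add0r.
by move=> /negP/negbTE ->.
Qed.

Lemma subsolution_quadratic alpha H f (r : R) u x p c delta : 0 < delta <= 1 ->
  continuous u -> L1_weighted s u -> 0 < r ->
  viscosity_subsolution alpha K H f (eball 0 r) u -> eball 0 r x ->
  (forall z, enorm z < delta -> u (x + z) - u x <= dotp p z + c * enorm z ^+ 2) ->
  alpha * u x + H x p <= \int[mu]_z operator_integrand u x p c delta z + f x.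
Proof.
move=> hd cu Lu r0 hu xr uz.
have := hu x delta (quadratic x p c) xr; rewrite /test_operator gradient_quadratic.
rewrite -(nonlocal_sum p c hd cu Lu r0 xr).
have [d0 _] := andP hd; move=> /(_ d0 (C2_quadratic x p c _)).
set X := nonlocal _ _ _ _ _; set Y := nonlocal _ _ _ _ _; move=> h.
suff : alpha * u x - X - Y + H x p - f x <= 0 by lra.
apply: h => y yx; rewrite quadratic_center subr0.
have := uz (y - x) yx; rewrite (_ : x + (y - x) = y); last by rewrite addrC subrK.
by rewrite /quadratic dotpxx; lra.
Qed.

Lemma supersolution_quadratic alpha H f (r : R) u x p c delta : 0 < delta <= 1 ->
  continuous u -> L1_weighted s u -> 0 < r ->
  viscosity_supersolution alpha K H f (eball 0 r) u -> eball 0 r x ->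
  (forall z, enorm z < delta -> dotp p z + c * enorm z ^+ 2 <= u (x + z) - u x) ->
  \int[mu]_z operator_integrand u x p c delta z + f x <= alpha * u x + H x p.
Proof.
move=> hd cu Lu r0 hu xr uz.
have := hu x delta (quadratic x p c) xr; rewrite /test_operator gradient_quadratic.
rewrite -(nonlocal_sum p c hd cu Lu r0 xr).
have [d0 _] := andP hd; move=> /(_ d0 (C2_quadratic x p c _)).
set X := nonlocal _ _ _ _ _; set Y := nonlocal _ _ _ _ _; move=> h.
suff : 0 <= alpha * u x - X - Y + H x p - f x by lra.
apply: h => y yx; rewrite quadratic_center subr0.
have := uz (y - x) yx; rewrite (_ : x + (y - x) = y); last by rewrite addrC subrK.
by rewrite /quadratic dotpxx; lra.
Qed.

End operator.

(** * Bounds on balls and growth of the Hamiltonian *)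

Section tools.
Context (R : realType) (n : nat).
Local Notation V := 'rV[R]_n.+1.
Implicit Types (u f : V -> R) (x y z p q : V).

(** The absolute value gives a function continuous on the whole line, ready for composition with
    [enorm]; at 0 the power need not be differentiable, so continuity is checked directly. *)
Lemma continuous_norm_powR (g : R) : 0 < g -> continuous (fun t : R => `|t| `^ g).
Proof.
move=> g0 t; have [->|t0] := eqVneq t 0; last first.
  have pc : {for `|t|, continuous ((@powR R) ^~ g)}.
    apply/differentiable_continuous/derivable1_diffP.
    by apply: derivable_powR; rewrite in_itv/= andbT normr_gt0.
  exact: (cvg_comp _ _ (@norm_continuous _ R t) pc).
rewrite /continuous_at normr0 powR0 ?gt_eqF//.
apply/cvgrPdist_lt => e e0; near=> x.
rewrite sub0r normrN ger0_norm ?powR_ge0//.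
rewrite -[ltRHS]powRr1 ?ltW// -(mulVf (lt0r_neq0 g0)) powRrM.
apply: gt0_ltr_powR => //; rewrite ?nnegrE ?powR_ge0//.
near: x; exists (e `^ g^-1); first exact: powR_gt0.
by move=> y /=; rewrite sub0r normrN.
Unshelve. all: by end_near. Qed.

(** The square root lies below its tangent at b^2. This replaces norms by polynomials, so that the
    norm never has to be differentiated. *)
Lemma enorm_le_amgm x (b : R) : 0 < b -> enorm x <= (enorm x ^+ 2 + b ^+ 2) / (2 * b).
Proof.
move=> b0; rewrite ler_pdivlMr ?mulr_gt0//.
by have := sqr_ge0 (enorm x - b); rewrite sqrrB; lra.
Qed.

Lemma enormD_sqr x y : enorm (x + y) ^+ 2 = enorm x ^+ 2 + 2 * dotp x y + enorm y ^+ 2.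
Proof. by rewrite -!dotpxx dotpDl !dotpDr (dotpC y x); ring. Qed.

Section bounded_on_ball.
Variables (rho : R) (g : V -> R).
Hypotheses (rho0 : 0 < rho) (cg : continuous g).

Lemma ball_image_bounds : has_sup (g @` eball 0 rho) /\ has_inf (g @` eball 0 rho).
Proof.
have [B hB] := continuous_ball_bounded 0 rho cg.
have ne : g @` eball 0 rho !=set0 by exists (g 0), 0 => //; rewrite /eball /= subrr enorm0.
have hB' x : eball 0 rho x -> `|g x| <= B by move=> xr; apply: hB; exact: ltW.
split; split=> //.
  by exists B => _ [x /hB' + <-]; rewrite ler_norml => /andP[].
by exists (- B) => _ [x /hB' + <-]; rewrite ler_norml => /andP[].
Qed.

Lemma le_sup_ball x : eball 0 rho x -> g x <= sup (g @` eball 0 rho).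
Proof. by move=> xr; apply: ub_le_sup; [exact: ball_image_bounds.1.2|exists x]. Qed.

Lemma ge_inf_ball x : eball 0 rho x -> inf (g @` eball 0 rho) <= g x.
Proof. by move=> xr; apply: ge_inf; [exact: ball_image_bounds.2.2|exists x]. Qed.

Lemma le_osc x y : eball 0 rho x -> eball 0 rho y -> g x - g y <= osc (eball 0 rho) g.
Proof. by move=> /le_sup_ball ? /ge_inf_ball ?; exact: lerB. Qed.

Lemma osc_ge0 : 0 <= osc (eball 0 rho) g.
Proof.
have c0 : eball 0 rho (0 : V) by rewrite /eball /= subrr enorm0.
by have := le_osc c0 c0; rewrite subrr.
Qed.

End bounded_on_ball.

Lemma Z2_ge s (r : R) f u : 1 / 2 < s < 1 -> 0 < r -> continuous f -> continuous u ->
  L1_weighted s u -> [/\ 1 <= Z2 s r f u, osc (eball 0 (r + 2)) u <= Z2 s r f u,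
   osc (eball 0 (r + 2)) f <= Z2 s r f u & tail s u (eball 0 (r + 2)) <= Z2 s r f u].
Proof.
move=> hs r0 cf cu Lu; have r2 : 0 < r + 2 by lra.
have := osc_ge0 r2 cu; have := osc_ge0 r2 cf; have := tail_ge0 hs r2 cu Lu.
by rewrite /Z2; split; lra.
Qed.

Lemma Aconst_ge s alpha (r : R) f u : 1 / 2 < s < 1 -> 0 <= alpha -> 0 < r -> continuous f ->
  continuous u -> L1_weighted s u -> [/\ 1 <= Aconst s alpha r f u,
    tail s u (eball 0 (r + 2)) <= Aconst s alpha r f u &
    forall x, eball 0 (r + 2) x -> f x - alpha * u x <= Aconst s alpha r f u].
Proof.
move=> hs a0 r0 cf cu Lu; have r2 : 0 < r + 2 by lra.
have t0 := tail_ge0 hs r2 cu Lu.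
have cmax : continuous (fun x => Num.max (f x) 0).
  by move=> x; apply: continuous_max; [exact: cf|exact: cst_continuous].
have cmin : continuous (fun x => Num.min (u x) 0).
  by move=> x; apply: continuous_min; [exact: cu|exact: cst_continuous].
have H x : eball 0 (r + 2) x ->
    [/\ 0 <= sup [set Num.max (f x) 0 | x in eball 0 (r + 2)],
      f x <= sup [set Num.max (f x) 0 | x in eball 0 (r + 2)],
      inf [set Num.min (u x) 0 | x in eball 0 (r + 2)] <= 0 &
      inf [set Num.min (u x) 0 | x in eball 0 (r + 2)] <= u x].
  move=> xr; have := le_sup_ball r2 cmax xr; have := ge_inf_ball r2 cmin xr.
  by rewrite le_min ge_max => /andP[-> ->] /andP[-> ->].
have [S0 _ I0 _] : [/\ 0 <= sup [set Num.max (f x) 0 | x in eball 0 (r + 2)],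
      f 0 <= sup [set Num.max (f x) 0 | x in eball 0 (r + 2)],
      inf [set Num.min (u x) 0 | x in eball 0 (r + 2)] <= 0 &
      inf [set Num.min (u x) 0 | x in eball 0 (r + 2)] <= u 0].
  by apply: H; rewrite /eball /= subrr enorm0.
have aI : 0 <= - (alpha * inf [set Num.min (u x) 0 | x in eball 0 (r + 2)]).
  by rewrite -mulrN mulr_ge0// oppr_ge0.
rewrite /Aconst; split=> [||x /H[_ fx _ ux]]; [lra|lra|].
have := ler_wpM2l a0 ux; lra.
Qed.

Section growth.
Variables (m : R) (H : V -> V -> R) (CH : R -> R) (rho : R).
Hypotheses (m1 : 1 <= m) (rho0 : 0 < rho) (hH : growth m H CH).

(* Splitting [q] into [N] equal steps removes the restriction [enorm q <= rho]. *)
Lemma growth_all x y p q : eball 0 rho x -> eball 0 rho y ->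
  `|H x (p + q) - H y p| <= CH rho *
    (enorm (x - y) * (1 + enorm p `^ m) + 2 * enorm q * (enorm p + enorm q) `^ (m - 1)).
Proof.
move=> xr yr; have [C0 hC] := hH rho0.
have m10 : 0 <= m - 1 by rewrite subr_ge0.
have mono (a b : R) : 0 <= a -> a <= b -> a `^ (m - 1) <= b `^ (m - 1).
  by move=> a0 ab; apply: ge0_ler_powR; rewrite ?nnegrE//; exact: le_trans ab.
pose N := (Num.truncn (enorm q / rho)).+1.
have N0 : 0 < N%:R :> R by rewrite ltr0n.
have qN : enorm q / N%:R <= rho.
  by rewrite ler_pdivrMr// mulrC -ler_pdivrMr//; exact/ltW/truncnS_gt.
pose e := N%:R^-1 *: q.
have eE : enorm e = enorm q / N%:R by rewrite enormZ ger0_norm ?invr_ge0 ?ltW// mulrC.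
have er : enorm e <= rho by rewrite eE.
have B0 : 0 <= enorm p + enorm q by rewrite addr_ge0 ?enorm_ge0.
have step k : (k <= N)%N -> `|H x (p + k%:R *: e) - H y p| <= CH rho *
    (enorm (x - y) * (1 + enorm p `^ m) + k%:R * (2 * enorm e * (enorm p + enorm q) `^ (m - 1))).
  elim: k => [|k IH] kN.
    (* The base point changes only once, here and with a zero increment; all later steps stay at
       [x]. *)
    have := hC x y p 0 xr yr; rewrite enorm0 scale0r mul0r => /(_ (ltW rho0)).
    by rewrite mul0r.
  have := hC x x (p + k%:R *: e) e xr xr er.
  rewrite subrr enorm0 mul0r add0r -addrA -[k%:R *: e + e](_ : k.+1%:R *: e = _); last first.
    by rewrite -natr1 scalerDl scale1r.
  move=> h1; have := IH (ltnW kN) => h2.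
  rewrite -[_ - H y p](subrKA (H x (p + k%:R *: e))) (le_trans (ler_normD _ _))//.
  apply: (le_trans (lerD h1 h2)); rewrite -mulrDr ler_wpM2l ?(ltW C0)//.
  rewrite -natr1 [X in _ + X <= _]addrC.
  have ke : enorm (p + k%:R *: e) <= enorm p + enorm q.
    apply: le_trans (enorm_triangle _ _) _; rewrite lerD2l enormZ ger0_norm// eE mulrCA ler_piMr ?enorm_ge0//.
    by rewrite ler_pdivrMr// mul1r ler_nat ltnW.
  have eq : enorm e <= enorm p + enorm q.
    rewrite eE (@le_trans _ _ (enorm q))// ?lerDr ?enorm_ge0// ler_piMr ?enorm_ge0//.
    by rewrite invf_le1// ler1n.
  have h3 := mono _ _ (enorm_ge0 _) ke; have h4 := mono _ _ (enorm_ge0 _) eq.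
  apply: le_trans (lerD (ler_wpM2l (enorm_ge0 e) (lerD h3 h4)) (lexx _)) _.
  by rewrite le_eqVlt; apply/orP; left; apply/eqP; ring.
have := step N (leqnn N).
rewrite scalerA mulfV ?gt_eqF// scale1r eE.
by rewrite (_ : N%:R * _ = 2 * enorm q * (enorm p + enorm q) `^ (m - 1))//; field; rewrite gt_eqF.
Qed.

(* In the coercive regime this replaces the lower bound [rho] on [CH] of the
   other regime. *)
Lemma coercive_growth_ge kappa : 0 < kappa -> coercive m kappa H -> (2 * kappa)^-1 <= CH rho.
Proof.
move=> k0 hc; have c0 : eball 0 rho (0 : V) by rewrite /eball /= subrr enorm0.
rewrite leNgt; apply/negP => Ck.
pose v : V := const_mx 1.
have v0 : 0 < enorm v.
  rewrite enorm_gt0; apply/eqP => /rowP/(_ ord0)/eqP.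
  by rewrite !mxE oner_eq0.
(* Coercivity from below and growth from above along one ray. If the factor on the left were
   positive, the left side would be unbounded in [t]. *)
have key (t : R) : 0 < t -> (kappa^-1 - 2 * CH rho) * t `^ m <= H 0 0 + kappa.
  move=> t0; pose q := (t / enorm v) *: v.
  have qt : enorm q = t by rewrite enormZ ger0_norm ?divr_ge0 ?enorm_ge0 ?(ltW t0)// divfK ?gt_eqF.
  have := growth_all 0 q c0 c0; rewrite add0r subrr enorm0 mul0r add0r add0r qt -mulrA mulr_powRB1; [|exact: ltW|exact: lt_le_trans m1].
  move=> /ler_normlP[_ h1]; have := hc 0 q; rewrite qt; lra.
have e0 : 0 < kappa^-1 - 2 * CH rho.
  by move: Ck; rewrite invfM; lra.
pose t : R := 1 + `|H 0 0 + kappa| / (kappa^-1 - 2 * CH rho).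
have t1 : 1 <= t by rewrite lerDl divr_ge0// ltW.
have := key t (lt_le_trans ltr01 t1).
apply/negP; rewrite -ltNge (@lt_le_trans _ _ ((kappa^-1 - 2 * CH rho) * t))//; last first.
  by rewrite ler_pM2l// le1r_powR.
rewrite /t mulrDr mulr1 mulrCA divff ?gt_eqF// mulr1.
by apply: le_lt_trans (ler_norm _) _; rewrite ltrDr.
Qed.

End growth.
End tools.

(** * The kernel against its majorants in three zones *)

Section kernel_bounds_lemmas.
Context (R : realType) (n : nat).
Local Notation V := 'rV[R]_n.+1.
Variables (s lambda Lambda : R) (K : V -> R).
Hypotheses (hs : 1 / 2 < s < 1) (hl : 0 < lambda <= Lambda).
Hypothesis (hK : kernel_bounds s lambda Lambda K).
Local Notation D := (n.+1%:R + 2 * s).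
Implicit Types (z : V) (X rho : R).

Lemma kernel_ub z : z != 0 -> K z <= Lambda * enorm z `^ (- D).
Proof. by move=> z0; have /andP[] := hK.2 _ z0. Qed.

Lemma kernel_quadratic_le X rho z : 0 <= X -> z != 0 -> enorm z <= rho ->
  X * enorm z ^+ 2 * K z <= X * Lambda * riesz s rho z.
Proof.
move=> X0 z0 zr; rewrite (riesz_near _ zr).
rewrite [leRHS](_ : _ = X * enorm z ^+ 2 * (Lambda * enorm z `^ (- D))); last by ring.
by apply: ler_wpM2l; [rewrite mulr_ge0// sqr_ge0|exact: kernel_ub].
Qed.

Lemma kernel_linear_le X rho z : 0 <= X -> 0 < rho -> rho <= enorm z ->
  X * rho * enorm z * K z <= X * Lambda * riesz s rho z.
Proof.
move=> X0 r0 zr; rewrite (riesz_far _ zr).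
have z0 : z != 0 by rewrite -enorm_gt0 (lt_le_trans r0).
rewrite [leRHS](_ : _ = X * rho * enorm z * (Lambda * enorm z `^ (- D))); last by ring.
apply: ler_wpM2l; last exact: kernel_ub.
by apply: mulr_ge0; [apply: mulr_ge0 => //; exact: ltW|exact: enorm_ge0].
Qed.

(** The factor of [powR_far_weight] at radius 1 / 4, up to which the maximum conditions control the
    increments of [u]. *)
Definition far_const : R := Lambda * (1 + (1 / 4) `^ (- D)).

Lemma far_const_ge0 : 0 <= far_const.
Proof.
move: hl => /andP[l0 lL]; apply: mulr_ge0; first exact: le_trans (ltW l0) lL.
by rewrite addr_ge0// powR_ge0.
Qed.

Lemma kernel_far_le X z : 0 <= X -> 1 / 4 <= enorm z ->
  X * K z <= far_const * (X / weight s z).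
Proof.
move=> X0 zr; have s0 : 0 < s by move: hs => /andP[? _]; lra.
have q0 : 0 < 1 / 4 :> R by lra.
have L0 : 0 <= Lambda by move: hl => /andP[l0 lL]; exact: le_trans (ltW l0) lL.
have z0 : z != 0 by rewrite -enorm_gt0 (lt_le_trans q0).
apply: (@le_trans _ _ (X * (Lambda * enorm z `^ (- D)))).
  by apply: ler_wpM2l => //; exact: kernel_ub.
rewrite [leRHS](_ : _ = X * (Lambda * ((1 + (1 / 4) `^ (- D)) / weight s z))); last first.
  by rewrite /far_const; ring.
by apply: ler_wpM2l => //; apply: ler_wpM2l => //; exact: powR_far_weight.
Qed.

End kernel_bounds_lemmas.

(** * Linear and quadratic bounds for the power barrier *)

Section power_barrier.
Context {R : realType} {n : nat}.
Local Notation V := 'rV[R]_n.+1.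
Implicit Types (a z : V) (g : R).

(** The right side is a paraboloid touching the norm from above at [a], obtained from
    [enorm_le_amgm] with b = |a|. *)
Lemma enormD_le_amgm a z : a != 0 ->
  enorm (a + z) - enorm a <= (dotp a z + enorm z ^+ 2 / 2) / enorm a.
Proof.
rewrite -enorm_gt0 => a0; have := enorm_le_amgm (a + z) a0.
rewrite enormD_sqr ler_pdivlMr ?mulr_gt0// ler_pdivlMr// => h.
by rewrite mulrBl -expr2; lra.
Qed.

(** The slope is written |a|^(g - 2) |a| so that it shares the factor |a|^(g - 2) with the quadratic
    bound. *)
Lemma power_barrier_le_lin g a z : 0 < g -> g <= 1 -> a != 0 ->
  enorm (a + z) `^ g - enorm a `^ g <= enorm a `^ (g - 2) * enorm a * enorm z.
Proof.
move=> g0 g1 a0; have a0' : 0 < enorm a by rewrite enorm_gt0.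
have := powR_le_tangent g0 g1 a0' (enorm_ge0 (a + z)); rewrite -lerBlDl => /le_trans; apply.
have -> : enorm a `^ (g - 1) = enorm a `^ (g - 2) * enorm a.
  by rewrite mulrC -gt0_powRS//; congr powR; ring.
set E := _ * enorm a.
have E0 : 0 <= E by rewrite mulr_ge0 ?powR_ge0 ?enorm_ge0.
apply: (@le_trans _ _ (g * E * enorm z)).
  apply: ler_wpM2l; first by rewrite mulr_ge0// ltW.
  by rewrite lerBlDl enorm_triangle.
by apply: ler_wpM2r; [exact: enorm_ge0|rewrite ler_piMl].
Qed.

(** The tangent of the concave power composed with the paraboloid above the norm. Times [L], it is
    the test function whose slope and coefficient appear in [holder_integral_le]. *)
Lemma power_barrier_le_quad g a z : 0 < g -> g <= 1 -> a != 0 ->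
  enorm (a + z) `^ g - enorm a `^ g <= g * enorm a `^ (g - 2) * (dotp a z + enorm z ^+ 2 / 2).
Proof.
move=> g0 g1 a0; have a0' : 0 < enorm a by rewrite enorm_gt0.
have := powR_le_tangent g0 g1 a0' (enorm_ge0 (a + z)); rewrite -lerBlDl => /le_trans; apply.
have -> : enorm a `^ (g - 1) = enorm a `^ (g - 2) * enorm a.
  by rewrite mulrC -gt0_powRS//; congr powR; ring.
set X := enorm (a + z) - _; set E := enorm a `^ _.
rewrite [leLHS](_ : _ = g * E * (X * enorm a)); last by ring.
apply: ler_wpM2l; first by rewrite mulr_ge0 ?powR_ge0// ltW.
by rewrite -ler_pdivlMr// enormD_le_amgm.
Qed.

End power_barrier.

(** * Hoelder estimate in the coercive regime *)

Section holder.
Context (R : realType) (n : nat).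
Local Notation V := 'rV[R]_n.+1.
Local Notation mu := (leb R n).
Variables (s lambda Lambda : R).
Hypotheses (hs : 1 / 2 < s < 1) (hl : 0 < lambda <= Lambda).

(** Three zones: the paraboloid for |z| < |a|, the linear bound of the barrier and the drift up to 1
    / 4, the tail and the drift beyond. With the choice delta = |a|, the first two zones are both
    bounded by [riesz s |a|], which gives L |a|^(g - 2) |a|^(2 - 2 s). *)
Lemma holder_integral_le (K u : V -> R) (x a : V) (r g L : R) :
  kernel_bounds s lambda Lambda K -> continuous u -> L1_weighted s u -> 0 < r -> eball 0 r x ->
  0 < g -> g <= 1 -> 0 < L -> a != 0 -> enorm a <= 1 / 4 ->
  (forall z, enorm z <= 1 / 4 -> u (x + z) - u x <= L * (enorm (a + z) `^ g - enorm a `^ g)) ->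
  \int[mu]_z operator_integrand K u x ((L * g * enorm a `^ (g - 2)) *: a)
    (L * g * enorm a `^ (g - 2) / 2) (enorm a) z <=
  2 * L * Lambda * riesz_const n s * enorm a `^ (g - 2 * s) +
  far_const n s Lambda * tail s u (eball 0 r).
Proof.
move=> hK cu Lu r0 xr g0 g1 L0 a0 a4 hu.
have ra : 0 < enorm a by rewrite enorm_gt0.
have hd : 0 < enorm a <= 1 by rewrite ra /=; lra.
have La0 : 0 <= Lambda by move: hl => /andP[l0 lL]; exact: le_trans (ltW l0) lL.
have [st It] := tail_ge hs r0 cu Lu xr.
have [sr Ir] := leb_integrable_riesz n hs ra.
set P := L * enorm a `^ (g - 2).
have P0 : 0 <= P by rewrite mulr_ge0 ?powR_ge0 ?ltW.
set p := _ *: a; set c := _ / 2.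
have pE : enorm p <= P * enorm a.
  rewrite /p enormZ ger0_norm; last by rewrite !mulr_ge0 ?powR_ge0 ?ltW.
  rewrite (_ : L * g * _ = g * P); last by rewrite /P; ring.
  by apply: ler_wpM2r; [exact: enorm_ge0|rewrite ler_piMl].
have cE : c <= 2 * P.
  rewrite /c (_ : L * g * _ = g * P); last by rewrite /P; ring.
  have : g * P <= P by rewrite ler_piMl.
  lra.
have c0 : 0 <= c by rewrite /c !mulr_ge0 ?powR_ge0 ?ltW.
have sB := leb_integrableD (leb_integrableZ (2 * P * Lambda) sr) (leb_integrableZ (far_const n s Lambda) st).
apply: (@le_trans _ _ (\int[mu]_z (2 * P * Lambda * riesz s (enorm a) z +
    far_const n s Lambda * tail_density s u x z))).
  apply: le_Rintegral; [exact: measurableT|exact: (leb_integrable_operator_integrand hs hl hK p c hd cu Lu r0 xr)|exact: sB|].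
  move=> z _; rewrite /operator_integrand.
  have rz0 := riesz_ge0 s (z : V) (ltW ra).
  have tz0 := tail_density_ge0 s u x z.
  have B1 : 0 <= 2 * P * Lambda * riesz s (enorm a) z.
    by apply: mulr_ge0 => //; apply: mulr_ge0 => //; apply: mulr_ge0.
  have B2 : 0 <= far_const n s Lambda * tail_density s u x z.
    by apply: mulr_ge0 => //; exact: far_const_ge0 hl.
  have [za|az] := ltP (enorm (z : V)) (enorm a).
    have [z0|z0] := eqVneq (z : V) 0.
      by rewrite z0 enorm0 expr0n/= mulr0 mul0r -z0 addr_ge0.
    apply: ler_wpDr; first exact: B2.
    apply: le_trans (kernel_quadratic_le hK c0 z0 (ltW za)) _.
    by apply: ler_wpM2r; [exact: rz0|apply: ler_wpM2r; [exact: La0|exact: cE]].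
  have z0 : (z : V) != 0 by rewrite -enorm_gt0 (lt_le_trans ra).
  have K0 := kernel_ge0 hl hK z0.
  have pz : `|\1_(eball 0 1) (z : V) * dotp (z : V) p| <= P * enorm a * enorm (z : V).
    rewrite normrM ger0_norm ?indicE//.
    apply: (@le_trans _ _ `|dotp (z : V) p|); first by rewrite ler_piMl//; case: (_ \in _).
    apply: le_trans (normr_dotp_le _ _) _.
    by rewrite mulrC; apply: ler_wpM2r => //; exact: enorm_ge0.
  have [z4|z4] := ltP (enorm (z : V)) (1 / 4).
    apply: ler_wpDr; first exact: B2.
    apply: (@le_trans _ _ (2 * P * enorm a * enorm (z : V) * K z)); last first.
      by apply: (kernel_linear_le hK); [apply: mulr_ge0; [|exact: P0]|exact: ra|exact: az].
    apply: ler_wpM2r; first exact: K0.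
    have h1 := hu _ (ltW z4).
    have h2 := power_barrier_le_lin (z : V) g0 g1 a0.
    have h3 : L * (enorm (a + (z : V)) `^ g - enorm a `^ g) <= P * enorm a * enorm (z : V).
      by rewrite /P -!mulrA ler_pM2l// !mulrA.
    move: pz; rewrite ler_norml => /andP[h4 _].
    move: h1 h3 h4; clear; lra.
  apply: (@le_trans _ _ ((P * enorm a * enorm (z : V) + `|u (x + (z : V)) - u x|) * K z)).
    apply: ler_wpM2r; first exact: K0.
    rewrite [leRHS]addrC; apply: lerD; first exact: ler_norm.
    by rewrite lerNl; move: pz; rewrite ler_norml => /andP[].
  rewrite mulrDl; apply: lerD.
    apply: le_trans (kernel_linear_le hK P0 ra az) _.
    apply: ler_wpM2r; first exact: rz0.
    by apply: ler_wpM2r; [exact: La0|move: P0; clear; lra].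
  exact: (kernel_far_le hs hl hK).
rewrite RintegralD; [|exact: measurableT|exact: (leb_integrableZ (2 * P * Lambda) sr)|exact: (leb_integrableZ (far_const n s Lambda) st)].
rewrite !RintegralZl; [|exact: measurableT|exact: st|exact: measurableT|exact: sr].
apply: lerD; last by apply: ler_wpM2l => //; exact: far_const_ge0 hl.
have PL0 : 0 <= 2 * P * Lambda by apply: mulr_ge0 => //; apply: mulr_ge0.
apply: le_trans (ler_wpM2l PL0 Ir) _.
have -> : enorm a `^ (g - 2 * s) = enorm a `^ (g - 2) * enorm a `^ (2 - 2 * s).
  by rewrite -gt0_powRD//; congr powR; ring.
by rewrite le_eqVlt; apply/orP; left; apply/eqP; rewrite /P; ring.
Qed.


End holder.

Section holder_estimate.
Context (R : realType) (n : nat).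
Local Notation V := 'rV[R]_n.+1.
Local Notation mu := (leb R n).

(** Here X is A^(1 / m), o the oscillation and C (X + o) the future [L]: the coercive term k L^m
    absorbs the rest. The assumption m >= 2 gives C L <= L^2 <= L^m. *)
Lemma holder_constant (m k B1 B3 : R) : 2 <= m -> 0 < k -> 0 <= B1 -> 0 <= B3 ->
  exists2 C : R, 4 <= C & forall X o, 1 <= X -> 0 <= o ->
    B1 * (C * (X + o)) + B3 * X `^ m < k * (C * (X + o)) `^ m.
Proof.
move=> m2 k0 B10 B30; exists (4 + (B1 + B3) / k); first by rewrite lerDl divr_ge0 ?addr_ge0// ltW.
set C := 4 + _; move=> X o X1 o0.
have C4 : 4 <= C by rewrite lerDl divr_ge0 ?addr_ge0// ltW.
have C0 : 0 < C by apply: lt_le_trans C4.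
have CB : B1 + B3 < k * C by rewrite /C mulrDr mulrCA divff ?gt_eqF// mulr1 ltrDr mulr_gt0.
set L := C * (X + o).
have XL : C * X <= L by rewrite ler_pM2l// lerDl.
have CX : C <= C * X by rewrite ler_peMr// ltW.
have L1 : 1 <= L by apply: le_trans XL; apply: le_trans CX; apply: le_trans C4; rewrite ler1n.
have L0 : 0 < L := lt_le_trans ltr01 L1.
have Lm : 0 < L `^ m by rewrite powR_gt0.
have h1 : C * L <= L `^ m.
  rewrite (_ : m = 1 + (m - 1)); last by ring.
  rewrite gt0_powRS// mulrC ler_pM2l//; apply: (@le_trans _ _ L); first exact: le_trans XL.
  by apply: le1r_powR => //; move: m2; lra.
have h2 : C * X `^ m <= L `^ m.
  apply: (@le_trans _ _ ((C * X) `^ m)); last first.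
    apply: ge0_ler_powR; rewrite ?nnegrE; [lra|by rewrite mulr_ge0 ?ltW//; lra|exact: ltW|exact: XL].
  rewrite powRM; [|exact: ltW|by lra].
  apply: ler_wpM2r; first exact: powR_ge0.
  by apply: le1r_powR; [lra|lra].
rewrite -(ltr_pM2l C0) mulrDr.
apply: (@le_lt_trans _ _ ((B1 + B3) * L `^ m)).
  have := ler_wpM2l B10 h1; have := ler_wpM2l B30 h2; clear; lra.
by rewrite mulrA (mulrC C) ltr_pM2r.
Qed.

Lemma holder_estimate (s lambda Lambda m kappa : R) :
  1 / 2 < s < 1 -> 0 < lambda <= Lambda -> 2 * s + 1 <= m -> 0 < kappa ->
  exists2 C : R, 0 < C & forall alpha (K f u : V -> R) H (r : R) (c x : V),
    0 <= alpha -> kernel_bounds s lambda Lambda K -> continuous f -> continuous u ->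
    L1_weighted s u -> coercive m kappa H -> 0 < r ->
    viscosity_subsolution alpha K H f (eball 0 (r + 2)) u ->
    eball 0 (r + 1) c -> enorm (x - c) <= 1 / 2 ->
    u x - u c <= C * (Aconst s alpha r f u `^ m^-1 + osc (eball 0 (r + 2)) u) *
      enorm (x - c) `^ gamma0 s m.
Proof.
move=> hs hl ms k0; set g := gamma0 s m.
have [s1 s2] := andP hs.
have m2 : 2 <= m by move: ms s1; clear; lra.
have m10 : 0 < m - 1 by move: m2; clear; lra.
have m0 : 0 < m by move: m2; clear; lra.
have g0 : 0 < g by rewrite divr_gt0//; move: ms; clear; lra.
have g1 : g <= 1 by rewrite ler_pdivrMr// mul1r; move: s1; clear; lra.
(* The defining balance of [gamma0]: with |p| of order L |a|^(g - 1), the terms |p|^m and the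
   nonlocal one carry the same power of |a|. *)
have gm : (g - 1) * m = g - 2 * s by rewrite /g /gamma0; field; rewrite gt_eqF.
have gs : g - 2 * s <= 0 by move: g1 s1; clear; lra.
have La0 : 0 <= Lambda by move: hl => /andP[l0 lL]; exact: le_trans (ltW l0) lL.
set k := kappa^-1 * g `^ m.
have k1 : 0 < k by rewrite mulr_gt0 ?invr_gt0 ?powR_gt0.
set B1 := 2 * Lambda * riesz_const n s.
have B10 : 0 <= B1.
  by apply: mulr_ge0; [exact: mulr_ge0|exact/ltW/riesz_const_gt0].
have F0 := far_const_ge0 n s hl.
set B3 := kappa + far_const n s Lambda + 1.
have B30 : 0 <= B3 by rewrite /B3; move: F0 k0; clear; lra.
have [C C4 hC] := holder_constant m2 k1 B10 B30.
have C0 : 0 < C by move: C4; clear; lra.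
exists C => // alpha K f u H r c x a0 hK cf cu Lu hH r0 hu cr xc.
have [A1 tA fA] := Aconst_ge hs a0 r0 cf cu Lu.
set A := Aconst _ _ _ _ _ in A1 tA fA *; set X := A `^ m^-1.
set o := osc _ u; set L := C * (X + o).
have r2 : 0 < r + 2 by move: r0; clear; lra.
have o0 : 0 <= o := osc_ge0 r2 cu.
have A0 : 0 < A := lt_le_trans ltr01 A1.
have Xm : X `^ m = A by rewrite -powRrM mulVf ?gt_eqF// powRr1// ltW.
have X1 : 1 <= X by rewrite -(powRr0 A); apply: ler_powR => //; rewrite invr_ge0 ltW.
have hL := hC X o X1 o0; rewrite Xm -/L in hL.
have L0 : 0 < L by rewrite mulr_gt0//; move: X1 o0; clear; lra.
pose psi (y : V) := u y - L * enorm (y - c) `^ g.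
have cpsi : continuous psi.
  have c1 : continuous (fun y : V => y - c).
    by move=> y; apply: continuousB; [exact: cvg_id|exact: cst_continuous].
  have c2 : continuous (fun y : V => enorm (y - c) `^ g).
    move=> y; rewrite (_ : (fun y : V => _) = (fun t : R => `|t| `^ g) \o (fun y : V => enorm (y - c))); last first.
      by apply/funext => w /=; rewrite ger0_norm ?enorm_ge0.
    apply: continuous_comp; last exact: continuous_norm_powR.
    by apply: continuous_comp; [exact: c1|exact: enorm_continuous].
  by move=> y; exact: (cvgB (cu y) (cvgM (cvg_cst L) (c2 y))).
have ne : eclosed_ball c (1 / 2) !=set0 by exists x.
have [xb /set_mem xbc xbmax] := EVT_max_rV ne (@compact_eclosed_ball _ _ c (1 / 2)) (continuous_subspaceT cpsi).
rewrite -/L leNgt; apply/negP => hneg.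
set a := xb - c.
have psipos : u c < psi xb.
  apply: lt_le_trans (xbmax x _); last by rewrite inE.
  by move: hneg; rewrite /psi; clear; lra.
have cE (y : V) (t : R) : enorm (y - c) <= t -> enorm y < r + 1 + t.
  move=> yt; rewrite -(subrK c y) (le_lt_trans (enorm_triangle _ _))// addrC ltr_leD//.
  by move: cr; rewrite /eball /= subr0.
have cball : eball 0 (r + 2) c.
  by move: cr; rewrite /eball /= subr0; move=> h; apply: lt_trans h _; rewrite ltrD2l ltr1n.
have a_ne0 : a != 0.
  apply/eqP => a00; move: psipos; rewrite /psi -/a a00 enorm0 powR0 ?gt_eqF// mulr0 subr0.
  by rewrite -(subrK c xb) -/a a00 add0r ltxx.
have xb2 : eball 0 (r + 2) xb.
  rewrite /eball /= subr0; apply: lt_le_trans (cE _ _ xbc) _; clear; lra.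
have oL : o <= L / 4.
  rewrite ler_pdivlMr// mulrC; apply: ler_pM => //; first by move: X1; clear; lra.
(* From C >= 4: the oscillation is at most L / 4, so |a| <= |a|^g < 1 / 4. This leaves room for
   shifts by 1 / 4 inside the ball where [xb] is a maximum point. *)
have a4 : enorm a <= 1 / 4.
  have h1 : L * enorm a `^ g < o.
    by apply: lt_le_trans (le_osc r2 cu xb2 cball); move: psipos; rewrite /psi -/a; clear; lra.
  have h2 : enorm a `^ g < 1 / 4.
    by rewrite -(ltr_pM2l L0); move: h1 oL; clear; lra.
  apply: ltW; apply: le_lt_trans h2; apply: ger1_powR => //.
  by rewrite enorm_gt0 a_ne0/=; apply: le_trans xbc _; clear; lra.
have hz (z : V) : enorm z <= 1 / 4 -> u (xb + z) - u xb <= L * (enorm (a + z) `^ g - enorm a `^ g).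
  move=> z4; have := xbmax (xb + z); rewrite /psi [xb + z - c]addrAC -/a inE /eclosed_ball /=.
  have : enorm (xb + z - c) <= 1 / 2.
    rewrite addrAC -/a; apply: le_trans (enorm_triangle _ _) _; move: a4 z4; clear; lra.
  by move=> -> /(_ isT); clear; lra.
have := holder_integral_le hs hl hK cu Lu r2 xb2 g0 g1 L0 a_ne0 a4 hz.
have ra : 0 < enorm a by rewrite enorm_gt0.
have hd : 0 < enorm a <= 1 by rewrite ra /=; move: a4; clear; lra.
set p := _ *: a; set cc := _ / 2.
have := subsolution_quadratic hs hl hK (p := p) (c := cc) hd cu Lu r2 hu xb2.
have ttest z : enorm z < enorm a -> u (xb + z) - u xb <= dotp p z + cc * enorm z ^+ 2.
  move=> za; apply: le_trans (hz z _) _; first by apply: ltW; apply: lt_le_trans za a4.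
  have := power_barrier_le_quad z g0 g1 a_ne0; rewrite -(ler_pM2l L0) => /le_trans; apply.
  by rewrite /p /cc dotpZl le_eqVlt; apply/orP; left; apply/eqP; field.
move=> /(_ ttest) h1 h2.
have h3 := hH xb p; have h4 := fA _ xb2.
set W := enorm a `^ (g - 2 * s) in h2.
(* Terms free of |a| may therefore be multiplied by W, which then divides out of the whole
   inequality. *)
have W1 : 1 <= W.
  by rewrite /W -[leLHS](powRr0 (enorm a)); apply: ger_powR.
have pE : kappa^-1 * enorm p `^ m = k * L `^ m * W.
  have Lg0 : 0 <= L * g by apply: mulr_ge0; exact: ltW.
  rewrite /p enormZ ger0_norm; last by apply: mulr_ge0 => //; exact: powR_ge0.
  rewrite (_ : L * g * _ * _ = L * g * (enorm a * enorm a `^ (g - 2))); last by ring.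
  rewrite -gt0_powRS// (_ : 1 + (g - 2) = g - 1); last by ring.
  rewrite (powRM _ Lg0 (powR_ge0 _ _)) (powRM _ (ltW L0) (ltW g0)) -powRrM gm /k /W.
  by ring.
have h5 : k * L `^ m * W <= B1 * L * W + B3 * A.
  have h6 : far_const n s Lambda * tail s u (eball 0 (r + 2)) <= far_const n s Lambda * A by apply: ler_wpM2l.
  have h7 : kappa <= kappa * A by rewrite ler_peMr// ltW.
  rewrite -pE; have -> : B3 * A = kappa * A + far_const n s Lambda * A + A by rewrite /B3; ring.
  have -> : B1 * L * W = 2 * L * Lambda * riesz_const n s * W by rewrite /B1; ring.
  move: h1 h2 h3 h4 h6 h7; clear.
  set I := \int[_]_(_ in _) _; set t1 := 2 * L * _ * _ * _; set t2 := far_const _ _ _ * _.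
  set t3 := far_const _ _ _ * _; set t4 := kappa * _; set t5 := alpha * _; lra.
have BA0 : 0 <= B3 * A by apply: mulr_ge0; [exact: B30|exact: ltW].
have h6 : B3 * A <= B3 * A * W by rewrite ler_peMr.
have : k * L `^ m * W < k * L `^ m * W.
  apply: le_lt_trans h5 _; apply: le_lt_trans (lerD (lexx _) h6) _.
  by rewrite -mulrDl ltr_pM2r// (lt_le_trans ltr01).
by rewrite ltxx.
Qed.

End holder_estimate.

(** * Doubling of variables *)

Section profile.
Context {R : realType} {n : nat}.
Implicit Types (th t b e : R) (a z : 'rV[R]_n.+1).

(** The factor 1 / 4 keeps the slope between 1 / 2 and 1 on [0, 1] when th <= 1. *)
Definition profile th t : R := t - t `^ (1 + th) / 4.

Definition dprofile th t : R := 1 - (1 + th) / 4 * t `^ th.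

Lemma profile_tangent th t0 t : 0 < th -> 0 < t0 -> 0 <= t ->
  profile th t <= profile th t0 + dprofile th t0 * (t - t0).
Proof.
move=> th0 t00 t_ge0; have b1 : 1 <= 1 + th by rewrite lerDl ltW.
have := powR_ge_tangent b1 t00 t_ge0; rewrite (_ : 1 + th - 1 = th); last by ring.
rewrite /profile /dprofile; set X := t0 `^ (1 + th); set Y := t `^ _; set W := t0 `^ th.
clear; lra.
Qed.

Lemma dprofile_bounds th t : 0 < th <= 1 -> 0 <= t <= 1 -> 1 / 2 <= dprofile th t <= 1.
Proof.
move=> /andP[th0 th1] /andP[t0 t1].
have h1 : t `^ th <= 1.
  rewrite [leRHS](_ : 1 = 1 `^ th); last by rewrite powR1.
  by apply: ge0_ler_powR; rewrite ?nnegrE// ltW.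
have h2 : (1 + th) * t `^ th <= 2 * 1.
  by apply: ler_pM; rewrite ?powR_ge0//; move: th0 th1; clear; lra.
have h3 : 0 <= (1 + th) * t `^ th by rewrite mulr_ge0 ?powR_ge0// addr_ge0// ltW.
by rewrite /dprofile mulrAC; apply/andP; split; move: h2 h3; clear; lra.
Qed.

Lemma profile_le th t : profile th t <= t.
Proof. by rewrite /profile gerBl divr_ge0 ?powR_ge0. Qed.

Lemma profile_ge th t : 0 < th -> 0 <= t <= 1 -> 3 / 4 * t <= profile th t.
Proof.
move=> th0 /andP[t0 t1]; have : t `^ (1 + th) <= t.
  move: t0; rewrite le_eqVlt => /predU1P[<-|t0]; first by rewrite powR0// gt_eqF// ltr_wpDr// ltW.
  by apply: ge1r_powR; rewrite ?t0//; move: th0; clear; lra.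
by rewrite /profile; clear; lra.
Qed.

Lemma profile_mono th t b : 0 < th <= 1 -> 0 <= t -> t <= b -> b <= 1 -> profile th t <= profile th b.
Proof.
move=> hth t0 tb b1; have [b0|b0] := leP b 0.
  by have -> : t = b by apply/eqP; rewrite eq_le tb (le_trans b0).
have [th0 _] := andP hth.
apply: le_trans (profile_tangent th0 b0 t0) _; rewrite gerDl mulr_ge0_le0 ?subr_le0//.
have hb : 0 <= b <= 1 by rewrite ltW.
by have /andP[h _] := dprofile_bounds hth hb; move: h; clear; lra.
Qed.

Lemma profileD_le th b e : 0 < th -> 0 <= b -> 0 <= e -> profile th (b + e) <= profile th b + e.
Proof.
move=> th0 b0 e0; have : b `^ (1 + th) <= (b + e) `^ (1 + th).
  by apply: ge0_ler_powR; rewrite ?nnegrE ?addr_ge0// ?lerDl// ltW.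
by rewrite /profile; clear; lra.
Qed.

Lemma profile_gap th : 0 < th -> exists2 k : R, 0 < k & forall t e, 0 < t -> t / 8 <= e ->
  profile th (t + e) <= profile th t + dprofile th t * e - k * t `^ (1 + th).
Proof.
move=> th0; have b1 : 1 < 1 + th by rewrite ltrDl.
have [k k0 hk] := powR_convex_gap b1; exists (k / 4); first by rewrite divr_gt0.
move=> t e t0 te; have := hk t e t0 te; rewrite (_ : 1 + th - 1 = th); last by ring.
rewrite /profile /dprofile; set X := t `^ (1 + th); set Y := (t + e) `^ _; set W := t `^ th.
clear; lra.
Qed.

Lemma enorm_le_of_sqr z b E e : 0 < b -> enorm z ^+ 2 <= b ^+ 2 + E -> E <= 2 * b * e ->
  enorm z <= b + e.
Proof.
move=> b0 h1 h2; apply: le_trans (enorm_le_amgm z b0) _.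
by rewrite ler_pdivrMr ?mulr_gt0//; move: h1 h2; clear; lra.
Qed.

(* [z] is close to the direction of [a]: the longitudinal part of the second
   difference is strictly negative by strict concavity of the profile, and the
   transversal part is of order [eta ^+ 2 * enorm a]. *)
Lemma profile_second_difference th k eta a z : 0 < th <= 1 ->
  (forall t e, 0 < t -> t / 8 <= e ->
    profile th (t + e) <= profile th t + dprofile th t * e - k * t `^ (1 + th)) ->
  a != 0 -> enorm a <= 1 / 4 -> 0 <= eta <= 1 / 16 -> 3 * eta ^+ 2 <= k * enorm a `^ th ->
  enorm (z - (3 / 16) *: a) <= eta * enorm a ->
  profile th (enorm (a + z)) + profile th (enorm (a - z)) - 2 * profile th (enorm a) <=
    - (k / 2 * enorm a `^ (1 + th)).
Proof.
move=> hth hk a0 a4 /andP[eta0 eta1] etak hz; have [th0 th1] := andP hth.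
have ra : 0 < enorm a by rewrite enorm_gt0.
set w := z - _ in hz; have zE : z = (3 / 16) *: a + w by rewrite addrC subrK.
(* [q] and [tau] are the components of [w] and [z] along [a]. The bounds 3 / 16 plus or minus 1 / 16
   put tau between |a| / 8, as the concavity gap requires, and |a| / 4, which keeps |a| - tau above
   |a| / 2. *)
pose q := dotp a w / enorm a; pose tau := 3 / 16 * enorm a + q.
have qa : dotp a w = q * enorm a by rewrite divfK ?gt_eqF.
have qw : `|q| <= enorm w.
  rewrite normrM normfV (ger0_norm (ltW ra)) ler_pdivrMr// mulrC; exact: normr_dotp_le.
have wa : enorm w <= 1 / 16 * enorm a by apply: le_trans hz _; rewrite ler_pM2r.
have w2 : enorm w ^+ 2 <= eta ^+ 2 * enorm a ^+ 2.
  by rewrite -exprMn ler_pXn2r ?nnegrE ?enorm_ge0// mulr_ge0// ltW.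
have [t1 t2] : enorm a / 8 <= tau /\ tau <= enorm a / 4.
  have := le_trans qw wa; rewrite ler_norml => /andP[].
  by rewrite /tau; split; lra.
have az : dotp a z = tau * enorm a.
  by rewrite zE dotpDr dotpZr dotpxx qa /tau; ring.
have z2 : enorm z ^+ 2 <= tau ^+ 2 + enorm w ^+ 2.
  rewrite zE enormD_sqr dotpZl qa enormZ ger0_norm; last by clear; lra.
  rewrite exprMn /tau; have : 0 <= q ^+ 2 by exact: sqr_ge0.
  by clear; lra.
have e0 : 0 <= eta ^+ 2 * enorm a by rewrite mulr_ge0 ?sqr_ge0// ltW.
have ee : eta ^+ 2 * enorm a <= 1 / 16 * enorm a.
  rewrite ler_pM2r// expr2; apply: le_trans (_ : 1 / 16 * (1 / 16) <= _); last by clear; lra.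
  exact: ler_pM.
have E2 : enorm w ^+ 2 <= enorm a * (eta ^+ 2 * enorm a) by rewrite mulrCA -expr2.
have P1 : enorm (a + z) <= enorm a + tau + eta ^+ 2 * enorm a / 2.
  apply: (@enorm_le_of_sqr _ _ (enorm w ^+ 2)).
  - by move: t1 ra; clear; lra.
  - by rewrite enormD_sqr az; move: z2; clear; lra.
  have : 0 <= tau * (eta ^+ 2 * enorm a) by rewrite mulr_ge0//; move: t1 ra; clear; lra.
  by move: E2; clear; lra.
have P2 : enorm (a - z) <= enorm a - tau + eta ^+ 2 * enorm a.
  apply: (@enorm_le_of_sqr _ _ (enorm w ^+ 2)).
  - by move: t2 ra; clear; lra.
  - by rewrite enormD_sqr dotpNr az enormN; move: z2; clear; lra.
  have : 0 <= (enorm a - 2 * tau) * (eta ^+ 2 * enorm a) by rewrite mulr_ge0//; move: t2 ra; clear; lra.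
  by move: E2; clear; lra.
have h1 : profile th (enorm (a + z)) <= profile th (enorm a) + dprofile th (enorm a) * tau
    - k * enorm a `^ (1 + th) + eta ^+ 2 * enorm a / 2.
  apply: (@le_trans _ _ (profile th (enorm a + tau + eta ^+ 2 * enorm a / 2))).
    apply: profile_mono => //; first exact: enorm_ge0.
    by move: a4 t2 ee ra; clear; lra.
  apply: le_trans (profileD_le th0 _ _) _; [by move: t1 ra; clear; lra|by move: e0; clear; lra|].
  by rewrite lerD2r; exact: hk.
have h2 : profile th (enorm (a - z)) <= profile th (enorm a) - dprofile th (enorm a) * tau + eta ^+ 2 * enorm a.
  apply: (@le_trans _ _ (profile th (enorm a - tau + eta ^+ 2 * enorm a))).
    apply: profile_mono => //; first exact: enorm_ge0.
    by move: a4 t1 ee ra; clear; lra.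
  have bt : 0 <= enorm a - tau by move: t2 ra; clear; lra.
  apply: le_trans (profileD_le th0 bt e0) _; rewrite lerD2r.
  apply: le_trans (profile_tangent th0 ra bt) _.
  by rewrite le_eqVlt; apply/orP; left; apply/eqP; ring.
(* The transversal errors at [a + z] and [a - z] are 1 / 2 and 1 times eta^2 |a|; the constant 3
   makes their sum half of the concavity gain. *)
have h3 : 3 * eta ^+ 2 * enorm a <= k * enorm a `^ (1 + th).
  rewrite gt0_powRS// [leRHS]mulrCA [leLHS]mulrC; apply: ler_wpM2l; [exact: ltW|exact: etak].
rewrite -mulrA in h3; move: h1 h2 h3.
move: (profile th (enorm (a + z))) (profile th (enorm (a - z))) (profile th (enorm a)) => Y1 Y2 Y3.
move: (dprofile th (enorm a)) (enorm a `^ (1 + th)) (eta ^+ 2 * enorm a) => Y4 Y5 Y6.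
move: (tau) => Y7.
clear; lra.
Qed.

End profile.

(** * Difference of the nonlocal terms at two points *)

Section ishii_lions_integral.
Context (R : realType) (n : nat).
Local Notation V := 'rV[R]_n.+1.
Local Notation mu := (leb R n).

(** The integrands are compared at the same [z], where the [p] terms cancel. Inside [delta] the
    coefficients c1 and c2 remain, up to 1 / 4 the penalization M, with the gain Gam on a cube, and
    beyond it the two tails and the drift of [q]. *)
Lemma ishii_lions_integral_le (s lambda Lambda : R) (K u : V -> R) (x y p q a : V)
    (r c1 c2 delta M l Gam : R) :
  1 / 2 < s < 1 -> 0 < lambda <= Lambda -> kernel_bounds s lambda Lambda K ->
  continuous u -> L1_weighted s u -> 0 < r -> eball 0 r x -> eball 0 r y ->
  a != 0 -> enorm a <= 1 / 4 -> 0 <= l -> n.+1%:R * l <= 1 / 16 * enorm a ->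
  0 < delta -> delta <= enorm a / 8 -> c2 <= c1 -> 0 <= M -> 0 <= Gam ->
  (forall z, enorm z <= 1 / 4 ->
    (u (x + z) - u x - dotp z (p + q)) - (u (y + z) - u y - dotp z p) <= M * enorm z ^+ 2) ->
  (forall z, enorm (z - (3 / 16) *: a) <= n.+1%:R * l ->
    (u (x + z) - u x - dotp z (p + q)) - (u (y + z) - u y - dotp z p) <= M * enorm z ^+ 2 - Gam) ->
  \int[mu]_z operator_integrand K u x (p + q) c1 delta z -
    \int[mu]_z operator_integrand K u y p c2 delta z <=
  (M + 4 * enorm q) * Lambda * riesz_const n s +
  (c1 - c2) * Lambda * riesz_const n s * delta `^ (2 - 2 * s) +
  far_const n s Lambda * (2 * tail s u (eball 0 r)) -
  Gam * lambda * enorm a `^ (- (n.+1%:R + 2 * s)) * (2 * l) ^+ n.+1.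
Proof.
move=> hs hl hK cu Lu r0 xr yr a0 a4 l0 la d0 da c12 M0 G0 hz hG.
have ra : 0 < enorm a by rewrite enorm_gt0.
have hd : 0 < delta <= 1 by rewrite d0 /=; move: da a4; clear; lra.
have La0 : 0 <= Lambda by move: hl => /andP[l0' lL]; exact: le_trans (ltW l0') lL.
have F0 := far_const_ge0 n s hl.
have [sx Ix] := tail_ge hs r0 cu Lu xr.
have [sy Iy] := tail_ge hs r0 cu Lu yr.
have q4 : 0 < 1 / 4 :> R by clear; lra.
have [s4 I4] := leb_integrable_riesz n hs q4.
have [sd Id] := leb_integrable_riesz n hs d0.
pose B : V * V := (\row_i ((3 / 16) *: a) 0 i - const_mx l, \row_i ((3 / 16) *: a) 0 i + const_mx l).
have volB : mu (box B) = ((2 * l) ^+ n.+1)%:E.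
  rewrite [LHS]leb_boxE /box_volume; congr EFin.
  rewrite (eq_bigr (fun=> 2 * l)); first by rewrite prodr_const card_ord.
  by move=> i _; rewrite /= !mxE max_r; move: l0; clear; lra.
have [sG IG] := leb_integrable_indic (measurable_box B) volB.
have inB z : box B z -> enorm (z - (3 / 16) *: a) <= n.+1%:R * l.
  move=> zB; apply: enorm_le_coord => i; have := zB i; rewrite /= !mxE => /andP[h1 h2].
  by rewrite ler_norml; apply/andP; split; move: h1 h2; clear; lra.
(* The cube avoids the ball of radius [delta], stays in the ball of radius 1 / 4, and satisfies |z|
   <= |a|, so that K z is at least lambda |a|^(-D) on it. *)
have rangeB z : box B z -> enorm a / 8 <= enorm z /\ enorm z <= enorm a / 4.
  move=> /inB h; have {}h := le_trans h la; set w := z - _ in h.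
  have zE : z = (3 / 16) *: a + w by rewrite addrC subrK.
  have aE : enorm ((3 / 16) *: a) = 3 / 16 * enorm a by rewrite enormZ ger0_norm//; clear; lra.
  have h1 : enorm z <= 3 / 16 * enorm a + enorm w by rewrite zE -aE; exact: enorm_triangle.
  have h2 : 3 / 16 * enorm a <= enorm z + enorm w.
    rewrite -aE (_ : (3 / 16) *: a = z - w); last by rewrite zE addrK.
    by rewrite -(enormN w); exact: enorm_triangle.
  by split; move: h h1 h2; clear; lra.
set X1 := (M + 4 * enorm q) * Lambda.
set X2 := (c1 - c2) * Lambda.
set X3 := Gam * lambda * _.
have q0 := enorm_ge0 q.
have X10 : 0 <= X1.
  by apply: mulr_ge0; [apply: addr_ge0; [exact: M0|apply: mulr_ge0; [|exact: q0]]|exact: La0].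
have X20 : 0 <= X2 by apply: mulr_ge0; [rewrite subr_ge0|exact: La0].
have X30 : 0 <= X3.
  apply: mulr_ge0; last exact: powR_ge0.
  by apply: mulr_ge0; [exact: G0|move: hl => /andP[/ltW]].
have sF1 := leb_integrable_operator_integrand hs hl hK (p + q) c1 hd cu Lu r0 xr.
have sF2 := leb_integrable_operator_integrand hs hl hK p c2 hd cu Lu r0 yr.
have sT := leb_integrableD sx sy.
have sA := leb_integrableD (leb_integrableZ X1 s4) (leb_integrableZ X2 sd).
have sC := leb_integrableD sA (leb_integrableZ (far_const n s Lambda) sT).
have sB := leb_integrableB sC (leb_integrableZ X3 sG).
rewrite -RintegralB; [|exact: measurableT|exact: sF1|exact: sF2].
apply: (@le_trans _ _ (\int[mu]_z (X1 * riesz s (1 / 4) z + X2 * riesz s delta z +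
    far_const n s Lambda * (tail_density s u x z + tail_density s u y z) - X3 * \1_(box B) z))).
  apply: le_Rintegral; [exact: measurableT|exact: (leb_integrableB sF1 sF2)|exact: sB|].
  move=> z _; rewrite /operator_integrand.
  have rz0 := riesz_ge0 s (z : V) (ltW q4).
  have rd0 := riesz_ge0 s (z : V) (ltW d0).
  have tx0 := tail_density_ge0 s u x z.
  have ty0 := tail_density_ge0 s u y z.
  have B1 : 0 <= X1 * riesz s (1 / 4) z by apply: mulr_ge0; [exact: X10|exact: rz0].
  have B2 : 0 <= X2 * riesz s delta z by apply: mulr_ge0; [exact: X20|exact: rd0].
  have B3 : 0 <= far_const n s Lambda * (tail_density s u x z + tail_density s u y z).
    by apply: mulr_ge0; [exact: F0|apply: addr_ge0; [exact: tx0|exact: ty0]].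
  have outB : ~ box B z -> \1_(box B) z = 0 :> R.
    by move=> zB; rewrite indicE memNset.
  have [zd|dz] := ltP (enorm (z : V)) delta.
    rewrite outB; last first.
      by move=> /rangeB[h _]; move: h zd da; clear; lra.
    rewrite mulr0 subr0; apply: ler_wpDr; first exact: B3.
    apply: ler_wpDl; first exact: B1.
    have [z0|z0] := eqVneq (z : V) 0.
      by rewrite z0 enorm0 expr0n/= !mulr0 !mul0r subrr -z0.
    rewrite -mulrBl -mulrBl; apply: (kernel_quadratic_le hK) => //; [by rewrite subr_ge0|exact: ltW].
  have z0 : (z : V) != 0 by rewrite -enorm_gt0 (lt_le_trans d0).
  have K0 := kernel_ge0 hl hK z0.
  rewrite -mulrBl.
  have [z4|z4] := ltP (enorm (z : V)) (1 / 4).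
    rewrite indicE [(z : V) \in eball 0 1]mem_set; last first.
      by rewrite /eball /= subr0; move: z4; clear; lra.
    rewrite (mul1r (dotp _ (p + q))) (mul1r (dotp _ p)).
    have Q1 : M * enorm (z : V) ^+ 2 * K z <= X1 * riesz s (1 / 4) z.
      apply: le_trans (kernel_quadratic_le hK M0 z0 (ltW z4)) _.
      apply: ler_wpM2r; first exact: rz0.
      by apply: ler_wpM2r; [exact: La0|rewrite lerDl; apply: mulr_ge0; [|exact: q0]].
    have [zB|zB] := pselect (box B z); last first.
      rewrite outB// mulr0 subr0; apply: ler_wpDr; first exact: B3.
      apply: ler_wpDr; first exact: B2.
      apply: le_trans Q1; apply: ler_wpM2r; first exact: K0.
      exact: hz (ltW z4).
    rewrite indicE [(z : V) \in box B]mem_set// mulr1.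
    have h1 := hG _ (inB _ zB).
    have h2 := ler_wpM2r K0 h1.
    apply: (le_trans h2); rewrite mulrBl; apply: lerB.
      by apply: ler_wpDr; [exact: B3|apply: ler_wpDr; [exact: B2|exact: Q1]].
    rewrite /X3 -mulrA; apply: ler_wpM2l; first exact: G0.
    have /andP[Kl _] := hK.2 _ z0.
    apply: le_trans Kl; apply: ler_wpM2l; first by move: hl => /andP[/ltW].
    have ez0 : 0 < enorm (z : V) by rewrite enorm_gt0.
    have [_ zub] := rangeB _ zB.
    rewrite !powRN lef_pV2 ?posrE ?powR_gt0//.
    apply: ge0_ler_powR; rewrite ?nnegrE; [|exact: ltW|exact: ltW|].
      by rewrite addr_ge0// mulr_ge0//; move: hs => /andP[h _]; move: h; clear; lra.
    by move: zub ra; clear; lra.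
  rewrite outB; last first.
    by move=> /rangeB[_ h]; move: h z4 a4; clear; lra.
  rewrite mulr0 subr0.
  (* The factor 4 (1 / 4) puts |q| |z| in the shape of [kernel_linear_le] at radius 1 / 4, whence
     the 4 |q| in the statement. *)
  apply: (@le_trans _ _ ((4 * enorm q * (1 / 4) * enorm (z : V) + (`|u (x + (z : V)) - u x| + `|u (y + (z : V)) - u y|)) * K z)).
    apply: ler_wpM2r; first exact: K0.
    have h1 := ler_norm (u (x + (z : V)) - u x).
    have h2 := ler_norm (- (u (y + (z : V)) - u y)); rewrite normrN in h2.
    have h3 : - (\1_(eball 0 1) (z : V) * dotp (z : V) q) <= enorm q * enorm (z : V).
      apply: le_trans (ler_norm _) _; rewrite normrN normrM ger0_norm ?indicE//.
      apply: (@le_trans _ _ `|dotp (z : V) q|); first by rewrite ler_piMl//; case: (_ \in _).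
      by rewrite mulrC normr_dotp_le.
    rewrite dotpDr; move: h1 h2 h3; clear; set t1 := `|_|; set t2 := `|_|; set i := \1_(_) _; lra.
  rewrite mulrDl; apply: lerD.
    apply: ler_wpDr; first exact: B2.
    apply: le_trans (kernel_linear_le hK _ q4 z4) _; first by apply: mulr_ge0; [|exact: q0].
    apply: ler_wpM2r; first exact: rz0.
    by apply: ler_wpM2r; [exact: La0|rewrite lerDr].
  apply: le_trans (kernel_far_le hs hl hK _ z4) _; first exact: addr_ge0.
  by apply: ler_wpM2l; [exact: F0|rewrite mulrDl].
rewrite RintegralB; [|exact: measurableT|exact: sC|exact: (leb_integrableZ X3 sG)].
rewrite RintegralD; [|exact: measurableT|exact: sA|exact: (leb_integrableZ (far_const n s Lambda) sT)].
rewrite RintegralD; [|exact: measurableT|exact: (leb_integrableZ X1 s4)|exact: (leb_integrableZ X2 sd)].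
rewrite !RintegralZl; try exact: measurableT; [|exact: sG|exact: sT|exact: sd|exact: s4].
rewrite RintegralD; [|exact: measurableT|exact: sx|exact: sy].
rewrite IG; apply: lerB; last by [].
apply: lerD; last first.
  by apply: ler_wpM2l; [exact: F0|move: Ix Iy; clear; lra].
apply: lerD; last by rewrite -mulrA; apply: ler_wpM2l; [exact: X20|exact: Id].
apply: ler_wpM2l; first exact: X10.
apply: le_trans I4 _; rewrite ler_piMr//; first exact/ltW/riesz_const_gt0.
rewrite [leRHS](_ : 1 = 1 `^ (2 - 2 * s)); last by rewrite powR1.
apply: ge0_ler_powR; rewrite ?nnegrE; [|exact: ltW|by []|by clear; lra].
by move: hs => /andP[_ h]; move: h; clear; lra.
Qed.

End ishii_lions_integral.

(** * Ingredients of the doubling argument *)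

Section ishii_lions.
Context (R : realType) (n : nat).
Local Notation V := 'rV[R]_n.+1.
Local Notation mu := (leb R n).

(** The exponent collects 1 + th from concavity, -(d + 2 s) from the kernel and d (1 + th / 2) from
    the volume of the cube; the dimension cancels except in th d / 2. *)
Lemma gain_eq (s lambda k th e0 L t : R) : 0 < t -> 0 <= e0 ->
  L * (k / 2) * t `^ (1 + th) * lambda * t `^ (- (n.+1%:R + 2 * s)) *
    (2 * (e0 * t `^ (th / 2) * t / n.+1%:R)) ^+ n.+1 =
  k / 2 * lambda * (2 * e0 / n.+1%:R) ^+ n.+1 * (L * t `^ (1 - 2 * s + th * (1 + n.+1%:R / 2))).
Proof.
move=> t0 e00.
rewrite (_ : 2 * (e0 * _ * t / _) = (2 * e0 / n.+1%:R) * (t * t `^ (th / 2))); last first.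
  by rewrite mulrACA mulrC; ring.
rewrite exprMn -gt0_powRS// -[(t `^ _) ^+ n.+1]powR_mulrn ?powR_ge0// -powRrM.
rewrite (_ : 1 - 2 * s + _ = (1 + th) + (- (n.+1%:R + 2 * s)) + (1 + th / 2) * n.+1%:R); last first.
  by field.
rewrite !(gt0_powRD _ _ t0); ring.
Qed.

(** The bound t L <= 2 Z takes one power of L off t |p|^m, so this term and the one in [q] are both
    of order Z L^(m - 1). *)
Lemma hamiltonian_le (m H0 CHr Z L t ep eq : R) : 1 <= m -> 1 <= L -> 0 <= Z -> 0 <= CHr ->
  0 <= t -> 0 <= ep -> ep <= L -> 0 <= eq -> eq <= 8 * Z -> 8 * Z <= L -> t * L <= 2 * Z ->
  `|H0| <= CHr * (t * (1 + ep `^ m) + 2 * eq * (ep + eq) `^ (m - 1)) ->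
  `|H0| <= (4 + 16 * 2 `^ (m - 1)) * (CHr * Z * L `^ (m - 1)).
Proof.
move=> m1 L1 Z0 C0 t0 ep0 epL eq0 eqZ ZL tL /le_trans; apply.
have L0 : 0 < L := lt_le_trans ltr01 L1.
have m10 : 0 <= m - 1 by rewrite subr_ge0.
have Lm0 : 0 <= L `^ (m - 1) by exact: powR_ge0.
have LmE : L `^ m = L * L `^ (m - 1) by rewrite mulr_powRB1// ?(ltW L0)// (lt_le_trans ltr01).
have Lm1 : 1 <= L `^ m.
  by rewrite -[leLHS](powRr0 L); apply: ler_powR => //; exact: le_trans m1.
have h1 : t * (1 + ep `^ m) <= 4 * (Z * L `^ (m - 1)).
  have h2 : ep `^ m <= L `^ m.
    by apply: ge0_ler_powR; rewrite ?nnegrE ?(ltW L0)//; exact: le_trans m1.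
  apply: (@le_trans _ _ (t * (L `^ m + L `^ m))); first by apply: ler_wpM2l => //; exact: lerD.
  have := ler_wpM2r Lm0 tL; rewrite LmE; clear; lra.
have h3 : (ep + eq) `^ (m - 1) <= 2 `^ (m - 1) * L `^ (m - 1).
  rewrite -powRM ?(ltW L0)//; apply: ge0_ler_powR; rewrite ?nnegrE.
  - exact: m10.
  - exact: addr_ge0.
  - by apply: mulr_ge0; [|exact: ltW].
  by move: epL eqZ ZL; clear; lra.
have h4 : 2 * eq * (ep + eq) `^ (m - 1) <= 16 * Z * (2 `^ (m - 1) * L `^ (m - 1)).
  apply: ler_pM => //; [by rewrite mulr_ge0|exact: powR_ge0|].
  by move: eqZ; clear; lra.
have h5 := ler_wpM2l C0 (lerD h1 h4).
apply: le_trans h5 _; rewrite le_eqVlt; apply/orP; left; apply/eqP; ring.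
Qed.

(** This chooses [delta]: B is the coefficient of the inner contribution and e = 2 - 2 s, so that
    this contribution is at most 1 however large B is. *)
Lemma exists_small_power (B e t : R) : 0 <= B -> 0 < e -> 0 < t ->
  exists2 d : R, 0 < d <= t & B * d `^ e <= 1.
Proof.
move=> B0 e0 t0; have B1 : 0 < B + 1 by rewrite ltr_wpDl.
have B1' : 0 < (B + 1)^-1 by rewrite invr_gt0.
exists (Num.min t ((B + 1)^-1 `^ e^-1)).
  by rewrite lt_min t0 powR_gt0//= ge_min lexx.
have : Num.min t ((B + 1)^-1 `^ e^-1) `^ e <= (B + 1)^-1.
  rewrite -[leRHS](powRr1 (ltW B1')) -(mulVf (lt0r_neq0 e0)) powRrM.
  apply: ge0_ler_powR; rewrite ?nnegrE ?powR_ge0 ?(ltW e0)//.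
    by rewrite le_min (ltW t0) powR_ge0.
  by rewrite ge_min lexx orbT.
move=> /(ler_wpM2l B0)/le_trans; apply.
by rewrite ler_pdivrMr// mul1r lerDl.
Qed.

(* The doubling function, written in the variables [x] and [w = x - y]. *)
Definition doubling (u : V -> R) (th L M : R) (x0 : V) (c : V * V) : R :=
  u c.1 - u (c.1 - c.2) - L * profile th (enorm c.2) - M * enorm (c.1 - x0) ^+ 2.

Lemma continuous_doubling u th L M x0 : 0 < th -> continuous u ->
  continuous (doubling u th L M x0).
Proof.
move=> th0 cu.
have c1 : continuous (fun c : V * V => c.1) by move=> c; exact: cvg_fst.
have c2 : continuous (fun c : V * V => c.2) by move=> c; exact: cvg_snd.
have cB : continuous (fun c : V * V => c.1 - c.2) by move=> c; exact: (cvgB (c1 c) (c2 c)).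
have cx : continuous (fun c : V * V => c.1 - x0) by move=> c; exact: (cvgB (c1 c) (cvg_cst x0)).
have cn2 : continuous (fun c : V * V => enorm c.2).
  by move=> c; apply: continuous_comp; [exact: c2|exact: enorm_continuous].
have cnx : continuous (fun c : V * V => enorm (c.1 - x0)).
  by move=> c; apply: continuous_comp; [exact: cx|exact: enorm_continuous].
have cp : continuous (fun c : V * V => enorm c.2 `^ (1 + th)).
  move=> c; rewrite (_ : (fun c : V * V => _) = (fun t : R => `|t| `^ (1 + th)) \o (fun c : V * V => enorm c.2)); last first.
    by apply/funext => w /=; rewrite ger0_norm ?enorm_ge0.
  by apply: continuous_comp; [exact: cn2|apply: continuous_norm_powR; rewrite addr_gt0].
have cu1 : continuous (fun c : V * V => u c.1).
  by move=> c; apply: continuous_comp; [exact: c1|exact: cu].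
have cu2 : continuous (fun c : V * V => u (c.1 - c.2)).
  by move=> c; apply: continuous_comp; [exact: cB|exact: cu].
have cpr : continuous (fun c : V * V => profile th (enorm c.2)).
  rewrite /profile => c.
  have h : enorm y.2 `^ (1 + th) / 4 @[y --> c] --> enorm c.2 `^ (1 + th) / 4.
    by apply: cvgMl; exact: cp.
  exact: (cvgB (cn2 c) h).
move=> c; exact: (cvgB (cvgB (cvgB (cu1 c) (cu2 c)) (cvgM (cvg_cst L) (cpr c)))
  (cvgM (cvg_cst M) (cvgM (cnx c) (cnx c)))).
Qed.

Lemma doubling_max u th L M x0 : 0 < th -> continuous u -> exists x a : V,
  [/\ enorm (x - x0) <= 1 / 2, enorm a <= 1 / 2 & forall x' a', enorm (x' - x0) <= 1 / 2 ->
    enorm a' <= 1 / 2 -> doubling u th L M x0 (x', a') <= doubling u th L M x0 (x, a)].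
Proof.
move=> th0 cu.
have h2 : 0 <= 1 / 2 :> R by clear; lra.
have ne : eclosed_ball x0 (1 / 2) `*` eclosed_ball (0 : V) (1 / 2) !=set0.
  by exists (x0, 0); split; rewrite /eclosed_ball /= subrr enorm0.
have cpt := compact_setX (@compact_eclosed_ball _ _ x0 (1 / 2)) (@compact_eclosed_ball _ _ (0 : V) (1 / 2)).
have [[x a] /set_mem[/= xb ab] hmax] := compact_EVT_max ne cpt (continuous_subspaceT (@continuous_doubling u th L M x0 th0 cu)).
rewrite /eclosed_ball /= subr0 in ab.
exists x, a; split=> // x' a' x'b a'b; apply: hmax; rewrite inE.
by split; rewrite /eclosed_ball //= subr0.
Qed.

(* Maximality, tested by moving [x] to [x + z1] and [y = x - a] to [y + z2]. *)
Lemma doubling_max_perturb u th L M x0 x a z1 z2 :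
  (forall x' a', enorm (x' - x0) <= 1 / 2 ->
    enorm a' <= 1 / 2 -> doubling u th L M x0 (x', a') <= doubling u th L M x0 (x, a)) ->
  enorm (x - x0) <= 1 / 4 -> enorm a <= 1 / 4 -> enorm z1 <= 1 / 4 -> enorm (z1 - z2) <= 1 / 4 ->
  u (x + z1) - u x - (u (x - a + z2) - u (x - a)) <=
    L * (profile th (enorm (a + (z1 - z2))) - profile th (enorm a)) +
    dotp ((2 * M) *: (x - x0)) z1 + M * enorm z1 ^+ 2.
Proof.
move=> hmax hx ha h1 h2; have := hmax (x + z1) (a + (z1 - z2)).
have e1 : enorm (x + z1 - x0) <= 1 / 2.
  by rewrite addrAC; apply: le_trans (enorm_triangle _ _) _; move: hx h1; clear; lra.
have e2 : enorm (a + (z1 - z2)) <= 1 / 2.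
  by apply: le_trans (enorm_triangle _ _) _; move: ha h2; clear; lra.
move=> /(_ e1 e2); rewrite /doubling /= [x + z1 - x0]addrAC [enorm (x - x0 + z1) ^+ 2]enormD_sqr dotpZl.
rewrite (_ : x + z1 - (a + (z1 - z2)) = x - a + z2); last first.
  by apply/rowP => i; rewrite !mxE; ring.
move: (profile th _) (profile th _) => P1 P2; clear; lra.
Qed.

End ishii_lions.

(** * The inequality at the maximum and the Lipschitz criterion *)

Section ishii_lions_core.
Context (R : realType) (n : nat).
Local Notation V := 'rV[R]_n.+1.
Local Notation mu := (leb R n).

(* At a maximum point of the doubling function, subtracting the two viscosity
   inequalities bounds the concavity gain from above. *)
Lemma doubling_viscosity (s lambda Lambda m th k e0 alpha : R) (K f u : V -> R)
    (H : V -> V -> R) (CH : R -> R) (r L : R) (x0 x a : V) :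
  1 / 2 < s < 1 -> 0 < lambda <= Lambda -> 1 <= m -> 0 < th <= 1 -> 0 <= alpha ->
  (forall t e, 0 < t -> t / 8 <= e ->
    profile th (t + e) <= profile th t + dprofile th t * e - k * t `^ (1 + th)) ->
  0 < k -> 0 < e0 -> e0 <= 1 / 16 -> 3 * e0 ^+ 2 <= k ->
  kernel_bounds s lambda Lambda K -> continuous f -> continuous u -> L1_weighted s u ->
  growth m H CH -> 0 < r -> viscosity_solution alpha K H f (eball 0 (r + 2)) u ->
  16 * Z2 s r f u <= L -> eball 0 (r + 2) x -> eball 0 (r + 2) (x - a) ->
  a != 0 -> enorm a <= 1 / 4 -> enorm (x - x0) <= 1 / 4 ->
  3 / 4 * L * enorm a <= u x - u (x - a) ->
  (forall x' a', enorm (x' - x0) <= 1 / 2 -> enorm a' <= 1 / 2 ->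
    doubling u th L (16 * Z2 s r f u) x0 (x', a') <= doubling u th L (16 * Z2 s r f u) x0 (x, a)) ->
  k / 2 * lambda * (2 * e0 / n.+1%:R) ^+ n.+1 *
    (L * enorm a `^ (1 - 2 * s + th * (1 + n.+1%:R / 2))) <=
  (48 * Lambda * riesz_const n s + 2 * far_const n s Lambda + 2) * Z2 s r f u +
  (4 + 16 * 2 `^ (m - 1)) * (CH (r + 2) * Z2 s r f u * L `^ (m - 1)).
Proof.
move=> hs hl m1 hth al0 hk k0 e00 e01 ek hK cf cu Lu hH r0 [hsub hsup] ZL xr yr a0 a4 xx0 uL hmax.
have [th0 th1] := andP hth.
have [Z1' oZ fZ tZ] := Z2_ge hs r0 cf cu Lu.
have r2 : 0 < r + 2 by move: r0; clear; lra.
set Z := Z2 s r f u in ZL hmax Z1' oZ fZ tZ *.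
set y := x - a in yr uL *.
set M := 16 * Z in ZL hmax.
have ra : 0 < enorm a by rewrite enorm_gt0.
have M0 : 0 <= M by rewrite /M; move: Z1'; clear; lra.
have L0 : 0 < L by move: ZL Z1'; rewrite /M; clear; lra.
have uxy : u x - u y <= Z by apply: le_trans (le_osc r2 cu xr yr) oZ.
have fxy : f x - f y <= Z by apply: le_trans (le_osc r2 cf xr yr) fZ.
set d := dprofile th (enorm a).
have /andP[d1 d2] : 1 / 2 <= d <= 1.
  by apply: dprofile_bounds => //; rewrite ltW//=; move: a4; clear; lra.
(* [c] is the coefficient of the paraboloid touching the barrier at [a]; the slope p = 2 c a has
   length L d, and [q] is the gradient of the penalization at [x]. *)
pose c := L * d / (2 * enorm a).
have d0 : 0 <= d by move: d1; clear; lra.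
have c0 : 0 <= c by apply: divr_ge0; apply: mulr_ge0 => //; exact: ltW.
pose p := (2 * c) *: a; pose q := (2 * M) *: (x - x0).
have pE : enorm p = L * d.
  rewrite enormZ ger0_norm; last by apply: mulr_ge0.
  by rewrite /c; field; rewrite gt_eqF.
have pL : enorm p <= L by rewrite pE ler_piMr// ltW.
have qE : enorm q <= 8 * Z.
  rewrite enormZ ger0_norm; last by apply: mulr_ge0.
  have M20 : 0 <= 2 * M by apply: mulr_ge0.
  by apply: le_trans (ler_wpM2l M20 xx0) _; rewrite /M; clear; lra.
have pert z1 z2 : enorm z1 <= 1 / 4 -> enorm (z1 - z2) <= 1 / 4 ->
    u (x + z1) - u x - (u (y + z2) - u y) <=
    L * (profile th (enorm (a + (z1 - z2))) - profile th (enorm a)) + dotp q z1 + M * enorm z1 ^+ 2.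
  by move=> h1 h2; exact: doubling_max_perturb.
have n0 : enorm (0 : V) <= 1 / 4 by rewrite enorm0; clear; lra.
have quad w : L * (profile th (enorm (a + w)) - profile th (enorm a)) <= dotp p w + c * enorm w ^+ 2.
  have h1 := profile_tangent th0 ra (enorm_ge0 (a + w)).
  have h2 := ler_wpM2l d0 (enormD_le_amgm w a0).
  have h3 : profile th (enorm (a + w)) - profile th (enorm a) <= d * ((dotp a w + enorm w ^+ 2 / 2) / enorm a).
    by apply: le_trans h2; rewrite lerBlDl.
  apply: le_trans (ler_wpM2l (ltW L0) h3) _.
  rewrite /p dotpZl /c le_eqVlt; apply/orP; left; apply/eqP; field.
  by rewrite gt_eqF.
(* Only [x] moves here, and only [y] in [testy]; the barrier is replaced by its paraboloid. *)
have testx z : enorm z <= 1 / 4 -> u (x + z) - u x <= dotp (p + q) z + (c + M) * enorm z ^+ 2.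
  move=> z4; have := pert z 0 z4; rewrite subr0 addr0 subrr subr0 => /(_ z4).
  have := quad z; rewrite dotpDl; move: (L * _) (enorm z ^+ 2) => P E.
  clear; lra.
have testy z : enorm z <= 1 / 4 -> dotp p z + (- c) * enorm z ^+ 2 <= u (y + z) - u y.
  move=> z4; have := pert 0 z n0; rewrite sub0r enormN addr0 subrr sub0r => /(_ z4).
  have := quad (- z); rewrite enormN dotpNr enorm0 expr0n /= mulr0 addr0.
  rewrite -(scale0r (0 : V)) dotpZr mul0r addr0.
  move: (L * _) (enorm z ^+ 2) => P E; clear; lra.
(* Equal shifts of both points leave [a] unchanged, so the barrier drops out and only the
   penalization remains. *)
have hz z : enorm z <= 1 / 4 ->
    (u (x + z) - u x - dotp z (p + q)) - (u (y + z) - u y - dotp z p) <= M * enorm z ^+ 2.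
  move=> z4; have := pert z z z4; rewrite subrr enorm0 addr0 subrr mulr0 add0r => /(_ _).
  have q4 : 0 <= 1 / 4 :> R by clear; lra.
  move=> /(_ q4); rewrite dotpDr (dotpC q); move: (enorm z ^+ 2) => E; clear; lra.
(* The largest order for which eta^2 |a| stays below the concavity gain of order |a|^(1 + th). *)
pose eta := e0 * enorm a `^ (th / 2).
have aM1 : enorm a <= 1 by move: a4; clear; lra.
have at1 : enorm a `^ (th / 2) <= 1.
  rewrite -[leRHS](powRr0 (enorm a)); apply: ger_powR; first by rewrite ra.
  by rewrite divr_ge0// ltW.
have eta0 : 0 <= eta by apply: mulr_ge0; [exact: ltW|exact: powR_ge0].
have eta1 : eta <= 1 / 16.
  by apply: le_trans e01; rewrite /eta ler_piMr// ltW.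
have etak : 3 * eta ^+ 2 <= k * enorm a `^ th.
  rewrite /eta exprMn -[(_ `^ _) ^+ 2]powR_mulrn ?powR_ge0// -powRrM divfK// mulrA.
  by apply: ler_wpM2r => //; exact: powR_ge0.
pose l := eta * enorm a / n.+1%:R.
have nl : n.+1%:R * l = eta * enorm a by rewrite /l mulrC divfK.
have l0 : 0 <= l by apply: divr_ge0 => //; apply: mulr_ge0 => //; exact: ltW.
pose Gam := L * (k / 2) * enorm a `^ (1 + th).
have G0 : 0 <= Gam.
  apply: mulr_ge0; last exact: powR_ge0.
  by apply: mulr_ge0; [exact: ltW|apply: divr_ge0 => //; exact: ltW].
(* Shifting one point at a time moves [a] to [a + z] and to [a - z]; the sum of the two inequalities
   contains the second difference of the profile. *)
have hG z : enorm (z - (3 / 16) *: a) <= n.+1%:R * l ->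
    (u (x + z) - u x - dotp z (p + q)) - (u (y + z) - u y - dotp z p) <= M * enorm z ^+ 2 - Gam.
  rewrite nl => za.
  have z4 : enorm z <= 1 / 4.
    rewrite -(subrK ((3 / 16) *: a) z); apply: le_trans (enorm_triangle _ _) _.
    have e316 : 0 <= 3 / 16 :> R by clear; lra.
    rewrite enormZ (ger0_norm e316).
    have : eta * enorm a <= 1 / 16 * enorm a by rewrite ler_pM2r.
    by move: za a4; clear; lra.
  have eta01 : 0 <= eta <= 1 / 16 by rewrite eta0.
  have := profile_second_difference hth hk a0 a4 eta01 etak za.
  rewrite -(ler_pM2l L0) => h.
  have h1 := pert z 0 z4; rewrite subr0 addr0 subrr subr0 in h1; have {}h1 := h1 z4.
  have h2 := pert 0 z n0; rewrite sub0r enormN addr0 subrr sub0r enorm0 expr0n /= mulr0 addr0 in h2.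
  have {}h2 := h2 z4; rewrite -(scale0r (0 : V)) dotpZr mul0r addr0 in h2.
  rewrite dotpDr (dotpC z q) /Gam; move: h h1 h2.
  move: (profile th _) (profile th _) (profile th _) (enorm z ^+ 2) (enorm a `^ _) => P1 P2 P3 E A.
  clear; lra.
have e2s : 0 < 2 - 2 * s by move: hs => /andP[_ h]; move: h; clear; lra.
have La0 : 0 <= Lambda by move: hl => /andP[l0' lL]; exact: le_trans (ltW l0') lL.
have C0 := riesz_const_gt0 n hs.
have cM0 : 0 <= c + M - - c by rewrite opprK; move: c0 M0; clear; lra.
have B0 : 0 <= (c + M - - c) * Lambda * riesz_const n s.
  by apply: mulr_ge0; [apply: mulr_ge0|exact: ltW].
have ra8 : 0 < enorm a / 8 by rewrite divr_gt0.
have [delta /andP[de0 de1] deB] := exists_small_power B0 e2s ra8.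
have hd : 0 < delta <= 1 by rewrite de0 /=; move: de1 a4; clear; lra.
have hd4 : delta <= 1 / 4 by move: de1 a4; clear; lra.
have la : n.+1%:R * l <= 1 / 16 * enorm a by rewrite nl ler_pM2r.
have c21 : - c <= c + M by rewrite -subr_ge0.
have I := ishii_lions_integral_le hs hl hK cu Lu r2 xr yr a0 a4 l0 la de0 de1 c21 M0 G0 hz hG.
have S1 : alpha * u x + H x (p + q) <= \int[mu]_z operator_integrand K u x (p + q) (c + M) delta z + f x.
  apply: (subsolution_quadratic hs hl hK hd cu Lu r2 hsub xr) => z zd.
  by apply: testx; apply: ltW; exact: lt_le_trans zd hd4.
have S2 : \int[mu]_z operator_integrand K u y p (- c) delta z + f y <= alpha * u y + H y p.
  apply: (supersolution_quadratic hs hl hK hd cu Lu r2 hsup yr) => z zd.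
  by apply: testy; apply: ltW; exact: lt_le_trans zd hd4.
(* The zeroth order term has the favourable sign because u x >= u y at the maximum. *)
have uxy0 : 0 <= alpha * (u x - u y).
  apply: mulr_ge0 => //; apply: le_trans uL; apply: mulr_ge0; last exact: ltW.
  by apply: mulr_ge0; [clear; lra|exact: ltW].
have [CH0 _] := hH _ r2.
have HH : `|H x (p + q) - H y p| <= (4 + 16 * 2 `^ (m - 1)) * (CH (r + 2) * Z * L `^ (m - 1)).
  have := growth_all m1 r2 hH p q xr yr; rewrite (_ : x - y = a); last by rewrite /y opprB addrC subrK.
  apply: hamiltonian_le => //.
  - by move: ZL Z1'; rewrite /M; clear; lra.
  - by move: Z1'; clear; lra.
  - exact: ltW.
  - exact: ltW.
  - exact: enorm_ge0.
  - exact: enorm_ge0.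
  - by move: ZL Z1'; rewrite /M; clear; lra.
  by move: uL uxy Z1'; rewrite -mulrA (mulrC L); move: (enorm a * L) => E; clear; lra.
rewrite -gain_eq//; last exact: ltW.
move: I; rewrite -/Gam -/eta -/l.
set G := Gam * _ * _ * _ => I.
have F0 := far_const_ge0 n s hl.
(* 48 = 16 + 4 * 8, from M = 16 Z and |q| <= 8 Z. *)
have h1 : (M + 4 * enorm q) * Lambda * riesz_const n s <= 48 * Lambda * riesz_const n s * Z.
  rewrite [leRHS](_ : _ = (48 * Z) * Lambda * riesz_const n s); last by ring.
  apply: ler_wpM2r; first exact: ltW.
  by apply: ler_wpM2r => //; rewrite /M; move: qE; clear; lra.
have h2 : far_const n s Lambda * (2 * tail s u (eball 0 (r + 2))) <= 2 * far_const n s Lambda * Z.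
  rewrite [leRHS](_ : _ = far_const n s Lambda * (2 * Z)); last by ring.
  by apply: ler_wpM2l => //; move: tZ; clear; lra.
move: HH; rewrite ler_norml => /andP[HH _].
move: I S1 S2 uxy0 HH h1 h2 deB fxy Z1'; clear.
set I1 := \int[_]_(_ in _) _; set I2 := \int[_]_(_ in _) _.
move: (H x (p + q)) (H y p) (L `^ (m - 1)) ((M + _) * _ * _) (far_const n s Lambda * (2 * _)) (_ * delta `^ _) => H1 H2 E T1 T2 T3.
move: (48 * Lambda * _) (2 * far_const n s Lambda) ((4 + _) * _) => T4 T5 T6.
move: I1 I2 => I1 I2; lra.
Qed.

(** The last hypothesis is restricted to pairs with the properties of the maximum point, so that
    each regime can feed in its own bound on |x - y| in terms of [L]. *)
Lemma ishii_lions (s lambda Lambda m th : R) :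
  1 / 2 < s < 1 -> 0 < lambda <= Lambda -> 1 <= m -> 0 < th <= 1 ->
  exists2 C : R, 0 < C & forall alpha (K f u : V -> R) (H : V -> V -> R) (CH : R -> R) (r L : R),
    0 <= alpha -> kernel_bounds s lambda Lambda K -> continuous f -> continuous u ->
    L1_weighted s u -> growth m H CH -> 0 < r ->
    viscosity_solution alpha K H f (eball 0 (r + 2)) u ->
    16 * Z2 s r f u <= L ->
    (forall x y, eball 0 (r + 1) x -> eball 0 (r + 1) y -> x != y -> enorm (x - y) <= 1 / 4 ->
      3 / 4 * L * enorm (x - y) <= u x - u y ->
      C * (Z2 s r f u + CH (r + 2) * Z2 s r f u * L `^ (m - 1)) <
        L * enorm (x - y) `^ (1 - 2 * s + th * (1 + n.+1%:R / 2))) ->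
    lipschitz_on_ball r L u.
Proof.
move=> hs hl m1 hth; have [th0 th1] := andP hth.
have [k k0 hk] := profile_gap th0.
pose e0 := Num.min (1 / 16) (k / 3).
have e00 : 0 < e0 by rewrite lt_min; apply/andP; split; [clear; lra|exact: divr_gt0].
have e01 : e0 <= 1 / 16 by rewrite ge_min lexx.
have ek : 3 * e0 ^+ 2 <= k.
  have h1 : e0 <= k / 3 by rewrite ge_min lexx orbT.
  have h2 : e0 * e0 <= e0 by rewrite ler_piMl ?(ltW e00)//; move: e01; clear; lra.
  by rewrite expr2; move: h1 h2; clear; lra.
have La0 : 0 < Lambda by move: hl => /andP[l0 lL]; exact: lt_le_trans l0 lL.
have l0 : 0 < lambda by move: hl => /andP[].
have C0 := riesz_const_gt0 n hs.
have F0 := far_const_ge0 n s hl.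
set g := k / 2 * lambda * (2 * e0 / n.+1%:R) ^+ n.+1.
have g0 : 0 < g.
  apply: mulr_gt0; first by apply: mulr_gt0 => //; exact: divr_gt0.
  by apply: exprn_gt0; apply: divr_gt0 => //; exact: mulr_gt0.
set A1 := 48 * Lambda * riesz_const n s + 2 * far_const n s Lambda + 2.
set A2 := 4 + 16 * 2 `^ (m - 1).
have A10 : 0 < A1.
  apply: addr_gt0 => //; apply: ltr_wpDr; first exact: mulr_ge0.
  by apply: mulr_gt0 => //; exact: mulr_gt0.
have A20 : 0 < A2 by apply: addr_gt0 => //; apply: mulr_gt0 => //; exact: powR_gt0.
exists ((A1 + A2) / g); first by apply: divr_gt0 => //; exact: addr_gt0.
move=> alpha K f u H CH r L al0 hK cf cu Lu hH r0 hsol ZL key.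
have [Z1' oZ fZ tZ] := Z2_ge hs r0 cf cu Lu.
have r2 : 0 < r + 2 by move: r0; clear; lra.
have L0 : 0 < L by move: ZL Z1'; clear; lra.
have sub (x : V) : eball 0 (r + 1) x -> eball 0 (r + 2) x.
  by rewrite /eball /= => h; apply: lt_trans h _; rewrite ltrD2l ltr1n.
have sub0 (x : V) : eball 0 r x -> eball 0 (r + 1) x.
  by rewrite /eball /= => h; apply: lt_trans h _; rewrite ltrDl.
have [CH0 _] := hH _ r2.
suff one x0 y0 : eball 0 r x0 -> eball 0 r y0 -> u x0 - u y0 <= L * enorm (x0 - y0).
  move=> x0 y0 xr yr; rewrite ler_norml; apply/andP; split; last exact: one.
  by rewrite lerNl opprB enormB; exact: one.
(* Points more than 1 / 2 apart need no doubling: the oscillation is at most Z2 <= L / 16. *)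
move=> xr yr; have [far|near] := ltP (1 / 2) (enorm (x0 - y0)).
  apply: le_trans (le_osc r2 cu (sub _ (sub0 _ xr)) (sub _ (sub0 _ yr))) _.
  have : L * (1 / 2) <= L * enorm (x0 - y0) by rewrite ler_pM2l// ltW.
  by move: oZ ZL Z1'; move: (enorm _) => E; clear; lra.
rewrite leNgt; apply/negP => hneg.
set M := 16 * Z2 s r f u in ZL.
have [x [a [xx0 aa hmax]]] := doubling_max L M x0 th0 cu.
have pos : 0 < doubling u th L M x0 (x, a).
  have := hmax x0 (x0 - y0); rewrite subrr enorm0 => /(_ _ near).
  have h2 : 0 <= 1 / 2 :> R by clear; lra.
  move=> /(_ h2); apply: lt_le_trans.
  rewrite /doubling /= subrr enorm0 expr0n /= mulr0 subr0 (_ : x0 - (x0 - y0) = y0); last first.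
    by rewrite opprB addrC subrK.
  rewrite subr_gt0; apply: le_lt_trans hneg; rewrite ler_pM2l//; exact: profile_le.
rewrite /doubling /= in pos.
have aa1 : 0 <= enorm a <= 1 by rewrite enorm_ge0 /=; move: aa; clear; lra.
have pa := profile_ge th0 aa1.
have LP : 3 / 4 * L * enorm a <= L * profile th (enorm a).
  by rewrite mulrAC mulrC ler_pM2l.
have M0 : 0 <= M by rewrite /M; move: Z1'; clear; lra.
have Mx : 0 <= M * enorm (x - x0) ^+ 2 by apply: mulr_ge0 => //; exact: sqr_ge0.
have La : 0 <= 3 / 4 * L * enorm a.
  by apply: mulr_ge0; [apply: mulr_ge0; [clear; lra|exact: ltW]|exact: enorm_ge0].
have uL : 3 / 4 * L * enorm a <= u x - u (x - a).
  move: pos LP Mx; move: (_ * profile _ _) (M * _) (3 / 4 * _ * _) => T1 T2 T3; clear; lra.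
have nx (t : R) (z w : V) : eball 0 t z -> enorm w <= 1 / 2 -> eball 0 (t + 1 / 2) (z + w).
  rewrite /eball /= !subr0 => zt wt; apply: le_lt_trans (enorm_triangle _ _) _.
  exact: ltr_leD.
have xr1 : eball 0 (r + 1 / 2) x.
  by have := nx _ _ _ xr xx0; rewrite [x0 + _]addrC subrK.
have yr1 : eball 0 (r + 1) (x - a).
  have := nx _ _ (- a) xr1; rewrite enormN => /(_ aa); rewrite /eball /= !subr0.
  by move=> h; apply: lt_le_trans h _; clear; lra.
have xr1' : eball 0 (r + 1) x.
  by move: xr1; rewrite /eball /= !subr0 => h; apply: lt_le_trans h _; clear; lra.
have uZ : u x - u (x - a) <= Z2 s r f u by apply: le_trans oZ; apply: le_osc => //; exact: sub.
have a0 : a != 0.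
  have th10 : 1 + th != 0 by rewrite gt_eqF// addr_gt0.
  apply/eqP => a00; move: pos; rewrite a00 subr0 subrr enorm0 /profile (powR0 th10).
  rewrite mul0r subrr mulr0 subr0 sub0r oppr_gt0 => h.
  by move: (le_lt_trans Mx h); rewrite ltxx.
have a4 : enorm a <= 1 / 4.
  rewrite -(ler_pM2l L0); move: uL uZ ZL Z1'; rewrite /M -mulrA.
  by move: (L * enorm a) => E; clear; lra.
(* The value M = 16 Z2 is chosen for this: positivity of the maximum bounds the penalization by
   Z2. *)
have x4 : enorm (x - x0) <= 1 / 4.
  have h : M * enorm (x - x0) ^+ 2 <= M * (1 / 4) ^+ 2.
    have h1 : M * enorm (x - x0) ^+ 2 <= Z2 s r f u.
      move: pos uZ LP La; move: (M * _ ^+ 2) (_ * profile _ _) (3 / 4 * _ * _) => T1 T2 T3; clear; lra.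
    by apply: le_trans h1 _; rewrite /M; clear; lra.
  have M0' : 0 < M by rewrite /M; move: Z1'; clear; lra.
  rewrite -(@ler_pXn2r _ 2) ?nnegrE ?enorm_ge0//.
  by rewrite -(ler_pM2l M0').
have G := doubling_viscosity hs hl m1 hth al0 hk k0 e00 e01 ek hK cf cu Lu hH r0 hsol ZL
  (sub _ xr1') (sub _ yr1) a0 a4 x4 uL hmax.
have xy : x - (x - a) = a by rewrite opprB addrC subrK.
have xney : x != x - a by rewrite -subr_eq0 xy.
have := key x (x - a) xr1' yr1 xney; rewrite xy => /(_ a4 uL).
rewrite -(ltr_pM2l g0) mulrA mulrCA divff ?gt_eqF// mulr1 => h.
have := lt_le_trans h G; rewrite -/A1 -/A2; set T := _ * L `^ _.
have T0 : 0 <= T.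
  apply: mulr_ge0; last exact: powR_ge0.
  by apply: mulr_ge0; [exact: ltW|move: Z1'; clear; lra].
have Z0 : 0 <= Z2 s r f u by move: Z1'; clear; lra.
have h1 := mulr_ge0 (ltW A20) Z0; have h2 := mulr_ge0 (ltW A10) T0.
move: (A1) (A2) (T) (Z2 s r f u) h1 h2 => B1 B2 T' Z' h1 h2.
by move: h1 h2; clear; lra.
Qed.

End ishii_lions_core.

(** * Choice of the constants and conclusion *)

Section conclusion.
Context (R : realType).

(* [beta] is [m] in the coercive regime and [2 * s] in the other one. *)
Lemma constant_choice (beta m theta0 C1 B rho : R) :
  1 <= m -> 0 < beta + 1 - m - theta0 -> 0 < C1 -> 0 < B -> 0 < rho ->
  exists2 C : R, 0 < C & forall Z CHr L, 1 <= Z -> rho <= CHr ->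
    L = C * CHr `^ (1 / (beta + 1 - m - theta0)) * Z `^ ((beta - theta0) / (beta + 1 - m - theta0)) ->
    16 * Z <= L /\ forall Z', 0 <= Z' -> Z' <= Z ->
      C1 * (Z' + CHr * Z' * L `^ (m - 1)) < L * (B * Z / L) `^ (- (beta - 1 - theta0)).
Proof.
set e := beta + 1 - m - theta0; set N := beta - theta0 => m1 e0 C10 B0 rho0.
have NE : N = e + (m - 1) by rewrite /N /e; ring.
have eN : e <= N by rewrite NE lerDl subr_ge0.
have N0 : 0 < N := lt_le_trans e0 eN.
(* Multiplied out, the claim reads Q Z^N (1 + CHr L^(m - 1)) < L^N at worst; [LN1] and [LN2] give
   half of the right side to each term. *)
pose Q := C1 * B `^ (N - 1).
have Q0 : 0 < Q by rewrite mulr_gt0// powR_gt0.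
have Q1 : 0 < 2 * Q + 1 by rewrite addr_gt0// mulr_gt0.
have inv0 (x : R) : 0 < x -> 0 <= x^-1 by move=> x0; rewrite invr_ge0 ltW.
have rhoe : 0 < rho `^ (1 / e) by rewrite powR_gt0.
(* [Ca] serves the Hamiltonian term. [Cb] serves 16 Z <= L and the term without [CHr], for which
   [CHr] is only known to be at least [rho]. *)
pose Ca := (2 * Q + 1) `^ e^-1; pose Cb := (16 + (2 * Q + 1) `^ N^-1) / rho `^ (1 / e).
have Ca0 : 0 < Ca by rewrite powR_gt0.
have Cb0 : 0 < Cb by rewrite divr_gt0// addr_gt0// powR_gt0.
exists (Ca + Cb); first exact: addr_gt0.
set C := Ca + Cb; have C0 : 0 < C by exact: addr_gt0.
move=> Z CHr L Z1 CHrho LE.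
have Z0 : 0 < Z := lt_le_trans ltr01 Z1.
have CHr0 : 0 < CHr := lt_le_trans rho0 CHrho.
have L0 : 0 < L by rewrite LE !mulr_gt0// powR_gt0.
have Ce : 2 * Q < C `^ e.
  apply: (@lt_le_trans _ _ (2 * Q + 1)); first by rewrite ltrDl.
  have CaE : Ca `^ e = 2 * Q + 1 by rewrite /Ca -powRrM mulVf ?gt_eqF// powRr1// ltW.
  by rewrite -CaE; apply: ge0_ler_powR; rewrite ?nnegrE ?lerDl ltW.
have Crho : 16 + (2 * Q + 1) `^ N^-1 <= C * rho `^ (1 / e).
  by rewrite -ler_pdivrMr// lerDr ltW.
have ZN : Z <= Z `^ (N / e).
  by apply: le1r_powR => //; rewrite ler_pdivlMr// mul1r.
have LZ : C * rho `^ (1 / e) * Z <= L.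
  rewrite LE; apply: ler_pM => //; [by rewrite mulr_ge0// ltW|exact: ltW|].
  apply: ler_wpM2l; first exact: ltW.
  apply: ge0_ler_powR; rewrite ?nnegrE; [by rewrite mul1r inv0|exact: ltW|exact: ltW|exact: CHrho].
have p0 : 0 <= (2 * Q + 1) `^ N^-1 by exact: powR_ge0.
split.
  apply: le_trans LZ; apply: ler_wpM2r; first exact: ltW.
  by apply: le_trans Crho; rewrite lerDl.
move=> Z' Z'0 Z'Z.
have LN1 : 2 * Q * Z `^ N < L `^ N.
  have h1 : (2 * Q + 1) `^ N^-1 * Z <= L.
    apply: le_trans LZ; apply: ler_wpM2r; first exact: ltW.
    by apply: le_trans Crho; rewrite lerDr.
  apply: (@lt_le_trans _ _ (((2 * Q + 1) `^ N^-1 * Z) `^ N)).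
    rewrite powRM ?(ltW Z0)// -powRrM mulVf ?gt_eqF// powRr1 ?(ltW Q1)//.
    by rewrite ltr_pM2r ?powR_gt0// ltrDl.
  apply: ge0_ler_powR; rewrite ?nnegrE; [exact: ltW|by rewrite mulr_ge0// ltW|exact: ltW|exact: h1].
(* The exponents of [CHr] and Z in [L] are the ones that make this identity hold. *)
have Le : L `^ e = C `^ e * CHr * Z `^ N.
  rewrite LE !powRM ?mulr_ge0 ?powR_ge0 ?(ltW C0)// -!powRrM.
  by rewrite mul1r mulVf ?gt_eqF// divfK ?gt_eqF// powRr1// ltW.
have LN2 : 2 * Q * (CHr * Z `^ N * L `^ (m - 1)) < L `^ N.
  have LNE : L `^ N = L `^ e * L `^ (m - 1) by rewrite -gt0_powRD// -NE.
  rewrite LNE Le [ltRHS](_ : _ = C `^ e * (CHr * Z `^ N * L `^ (m - 1))); last by ring.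
  by rewrite ltr_pM2r// !mulr_gt0// powR_gt0.
have BZ0 : 0 < B * Z by exact: mulr_gt0.
have rhsE : L * (B * Z / L) `^ (- (beta - 1 - theta0)) = L `^ N / (B `^ (N - 1) * Z `^ (N - 1)).
  rewrite (_ : beta - 1 - theta0 = N - 1); last by rewrite /N; ring.
  rewrite powRN powRM ?inv0 ?(ltW BZ0)// powRM ?(ltW B0) ?(ltW Z0)//.
  rewrite -[L^-1]powR_inv1 ?(ltW L0)// -powRrM mulN1r powRN.
  rewrite (_ : N = 1 + (N - 1)); last by ring.
  rewrite gt0_powRS// (_ : 1 + (N - 1) - 1 = N - 1); last by ring.
  have := powR_gt0 (N - 1) B0; have := powR_gt0 (N - 1) Z0; have := powR_gt0 (N - 1) L0.
  move: (B `^ _) (Z `^ _) (L `^ _) => b z l' l0 z0 b0.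
  by field; rewrite !gt_eqF.
rewrite rhsE ltr_pdivlMr; last by rewrite mulr_gt0// powR_gt0.
have ZNE : Z `^ N = Z * Z `^ (N - 1) by rewrite -gt0_powRS//; congr powR; ring.
have h0 : Z' + CHr * Z' * L `^ (m - 1) <= Z * (1 + CHr * L `^ (m - 1)).
  rewrite [leLHS](_ : _ = Z' * (1 + CHr * L `^ (m - 1))); last by ring.
  apply: ler_wpM2r => //; apply: addr_ge0 => //; apply: mulr_ge0; [exact: ltW|exact: powR_ge0].
apply: (@le_lt_trans _ _ (Q * Z `^ N + Q * (CHr * Z `^ N * L `^ (m - 1)))).
  have b0 : 0 <= C1 * (B `^ (N - 1) * Z `^ (N - 1)).
    by apply: mulr_ge0; [exact: ltW|apply: mulr_ge0; exact: powR_ge0].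
  rewrite mulrAC; apply: le_trans (ler_wpM2l b0 h0) _.
  by rewrite ZNE /Q le_eqVlt; apply/orP; left; apply/eqP; ring.
move: LN1 LN2; rewrite -!(mulrA 2).
move: (Q * Z `^ N) (Q * (_ * _ * _)) (L `^ N) => T1 T2 T3; clear; lra.
Qed.

Lemma lipschitz_regularity (n : nat) (s lambda Lambda alpha m kappa : R) :
  1 / 2 < s < 1 -> 0 < lambda <= Lambda -> 0 <= alpha -> 1 <= m -> 0 < kappa ->
  exists theta_max : R, 0 < theta_max <= 1 /\
   forall theta0 : R, 0 < theta0 < theta_max ->
   forall rho : R, 0 < rho ->
   exists C : R, 0 < C /\
   forall (K f u : 'rV[R]_n.+1 -> R) (H : 'rV[R]_n.+1 -> 'rV[R]_n.+1 -> R)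
      (CH : R -> R) (r : R),
    kernel_bounds s lambda Lambda K ->
    continuous f ->
    growth m H CH ->
    (2 * s + 1 <= m -> coercive m kappa H) ->
    0 < r ->
    continuous u -> L1_weighted s u ->
    viscosity_solution alpha K H f (eball 0 (r + 2)) u ->
    (2 * s + 1 <= m -> rho <= r ->
      lipschitz_on_ball r
        (C * CH (r + 2) `^ (1 / (1 - theta0)) *
         Num.max (Z1 s m alpha r f u) (Z2 s r f u)
           `^ ((m - theta0) / (1 - theta0))) u)
    /\
    (m < 2 * s + 1 -> rho <= CH (r + 2) ->
      lipschitz_on_ball r
        (C * CH (r + 2) `^ (1 / (2 * s + 1 - m - theta0)) *
         Z2 s r f u
           `^ ((2 * s - theta0) / (2 * s + 1 - m - theta0))) u).
Proof.
move=> hs hl al0 m1 k0; have [s1 s2] := andP hs.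
have d0 : 0 < 1 + n.+1%:R / 2 :> R by rewrite addr_gt0// divr_gt0.
have d1 : 1 <= 1 + n.+1%:R / 2 :> R by rewrite lerDl divr_ge0.
have th_ok (t : R) : 0 < t -> t <= 1 -> 0 < t / (1 + n.+1%:R / 2) <= 1.
  by move=> t0 t1; rewrite divr_gt0//= ler_pdivrMr// mul1r (le_trans t1).
have [ms|ms] := leP (2 * s + 1) m.
  have m10 : 0 < m - 1 by move: ms s1; clear; lra.
  have sm : 0 < 2 * s - 1 by move: s1; clear; lra.
  pose g := gamma0 s m.
  exists 1; split; first by rewrite ltr01 lexx.
  move=> theta0 /andP[t0 t1] rho rho0.
  (* This is theta0 (1 - g): since (1 - g) (m - 1) = 2 s - 1, the exponent of |x - y| becomes -(1 -
     g) (m - 1 - theta0), with beta = m. *)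
  pose th' := theta0 * (2 * s - 1) / (m - 1).
  have th'0 : 0 < th' by apply: divr_gt0 => //; exact: mulr_gt0.
  have th'1 : th' <= 1.
    rewrite ler_pdivrMr// mul1r.
    have : theta0 * (2 * s - 1) <= 2 * s - 1 by rewrite ler_piMl ?ltW.
    by move: ms s1 s2; clear; lra.
  have [C1 C10 hIL] := ishii_lions n hs hl m1 (th_ok _ th'0 th'1).
  have [Ch Ch0 hH] := holder_estimate n hs hl ms k0.
  have rg0 : 0 < rho `^ (1 - g) by rewrite powR_gt0.
  (* 4 / 3 inverts the factor in 3 / 4 L |x - y| <= u x - u y; the division by rho^(1 - g) pays for
     the factor r^(1 - g) of [Z1], as r >= rho. *)
  pose B := 4 / 3 * Ch / rho `^ (1 - g).
  have B0 : 0 < B by apply: divr_gt0 => //; apply: mulr_gt0 => //; apply: divr_gt0.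
  have k20 : 0 < (2 * kappa)^-1 by rewrite invr_gt0 mulr_gt0.
  have e0 : 0 < m + 1 - m - theta0 by move: t1; clear; lra.
  have [C C0 hC] := constant_choice m1 e0 C10 B0 k20.
  rewrite (_ : m + 1 - m - theta0 = 1 - theta0) in hC; last by ring.
  exists C; split=> // K f u H CH r hK cf hG hco r0 cu Lu hsol; split; last by [].
  move=> _ rr; have hco' := hco isT.
  have r2 : 0 < r + 2 by move: r0; clear; lra.
  have CHge := coercive_growth_ge m1 r2 hG k0 hco'.
  have [Z21 oZ _ _] := Z2_ge hs r0 cf cu Lu.
  set Z := Num.max _ _; set L := _ * Z `^ _.
  have ZZ2 : Z2 s r f u <= Z by rewrite le_max lexx orbT.
  have ZZ1 : Z1 s m alpha r f u <= Z by rewrite le_max lexx.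
  have Z1' : 1 <= Z by exact: le_trans ZZ2.
  have [LZ hL] := hC Z (CH (r + 2)) L Z1' CHge erefl.
  have Z20 : 0 <= Z2 s r f u by move: Z21; clear; lra.
  have L0 : 0 < L by move: LZ Z1'; clear; lra.
  apply: (hIL alpha K f u H CH r L) => //.
    by apply: le_trans LZ; apply: ler_wpM2l.
  move=> x y xr yr xy xy4 hxy.
  apply: (lt_le_trans (hL _ Z20 ZZ2)); rewrite ler_pM2l//.
  have a0 : 0 < enorm (x - y) by rewrite enorm_gt0 subr_eq0.
  set t := enorm (x - y) in xy4 hxy a0 *.
  have gE : (1 - g) = (2 * s - 1) / (m - 1) by rewrite /g /gamma0; field; rewrite gt_eqF.
  have -> : 1 - 2 * s + th' / (1 + n.+1%:R / 2) * (1 + n.+1%:R / 2) = (1 - g) * (- (m - 1 - theta0)).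
    by rewrite divfK ?gt_eqF// gE /th'; field; rewrite gt_eqF.
  rewrite powRrM; apply: powR_antitone.
  - exact: powR_gt0.
  - have xy2 : t <= 1 / 2 by move: xy4; clear; lra.
    have := hH alpha K f u H r y x al0 hK cf cu Lu hco' r0 hsol.1 yr xy2.
    rewrite -/g -/t; set X := _ + osc _ _ => hh.
    have X0 : 0 <= X by rewrite addr_ge0 ?powR_ge0// osc_ge0.
    have XZ : X <= Z / rho `^ (1 - g).
      rewrite ler_pdivlMr// mulrC; apply: le_trans ZZ1; rewrite /Z1 -/g -/X.
      apply: ler_wpM2r => //; apply: ge0_ler_powR; rewrite ?nnegrE; [|exact: ltW|exact: ltW|exact: rr].
      by rewrite gE divr_ge0 ?ltW.
    have tg0 : 0 < t `^ g by rewrite powR_gt0.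
    have tE : t = t `^ (1 - g) * t `^ g.
      by rewrite -gt0_powRD// (_ : 1 - g + g = 1) ?powRr1 ?ltW//; ring.
    rewrite ler_pdivlMr//.
    have h1 : 3 / 4 * L * t `^ (1 - g) <= Ch * X.
      rewrite -(ler_pM2r tg0) -[leLHS]mulrA -tE; exact: le_trans hxy hh.
    have h2 : Ch * X <= Ch * (Z / rho `^ (1 - g)) by rewrite ler_pM2l.
    have -> : B * Z = 4 / 3 * (Ch * (Z / rho `^ (1 - g))) by rewrite /B; ring.
    by move: h1 h2; move: (t `^ _) (Ch * X) (Ch * (_ / _)) => E1 E2 E3; clear; lra.
  - by rewrite oppr_le0; move: ms s1 t1; clear; lra.
(* The first bound keeps the exponent of |x - y| negative, the second one keeps the denominator 2 s
   + 1 - m - theta0 positive. *)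
pose tm := Num.min (2 * s - 1) (2 * s + 1 - m).
exists tm; split.
  rewrite lt_min ge_min; apply/andP; split; last by apply/orP; left; move: s2; clear; lra.
  by apply/andP; split; [move: s1; clear; lra|move: ms; clear; lra].
move=> theta0 /andP[t0]; rewrite lt_min => /andP[t1 t2] rho rho0.
have t1' : theta0 <= 1 by move: t1 s2; clear; lra.
have [C1 C10 hIL] := ishii_lions n hs hl m1 (th_ok _ t0 t1').
have e0 : 0 < 2 * s + 1 - m - theta0 by move: t2; clear; lra.
(* B = 2 exceeds 4 / 3, the factor in the bound of |x - y| by Z2 / L. *)
have [C C0 hC] := constant_choice m1 e0 C10 (ltr0n R 2) rho0.
exists C; split=> // K f u H CH r hK cf hG hco r0 cu Lu hsol; split; first by [].
move=> _ CHge; have r2 : 0 < r + 2 by move: r0; clear; lra.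
have [Z21 oZ _ _] := Z2_ge hs r0 cf cu Lu.
set Z := Z2 s r f u in Z21 oZ *; set L := _ * Z `^ _.
have [LZ hL] := hC Z (CH (r + 2)) L Z21 CHge erefl.
have Z20 : 0 <= Z by move: Z21; clear; lra.
have L0 : 0 < L by move: LZ Z21; clear; lra.
apply: (hIL alpha K f u H CH r L) => //.
move=> x y xr yr xy xy4 hxy.
apply: (lt_le_trans (hL _ Z20 (lexx _))); rewrite ler_pM2l//.
have a0 : 0 < enorm (x - y) by rewrite enorm_gt0 subr_eq0.
set t := enorm (x - y) in xy4 hxy a0 *.
rewrite divfK ?gt_eqF// (_ : 1 - 2 * s + theta0 = - (2 * s - 1 - theta0)); last by ring.
apply: powR_antitone => //; last by rewrite oppr_le0; move: t1; clear; lra.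
have sub (w : 'rV[R]_n.+1) : eball 0 (r + 1) w -> eball 0 (r + 2) w.
  by rewrite /eball /= => h; apply: lt_trans h _; rewrite ltrD2l ltr1n.
have h := le_trans hxy (le_trans (le_osc r2 cu (sub _ xr) (sub _ yr)) oZ).
rewrite ler_pdivlMr// mulrC; move: h Z20; rewrite -mulrA; move: (L * t) => E; clear; lra.
Qed.

End conclusion.

(* The dimension is d = n.+1.  [kappa] only matters when m >= 2s + 1.
   [rho] is a lower bound for the radius r (first regime), resp. for the
   constant CH (r + 2) of the Hamiltonian (second regime): the estimate cannot
   hold with a constant C that is uniform as these tend to 0. *)
Theorem theorem2p1 (R : realType) (n : nat) (s lambda Lambda alpha m kappa : R) :
  1 / 2 < s < 1 -> 0 < lambda <= Lambda -> 0 <= alpha -> 1 <= m -> 0 < kappa ->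
  (forall (K f u : 'rV[R]_n.+1 -> R) (H : 'rV[R]_n.+1 -> 'rV[R]_n.+1 -> R)
      (CH : R -> R) (r : R),
    kernel_bounds s lambda Lambda K ->
    continuous f ->
    continuous (fun z : 'rV[R]_n.+1 * 'rV[R]_n.+1 => H z.1 z.2) ->
    growth m H CH ->
    (2 * s + 1 <= m -> coercive m kappa H) ->
    0 < r ->
    continuous u -> L1_weighted s u ->
    viscosity_solution alpha K H f (eball 0 (r + 2)) u ->
    exists CR : R, 0 < CR /\ lipschitz_on_ball r CR u)
  /\
  (exists theta_max : R, 0 < theta_max <= 1 /\
   forall theta0 : R, 0 < theta0 < theta_max ->
   forall rho : R, 0 < rho ->
   exists C : R, 0 < C /\
   forall (K f u : 'rV[R]_n.+1 -> R) (H : 'rV[R]_n.+1 -> 'rV[R]_n.+1 -> R)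
      (CH : R -> R) (r : R),
    kernel_bounds s lambda Lambda K ->
    continuous f ->
    continuous (fun z : 'rV[R]_n.+1 * 'rV[R]_n.+1 => H z.1 z.2) ->
    growth m H CH ->
    (2 * s + 1 <= m -> coercive m kappa H) ->
    0 < r ->
    continuous u -> L1_weighted s u ->
    viscosity_solution alpha K H f (eball 0 (r + 2)) u ->
    (2 * s + 1 <= m -> rho <= r ->
      lipschitz_on_ball r
        (C * CH (r + 2) `^ (1 / (1 - theta0)) *
         Num.max (Z1 s m alpha r f u) (Z2 s r f u)
           `^ ((m - theta0) / (1 - theta0))) u)
    /\
    (m < 2 * s + 1 -> rho <= CH (r + 2) ->
      lipschitz_on_ball r
        (C * CH (r + 2) `^ (1 / (2 * s + 1 - m - theta0)) *
         Z2 s r f u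
           `^ ((2 * s - theta0) / (2 * s + 1 - m - theta0))) u)).
Proof.
move=> hs hl al0 m1 k0.
have [tm [/andP[tm0 tm1] hreg]] := @lipschitz_regularity R n s lambda Lambda alpha m kappa hs hl al0 m1 k0.
split; last first.
  exists tm; split; first by rewrite tm0.
  move=> theta0 ht rho rho0; have [C [C0 hC]] := hreg theta0 ht rho rho0.
  exists C; split=> // K f u H CH r hK cf _ hG hco r0 cu Lu hsol.
  exact: (hC K f u H CH r).
move=> K f u H CH r hK cf _ hG hco r0 cu Lu hsol.
have r2 : 0 < r + 2 by move: r0; clear; lra.
have [CH0 _] := hG _ r2.
have ht : 0 < tm / 2 < tm by apply/andP; split; move: tm0; clear; lra.
(* For one fixed solution [rho] may depend on the radius and on the Hamiltonian, so both lower
   bounds hold trivially. *)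
have rho0 : 0 < Num.min r (CH (r + 2)) by rewrite lt_min r0.
have [C [C0 hC]] := hreg _ ht _ rho0.
have [h1 h2] := hC K f u H CH r hK cf hG hco r0 cu Lu hsol.
have [L hL] : exists L, lipschitz_on_ball r L u.
  have [ms|ms] := leP (2 * s + 1) m.
    by eexists; apply: h1 => //; rewrite ge_min lexx.
  by eexists; apply: h2 => //; rewrite ge_min lexx orbT.
(* The absolute value and the 1 make the constant positive without inspecting the form of [L]. *)
exists (`|L| + 1); split; first by rewrite ltr_wpDl.
move=> x y xr yr; apply: le_trans (hL x y xr yr) _.
apply: ler_wpM2r; first exact: enorm_ge0.
by apply: le_trans (ler_norm L) _; rewrite lerDl.
Qed.
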